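(* For each pair $(a,b)\in\{(0,0),(1,0),(0,1),(1,1)\}$ there exist sequences of positive integers $(m_k)_{k\ge1},(n_k)_{k\ge1}$ satisfying Keane's condition such that the ergodic measures $\lambda_2,\lambda_3$ of the associated Keane type 4-interval exchange transformation satisfy $$\bigl(H_{dim}(\lambda_2,d_{\lambda_3}),\,H_{dim}(\lambda_3,d_{\lambda_2})\bigr)=(a,b).$$
   Context: **Keane type IETs.** For positive integers $m,n$ let $$A_{m,n}=\begin{pmatrix}0&0&1&1\\ m-1&m&0&0\\ n&n&n-1&n\\ 1&1&1&1\end{pmatrix}.$$ For a nonnegative nonzero vector $w$ let $|w|$ be the sum of its entries, and $\bar A_{m,n}v=A_{m,n}v/|A_{m,n}v|$. Let $\Delta_3=\{(l_1,\dots,l_4):l_i>0,\sum l_i=1\}$ and let $e_1,\dots,e_4$ be the standard basis of $\mathbb R^4$. Sequences $(m_k)_{k\ge1},(n_k)_{k\ge1}$ of positive integers satisfy *Keane's condition* if $3(n_k+1)\le m_k\le\frac12(n_{k+1}+1)$ for all $k\ge 1$ and $n_1>9$. By a theorem of Keane, in that case the limits $L_i=\lim_{r\to\infty}\bar A_{m_1,n_1}\bar A_{m_2,n_2}\cdots\bar A_{m_r,n_r}e_i\in\Delta_3$ exist for $i=2,3$. For any fixed $c\in[0,1]$ (the choice is immaterial) put $L=cL_2+(1-c)L_3=(l_1,l_2,l_3,l_4)$ and let $T:[0,1)\to[0,1)$ be the 4-interval exchange transformation with permutation $(4213)$: $[0,1)$ is cut into consecutive half-open intervals $I_1,I_2,I_3,I_4$,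 from left to right, of lengths $l_1,\dots,l_4$, and $T$ translates each $I_j$ so that the images appear from left to right in the order $I_4,I_2,I_1,I_3$. Then (Keane) $T$ is minimal (every orbit is dense), not uniquely ergodic, and has two ergodic invariant Borel probability measures $\lambda_2,\lambda_3$, determined by $\lambda_i(I_j)=(L_i)_j$ for $j=1,\dots,4$, $i=2,3$. This $T$ is the Keane type 4-IET associated with $(m_k),(n_k)$. **Hausdorff dimension.** For a non-atomic fully supported Borel measure $\mu$ on $[0,1)$, $d_\mu$ is the metric on $[0,1)$ given by $d_\mu(a,b)=\mu([a,b])$ for $a\le b$. For a set $S\subset[0,1)$ and a metric $d$, $H^s(S)=\lim_{\delta\to0^+}\inf\{\sum_i \mathrm{diam}(U_i)^s\}$, the infimum being over countable covers of $S$ by open sets of $d$-diameter at most $\delta$, and $H_{dim}(S,d)=\inf\{s:H^s(S)=0\}$. For a Borel probability measure $\nu$ on $[0,1)$, $H_{dim}(\nu,d)=\inf\{H_{dim}(M,d): M\text{ Borel},\ \nu(M)=1\}$. *)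

(* Defs.v *)
From HB Require Import structures.
From mathcomp Require Export all_boot all_order all_algebra.
From mathcomp Require Export all_classical all_reals all_analysis.
Export numFieldNormedType.Exports.

Export Order.TTheory GRing.Theory Num.Theory.

#[export] Set Implicit Arguments.
#[export] Unset Strict Implicit.
#[export] Unset Printing Implicit Defensive.

Local Open Scope classical_set_scope.
Local Open Scope ring_scope.

(* Coordinates are numbered from 0: the index j = 1, 2, 3, 4 of the mathematical
   text is the ordinal j - 1 of 'I_4. *)
Definition ix1 : 'I_4 := @Ordinal 4 0 isT.
Definition ix2 : 'I_4 := @Ordinal 4 1 isT.
Definition ix3 : 'I_4 := @Ordinal 4 2 isT.
Definition ix4 : 'I_4 := @Ordinal 4 3 isT.

Section KeaneMatrices.
Context {R : realType}.

Definition keane_mx (m n : nat) : 'M[R]_4 :=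
  \matrix_(i < 4, j < 4)
    nth 0 (nth [::]
      [:: [:: 0        ; 0    ; 1        ; 1    ];
          [:: m%:R - 1 ; m%:R ; 0        ; 0    ];
          [:: n%:R     ; n%:R ; n%:R - 1 ; n%:R ];
          [:: 1        ; 1    ; 1        ; 1    ]] i) j.

Definition sum_entries (w : 'cV[R]_4) : R := \sum_(i < 4) w i 0.

(* The map written \bar A_{m,n}. *)
Definition keane_map (m n : nat) (v : 'cV[R]_4) : 'cV[R]_4 :=
  (sum_entries (keane_mx m n *m v))^-1 *: (keane_mx m n *m v).

(* \bar A_{m_1,n_1} \bar A_{m_2,n_2} ... \bar A_{m_r,n_r} v;
   sequences are indexed from 1, their value at 0 is never used. *)
Definition keane_iter (m n : nat -> nat) (v : 'cV[R]_4) (r : nat) : 'cV[R]_4 :=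
  foldr (fun k => keane_map (m k) (n k)) v (iota 1 r).

Definition basis_vec (i : 'I_4) : 'cV[R]_4 := delta_mx i 0.

(* L = lim_r \bar A_{m_1,n_1} ... \bar A_{m_r,n_r} e_i *)
Definition is_keane_limit (m n : nat -> nat) (i : 'I_4) (L : 'cV[R]_4) : Prop :=
  keane_iter m n (basis_vec i) @ \oo --> L.

(* The open simplex Delta_3. *)
Definition open_simplex : set 'cV[R]_4 :=
  [set l : 'cV[R]_4 | (forall i, 0 < l i 0) /\ sum_entries l = 1].

End KeaneMatrices.

Definition keane_condition (m n : nat -> nat) : Prop :=
  [/\ (forall k, (1 <= k)%N -> (0 < m k)%N /\ (0 < n k)%N),
      (* m_k <= (n_(k+1) + 1) / 2, with the denominator cleared *)
      (forall k, (1 <= k)%N ->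
         (3 * (n k + 1) <= m k)%N /\ (2 * m k <= n k.+1 + 1)%N)
    & (9 < n 1)%N].

Section IntervalExchange.
Context {R : realType}.

Definition iet_left (l : 'cV[R]_4) (j : 'I_4) : R := \sum_(i < 4 | (i < j)%N) l i 0.

Definition iet_piece (l : 'cV[R]_4) (j : 'I_4) : set R :=
  `[iet_left l j, iet_left l j + l j 0[.

(* The images of the pieces appear, from left to right, in the order
   I_4, I_2, I_1, I_3. *)
Definition iet_order : seq 'I_4 := [:: ix4; ix2; ix1; ix3].

Definition iet_image_left (l : 'cV[R]_4) (j : 'I_4) : R :=
  \sum_(i < 4 | (index i iet_order < index j iet_order)%N) l i 0.

(* Only meant on [0, 1[; it is extended by the identity to the rest of R. *)
Definition iet (l : 'cV[R]_4) (x : R) : R :=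
  x + \sum_(j < 4) (x \in iet_piece l j)%:R * (iet_image_left l j - iet_left l j).

End IntervalExchange.

(* Borel probability measures on [0, 1[ are represented by Borel probability
   measures on R giving full mass to [0, 1[. *)
Section InvariantMeasures.
Context {R : realType}.

Definition unit_itv : set R := `[0, 1[.

Definition on_unit_itv (mu : probability (measurableTypeR R) R) : Prop :=
  mu unit_itv = 1%E.

Definition invariant_measure (T : R -> R)
    (mu : probability (measurableTypeR R) R) : Prop :=
  forall A : set (measurableTypeR R), measurable A -> A `<=` unit_itv ->
    mu (unit_itv `&` T @^-1` A) = mu A.

Definition ergodic_measure (T : R -> R)
    (mu : probability (measurableTypeR R) R) : Prop :=
  forall A : set (measurableTypeR R), measurable A -> A `<=` unit_itv ->
    unit_itv `&` T @^-1` A = A -> mu A = 0%E \/ mu A = 1%E.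

(* mu is the ergodic invariant measure of the interval exchange with lengths l
   which gives mass v_j to I_j. *)
Definition is_keane_measure (l v : 'cV[R]_4)
    (mu : probability (measurableTypeR R) R) : Prop :=
  [/\ on_unit_itv mu, invariant_measure (iet l) mu, ergodic_measure (iet l) mu
    & forall j, mu (iet_piece l j) = (v j 0)%:E].

End InvariantMeasures.

(* Hausdorff measure and dimension of subsets of X for a distance d on X. *)
Section Hausdorff.
Context {R : realType} {T : Type}.
Variables (X : set T) (d : T -> T -> R).
Local Open Scope ereal_scope.

Definition metric_open (U : set T) : Prop :=
  U `<=` X /\
  forall x, U x -> exists2 e : R, (0 < e)%R &
    forall y, X y -> (d x y < e)%R -> U y.

Definition diam (U : set T) : \bar R :=
  ereal_sup [set z | exists x y, [/\ U x, U y & z = (d x y)%:E]].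

(* diam(U)^s, the empty set counting 0 for every s, including s = 0; countable
   covers, finite ones included, are thus sequences padded with empty sets. *)
Definition diam_pow (s : R) (U : set T) : \bar R :=
  if U == set0 then 0 else poweR (diam U) s.

Definition open_cover (S : set T) (delta : R) (U : (set T)^nat) : Prop :=
  [/\ forall i, metric_open (U i), forall i, diam (U i) <= delta%:E
    & S `<=` \bigcup_i U i].

Definition hausdorff_premeasure (s delta : R) (S : set T) : \bar R :=
  ereal_inf [set z | exists2 U : (set T)^nat,
    open_cover S delta U & z = \sum_(0 <= i <oo) diam_pow s (U i)].

Definition hausdorff_measure (s : R) (S : set T) : \bar R :=
  lim (hausdorff_premeasure s delta S @[delta --> (0%R : R)^'+]).

Definition hausdorff_dim (S : set T) : \bar R :=
  ereal_inf [set s%:E | s in [set s : R | (0 <= s)%R /\ hausdorff_measure s S = 0]].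

End Hausdorff.

Section MeasureDimension.
Context {R : realType}.

Definition measure_dist (mu : probability (measurableTypeR R) R) (a b : R) : R :=
  fine (mu `[Num.min a b, Num.max a b]%classic).

Definition hausdorff_dim_measure (nu : probability (measurableTypeR R) R)
    (d : R -> R -> R) : \bar R :=
  ereal_inf [set hausdorff_dim unit_itv d M | M in
    [set M : set (measurableTypeR R) |
      [/\ measurable M, M `<=` unit_itv & nu M = 1%E]]].

End MeasureDimension.

(* Main.v *)
(** One step of Keane's induction replaces the exchange of lengths [A_{m,n} l] by
    the mirror image of the exchange of lengths [l], so at stage [k] the interval
    [0, 1[ is cut into the floors of four towers, of heights [b_j], the column
    sums of [A_1 ... A_k]; [T] moves every floor but the last of a tower onto the
    next one. The incidences of the floors of two consecutive stages do not depend
    on the lengths, so the Lebesgue measure of the exchange of lengths [L_i] can be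
    transported to the exchange of lengths [c L_2 + (1 - c) L_3]; this is
    [lambda_i]. Almost all its mass is in the i-th tower, all floors of a tower
    have equal mass for an invariant measure, and the floors generate the Borel
    sets; hence [lambda_i] is ergodic.

    Up to factors exponential in [k], the i-th tower has [b_2 = m_1 ... m_k]
    (resp. [b_3 = n_1 ... n_k]) floors; its floors have [lambda_3]-measure
    [m_{k+1} / (n_1 ... n_{k+2})] (resp. [lambda_2]-measure
    [n_{k+1} / (m_1 ... m_{k+1})]). If [n_{k+1} / m_k] (resp. [m_k / n_k]) is
    constant, the number of floors is the inverse of their size up to
    exponential factors, negligible against [b_i >= 2^(k^2)], and the mass
    distribution principle gives dimension 1. If that ratio grows fast enough,
    the floors are so small that they give dimension 0. The two ratios can be
    chosen independently. *)

From HB Require Import structures.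
Require Import Defs.
From mathcomp Require Import measurable_realfun ring lra zify.

Local Open Scope classical_set_scope.
Local Open Scope ring_scope.

(** * One step of the induction *)

(** Two measures on the unit interval are compared only through finite sums over floors: at stage
    $k$ a ray is a union of floors up to one cut floor, so it suffices that the masses of the floors
    agree up to a small total error. Invariance is this test for $\lambda_i$ and its image under
    $T$; ergodicity is the test for $\lambda_i(\cdot\cap A)$ and $\lambda_i(A)\lambda_i$ with $A$
    invariant, which gives $\lambda_i(A)=\lambda_i(A)^2$. Lengths of the exchange and masses of the
    measure are kept as two separate families with the same linear recursion. The dimension
    estimates see only masses and heights, so they hold for every $c$ at once. Keane's inequalities
    are strengthened to a factor 16 between successive terms. Comparing heights across one stage
    loses a factor 4 or 3, so a gain of 4 per stage remains, and the mass of $\lambda_i$ outside the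
    $i$-th tower is at most $7/4^k$. This is summable: the lower bound on the dimension may discard
    everything that leaves the towers after some stage. *)

Lemma ord4_ind (P : 'I_4 -> Prop) :
  P ix1 -> P ix2 -> P ix3 -> P ix4 -> forall p, P p.
Proof.
move=> P1 P2 P3 P4 [[|[|[|[|//]]]] i].
- by rewrite (_ : Ordinal i = ix1) //; apply: val_inj.
- by rewrite (_ : Ordinal i = ix2) //; apply: val_inj.
- by rewrite (_ : Ordinal i = ix3) //; apply: val_inj.
- by rewrite (_ : Ordinal i = ix4) //; apply: val_inj.
Qed.

Lemma sum_ord4 (V : nmodType) (F : 'I_4 -> V) :
  \sum_(i < 4) F i = F ix1 + F ix2 + F ix3 + F ix4.
Proof.
rewrite !big_ord_recr big_ord0 /= add0r.
by congr (F _ + F _ + F _ + F _); apply: val_inj.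
Qed.

Section Tiling.
Context {R : realType}.
Implicit Types (f g : 'I_4 -> R) (p j : 'I_4) (q m n : nat).

(** The entries of $A_{m,n}$ as natural numbers, so that they can bound visit numbers; the
    predecessors are the true entries when $m$ and $n$ are positive. *)
Definition keane_entry m n p j : nat :=
  nth 0%N (nth [::] [:: [:: 0; 0; 1; 1]; [:: m.-1; m; 0; 0];
    [:: n; n; n.-1; n]; [:: 1; 1; 1; 1]] p)%N j.

(** This is $f = A_{m,n}\,g$: [f] holds the lengths before one induction step, [g] those after
    it. *)
Definition keane_rec m n f g : Prop :=
  [/\ f ix1 = g ix3 + g ix4,
      f ix2 = (m%:R - 1) * g ix1 + m%:R * g ix2,
      f ix3 = n%:R * (g ix1 + g ix2 + g ix4) + (n%:R - 1) * g ix3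
    & f ix4 = g ix1 + g ix2 + g ix3 + g ix4].

(* Itinerary of the j-th interval of I_4 until it returns to I_4: the letter
   (p, q) is its q-th visit to I_p. *)
Definition visits m n j : seq ('I_4 * nat) :=
  (ix4, 0) :: (if (j < 2)%N then [seq (ix2, q) | q <- iota 0 (m - (j == ix1))]
               else [:: (ix1, 0)])
  ++ [seq (ix3, q) | q <- iota 0 (n - (j == ix3))].

(* Offset in I_p of the q-th visit. The visits tile I_4 in the order 4 3 2 1,
   I_1 in the order 4 3, I_2 periodically in the order 2 1 and I_3
   periodically in the order 1 2 4 3. *)
Definition visit_ofs g p j q : R :=
  match nat_of_ord p with
  | 0 => match nat_of_ord j with 3 => 0 | _ => g ix4 end
  | 1 => q%:R * (g ix1 + g ix2) +
      match nat_of_ord j with 1 => 0 | _ => g ix2 end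
  | 2 => q%:R * (g ix1 + g ix2 + g ix3 + g ix4) +
      match nat_of_ord j with
      | 0 => 0 | 1 => g ix1 | 3 => g ix1 + g ix2 | _ => g ix1 + g ix2 + g ix4
      end
  | _ => match nat_of_ord j with
      | 3 => 0 | 2 => g ix4 | 1 => g ix3 + g ix4 | _ => g ix2 + g ix3 + g ix4
      end
  end.

Definition dom_ofs f p : R :=
  match nat_of_ord p with
  | 0 => 0 | 1 => f ix1 | 2 => f ix1 + f ix2 | _ => f ix1 + f ix2 + f ix3 end.

Definition img_ofs f p : R :=
  match nat_of_ord p with
  | 0 => f ix4 + f ix2 | 1 => f ix4 | 2 => f ix4 + f ix2 + f ix1 | _ => 0 end.

(** Translates between the two descriptions of a visit: positions use the bound on [q] given by the
    matrix, the dynamics uses the order of the list. *)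
Lemma mem_visits m n p j q :
  (0 < m)%N -> (0 < n)%N -> ((p, q) \in visits m n j) = (q < keane_entry m n p j)%N.
Proof.
have mem_pair (a b : 'I_4) (s : seq nat) c :
    ((a, c) \in [seq (b, x) | x <- s]) = (a == b) && (c \in s).
  apply/mapP/andP => [[x xs [-> ->]]|[/eqP -> cs]]; last by exists c.
  by rewrite eqxx.
move=> m0 n0; rewrite /visits inE mem_cat xpair_eqE.
move: j p; do 2! apply: ord4_ind; rewrite /keane_entry /= ?inE ?mem_pair ?mem_iota /=
  ?xpair_eqE /= ?orbF ?andbF ?subn0 ?subn1 ?add0n //; lia.
Qed.

Lemma uniq_visits m n j : uniq (visits m n j).
Proof.
have inj (a : 'I_4) : injective (fun q : nat => (a, q)) by move=> x y [].
rewrite /visits /= mem_cat cat_uniq map_inj_uniq ?iota_uniq //.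
move: j; apply: ord4_ind; rewrite /= ?map_inj_uniq ?iota_uniq //= ?andbT
  ?inE ?xpair_eqE /= ?andbT;
  do ?[apply/andP; split]; rewrite ?negb_or; do ?[apply/andP; split];
  rewrite -?all_predC;
  by [| apply/allP => /= -[a b] /mapP[x _ [-> _]]; apply/negP => /mapP[y _ []]
      | apply/negP => /mapP[y _ []]
      | apply/allP => /= -[a b] /mapP[x _ [-> _]]; rewrite inE xpair_eqE ].
Qed.

Section OneStep.
Variables (m n : nat) (f g : 'I_4 -> R).
Hypotheses (m0 : (0 < m)%N) (n0 : (0 < n)%N) (rec : keane_rec m n f g)
  (g0 : forall p, 0 < g p).

Let mR : (m.-1)%:R = m%:R - 1 :> R.
Proof. by rewrite -subn1 natrB. Qed.
Let nR : (n.-1)%:R = n%:R - 1 :> R.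
Proof. by rewrite -subn1 natrB. Qed.

Let lt_mulr q q' (w : R) : 0 < w -> (q < q')%N -> q%:R * w + w <= q'%:R * w.
Proof.
move=> w0 qq'; rewrite -[X in _ + X]mul1r -mulrDl ler_pM2r //.
by rewrite natr1 ler_nat.
Qed.

Lemma visit_ofs_ge0 p j q : 0 <= visit_ofs g p j q.
Proof.
have [g1 g2 g3 g4] := And4 (g0 ix1) (g0 ix2) (g0 ix3) (g0 ix4).
have q0 : 0 <= q%:R :> R := ler0n _ _.
have h1 : 0 <= q%:R * (g ix1 + g ix2) by apply: mulr_ge0 => //; lra.
have h2 : 0 <= q%:R * (g ix1 + g ix2 + g ix3 + g ix4)
  by apply: mulr_ge0 => //; lra.
by move: p j; do 2! apply: ord4_ind; rewrite /visit_ofs /=; lra.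
Qed.

Lemma visit_ofs_le p j q :
  (q < keane_entry m n p j)%N -> visit_ofs g p j q + g j <= f p.
Proof.
have [g1 g2 g3 g4] := And4 (g0 ix1) (g0 ix2) (g0 ix3) (g0 ix4).
have [f1 f2 f3 f4] := rec.
have w2 : 0 < g ix1 + g ix2 by lra.
have w4 : 0 < g ix1 + g ix2 + g ix3 + g ix4 by lra.
move: p j; do 2! apply: ord4_ind;
  rewrite /keane_entry /visit_ofs /= ?ltn0 // ?ltnS ?leqn0 => hq; try lra;
  move: (lt_mulr w2 hq) (lt_mulr w4 hq); rewrite ?mR ?nR; nra.
Qed.

Lemma visit_ofs_disj p j j' q q' :
  (q < keane_entry m n p j)%N -> (q' < keane_entry m n p j')%N -> (j, q) != (j', q') ->
  visit_ofs g p j q + g j <= visit_ofs g p j' q' \/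
  visit_ofs g p j' q' + g j' <= visit_ofs g p j q.
Proof.
have [g1 g2 g3 g4] := And4 (g0 ix1) (g0 ix2) (g0 ix3) (g0 ix4).
have w2 : 0 < g ix1 + g ix2 by lra.
have w4 : 0 < g ix1 + g ix2 + g ix3 + g ix4 by lra.
(* In $I_1$ and $I_4$ the entries are at most 1, so $r<r'$ cannot occur. In $I_2$ and $I_3$ visit
   number $r$ stays inside the $r$-th period, which ends before the $r'$-th begins. *)
have lt_case (r r' : nat) (i i' : 'I_4) : (r < r')%N ->
    (r < keane_entry m n p i)%N -> (r' < keane_entry m n p i')%N ->
    visit_ofs g p i r + g i <= visit_ofs g p i' r'.
  move=> rr'; move: (lt_mulr w2 rr') (lt_mulr w4 rr').
  move: p; apply: ord4_ind.
  - by case: r' rr' => // r' _ _ _ _; move: i i'; do 2! apply: ord4_ind.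
  - move=> h _ hi hi'; move: i i' hi hi'; do 2! apply: ord4_ind;
      rewrite /keane_entry /visit_ofs //= => _ _;
      move: h; move: (r%:R * _) (r'%:R * _) => *; lra.
  - move=> _ h _ _; move: i i'; do 2! apply: ord4_ind; rewrite /visit_ofs /=;
      move: h; move: (r%:R * _) (r'%:R * _) => *; lra.
  - by case: r' rr' => // r' _ _ _ _; move: i i'; do 2! apply: ord4_ind.
case: (ltngtP q q') => [qq'|q'q|<-] hq hq' jq.
- by left; apply: lt_case.
- by right; apply: lt_case.
have {}jq : j != j' by move: jq; rewrite xpair_eqE eqxx andbT.
clear lt_case rec; move: p j j' hq hq' jq; do 3! apply: ord4_ind;
  rewrite /keane_entry //= => _ _ _; rewrite /visit_ofs /=;
  try (move: (q%:R * _) => t); by [left; lra | right; lra].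
Qed.

(** The right-hand side places the [j]-th interval by counting from the right end of $I_4$: inducing
    reverses the orientation. *)
Lemma visit_first j :
  visit_ofs g ix4 j 0 = f ix4 - dom_ofs g j - g j.
Proof.
have [f1 f2 f3 f4] := rec.
by move: j; apply: ord4_ind; rewrite /visit_ofs /dom_ofs /=; lra.
Qed.

(** The exchange maps the subinterval of visit [x] onto that of visit [y]; left ends are enough,
    since both have length [g j]. *)
Definition visit_next j (x y : 'I_4 * nat) : bool :=
  img_ofs f x.1 + visit_ofs g x.1 j x.2 == dom_ofs f y.1 + visit_ofs g y.1 j y.2.

Let path_iota (T : Type) (e : rel T) (x : T) (h : nat -> T) a c :
  ((0 < c)%N -> e x (h a)) -> (forall q, e (h q) (h q.+1)) ->
  path e x [seq h q | q <- iota a c].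
Proof.
elim: c a x => //= c IH a x h1 h2; rewrite h1 //=; apply: IH => //.
Qed.

Let last_iota (T : Type) (x : T) (h : nat -> T) a c :
  (0 < c)%N -> last x [seq h q | q <- iota a c] = h (a + c).-1.
Proof.
elim: c a x => [//|[|c] IH] a x _; first by rewrite /= addn1.
by move: (IH a.+1 (h a) isT) => /= ->; congr h; lia.
Qed.

(** The exchange translates $I_2$ by $f_4-f_1=g_1+g_2$ and $I_3$ by $f_4$, exactly one period of
    their tilings, so inside a run each visit is carried to the next. The passages between runs are
    checked separately; [1 < m] keeps the run of $m-1$ visits nonempty when [j] is [ix1]. *)
Lemma visits_sorted j : (1 < m)%N -> (1 < n)%N ->
  sorted (visit_next j) (visits m n j).
Proof.
move=> m1 n1; have [f1 f2 f3 f4] := rec.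
rewrite /visits /= cat_path.
move: j; apply: ord4_ind; rewrite /= ?subn0 ?subn1;
  repeat (apply/andP; split); try apply: path_iota => *;
  rewrite ?last_iota ?ltn_predRL //;
  rewrite /visit_next /visit_ofs /img_ofs /dom_ofs /= ?add0n ?mR -?natr1;
  apply/eqP; rewrite ?f1 ?f2 ?f3 ?f4 -?(subn1 m.-1); try ring.
by rewrite natrB ?mR; [ring | rewrite -ltnS prednK].
Qed.

Lemma visit_last j : (1 < n)%N -> exists q,
  last (ix1, 0%N) (visits m n j) = (ix3, q) /\
  img_ofs f ix3 + visit_ofs g ix3 j q =
  dom_ofs f ix4 + f ix4 - img_ofs g j - g j.
Proof.
move=> n1; have [f1 f2 f3 f4] := rec.
exists (n - (j == ix3)).-1; split.
  by rewrite /visits /= last_cat last_iota //; case: (j == ix3) => /=; lia.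
move: j; apply: ord4_ind; rewrite /visit_ofs /img_ofs /dom_ofs /= ?subn0 ?subn1.
all: rewrite ?mR ?nR ?f1 ?f2 ?f3 ?f4.
3: rewrite -subn1 natrB ?nR; last by lia.
all: ring.
Qed.

End OneStep.
End Tiling.

(** * Towers and their floors *)

Definition address := seq ('I_4 * nat).

Section Addresses.
Variables m n : nat -> nat.
Hypotheses (m1 : forall k, (1 < m k.+1)%N) (n1 : forall k, (1 < n k.+1)%N).
Implicit Types (k q : nat) (p j : 'I_4) (a : address).

Let m0 k : (0 < m k.+1)%N. Proof. exact: ltnW. Qed.
Let n0 k : (0 < n k.+1)%N. Proof. exact: ltnW. Qed.

(* The floors of the tower over the j-th interval of the k-th induced map, in
   temporal order. An address lists, most recent stage first, the tower to which
   the floor belongs and the number of the visit inside the previous tower. *)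
Fixpoint floors k j : seq address :=
  match k with
  | 0 => [:: [:: (j, 0%N)]]
  | k'.+1 => [seq (j, x.2) :: a | x <- visits (m k) (n k) j, a <- floors k' x.1]
  end.

Definition height k j : nat := size (floors k j).

Definition all_floors k : seq address := flatten [seq floors k j | j <- enum 'I_4].

Definition tower_of a : 'I_4 := (head (ix1, 0%N) a).1.
Definition base_of a : 'I_4 := (last (ix1, 0%N) a).1.

Lemma floorsS k j b : reflect
  (exists p q a, [/\ (q < keane_entry (m k.+1) (n k.+1) p j)%N, a \in floors k p &
                     b = (j, q) :: a]) (b \in floors k.+1 j).
Proof.
apply: (iffP allpairsPdep) => [[[p q] [a [h1 h2 ->]]]|[p [q [a [h1 h2 ->]]]]].
  by exists p, q, a; rewrite -mem_visits.
by exists (p, q), a; rewrite mem_visits.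
Qed.

Lemma tower_of_floors k j a : a \in floors k j -> tower_of a = j.
Proof.
by case: k => [|k]; [rewrite inE => /eqP ->|case/floorsS => p [q [b [_ _ ->]]]].
Qed.

Lemma size_floors k j a : a \in floors k j -> size a = k.+1.
Proof.
elim: k j a => [|k IH] j a; first by rewrite inE => /eqP ->.
by case/floorsS => p [q [b [_ /IH sb ->]]]; rewrite /= sb.
Qed.

Lemma mem_all_floors k a :
  reflect (exists j, a \in floors k j) (a \in all_floors k).
Proof.
apply: (iffP flatten_mapP) => [[j _ h]|[j h]]; exists j => //.
by rewrite mem_enum.
Qed.

Lemma uniq_floors k j : uniq (floors k j).
Proof.
elim: k j => [//|k IH] j; rewrite -[floors _ _]/(
  [seq (j, x.2) :: a | x <- visits (m k.+1) (n k.+1) j, a <- floors k x.1]).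
apply: (@allpairs_uniq_dep _ (fun=> address) _
  (fun (x : 'I_4 * nat) a => (j, x.2) :: a)) => [|x _|].
- exact: uniq_visits.
- exact: IH.
- move=> _ _ /allpairsPdep[[p q] [a [hx ha ->]]] /allpairsPdep[[p' q'] [a' [hx' ha' ->]]].
  move=> /= [qq' aa']; move: aa' qq' hx hx' ha ha' => -> -> hx hx' ha ha'.
  by move: (tower_of_floors ha); rewrite (tower_of_floors ha') => /= ->.
Qed.

Lemma uniq_all_floors k : uniq (all_floors k).
Proof.
have -> : all_floors k = [seq a | j <- enum 'I_4, a <- floors k j].
  by congr flatten; apply: eq_map => j; rewrite map_id.
apply: (@allpairs_uniq_dep _ (fun=> address) _ (fun _ a => a)) => [|j _|].
- exact: enum_uniq.
- exact: uniq_floors.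
- move=> _ _ /allpairsPdep[j [a [_ ha ->]]] /allpairsPdep[j' [a' [_ ha' ->]]] /= aa'.
  move: aa' ha ha' => -> ha ha'.
  by move: (tower_of_floors ha); rewrite (tower_of_floors ha') => <-.
Qed.

Lemma sum_all_floors (V : nmodType) k (F : address -> V) :
  \sum_(a <- all_floors k) F a = \sum_(j < 4) \sum_(a <- floors k j) F a.
Proof. by rewrite big_flatten big_map big_enum. Qed.

Lemma height0 j : height 0 j = 1%N. Proof. by []. Qed.

Let sum_visits k j (F : 'I_4 -> nat) :
  sumn [seq F x.1 | x <- visits (m k.+1) (n k.+1) j] =
  (F ix4 + (if (j < 2)%N then (m k.+1 - (j == ix1)) * F ix2 else F ix1) +
   (n k.+1 - (j == ix3)) * F ix3)%N.
Proof.
have sum_cst (p : 'I_4) (u c : nat) :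
    sumn [seq F x.1 | x <- [seq (p, q) | q <- iota u c]] = (c * F p)%N.
  by elim: c u => [|c IH] u; rewrite /= ?IH.

rewrite /visits /= map_cat sumn_cat addnA; congr (_ + _ + _)%N; last exact: sum_cst.
by case: ifP => _; [exact: sum_cst | rewrite /= addn0].
Qed.

Lemma heightS k j :
  height k.+1 j = (height k ix4 + (if (j < 2)%N
    then (m k.+1 - (j == ix1)) * height k ix2 else height k ix1) +
   (n k.+1 - (j == ix3)) * height k ix3)%N.
Proof.
rewrite -(sum_visits k j (height k)); exact: size_allpairs_dep.
Qed.

(** * Floors as subintervals of the unit interval *)

Section Levels.
Context {R : realType}.
Implicit Types (f g : 'I_4 -> R) (v : nat -> 'I_4 -> R) (s : bool).

(* At odd stages the induced exchange is seen from right to left. *)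
Definition visit_ofs_or s f g p j q : R :=
  if s then f p - visit_ofs g p j q - g j else visit_ofs g p j q.

Definition dom_ofs_or s f p : R :=
  if s then \sum_i f i - dom_ofs f p - f p else dom_ofs f p.

Definition img_ofs_or s f p : R :=
  if s then \sum_i f i - img_ofs f p - f p else img_ofs f p.

(** The parent address [a'] belongs to stage [(size a').-1], whose parity decides the orientation.
    Lengths enter only through [v], so one address has a realization for every family; this is what
    allows measures to be transported. *)
Fixpoint left_end v a : R :=
  if a is x :: a' then
    if a' is y :: _ then
      left_end v a' + visit_ofs_or (odd (size a').-1)
        (v (size a').-1) (v (size a')) y.1 x.1 x.2
    else dom_ofs (v 0%N) x.1
  else 0.

Definition width v a : R := v (size a).-1 (tower_of a).

Definition level v a : set R := `[left_end v a, left_end v a + width v a[.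

(* [v k p] is the length of the p-th interval of the k-th induced exchange. *)
Definition keane_family v : Prop :=
  [/\ forall k p, 0 < v k p,
      forall k, keane_rec (m k.+1) (n k.+1) (v k) (v k.+1)
    & \sum_p v 0%N p = 1].

Lemma width_floors v k j a : a \in floors k j -> width v a = v k j.
Proof. by move=> ha; rewrite /width (tower_of_floors ha) (size_floors ha). Qed.

Section Family.
Variable v : nat -> 'I_4 -> R.
Hypothesis fam : keane_family v.

Let v0 : forall k p, 0 < v k p. Proof. by case: fam. Qed.
Let vrec : forall k, keane_rec (m k.+1) (n k.+1) (v k) (v k.+1).
Proof. by case: fam. Qed.

Lemma left_end_cons k p j q a : a \in floors k p ->
  left_end v ((j, q) :: a) =
  left_end v a + visit_ofs_or (odd k) (v k) (v k.+1) p j q.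
Proof.
move=> ha; rewrite /= (size_floors ha) /=.
case: a ha (tower_of_floors ha) => [/size_floors //|y a ha].
by rewrite /tower_of /= => ->.
Qed.

Lemma visit_ofs_or_bounds k p j q : (q < keane_entry (m k.+1) (n k.+1) p j)%N ->
  0 <= visit_ofs_or (odd k) (v k) (v k.+1) p j q <= v k p - v k.+1 j.
Proof.
move=> hq; rewrite /visit_ofs_or.
have := visit_ofs_ge0 (v0 k.+1) p j q.
have := visit_ofs_le (m0 k) (n0 k) (vrec k) (v0 k.+1) hq.
by case: odd; lra.
Qed.

Lemma left_end_bounds k j a : a \in floors k j ->
  0 <= left_end v a <= 1 - v k j.
Proof.
elim: k j a => [|k IH] j a.
  rewrite inE => /eqP -> /=; case: fam => [_ _]; rewrite sum_ord4 => v1.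
  move: (v0 0 ix1) (v0 0 ix2) (v0 0 ix3) (v0 0 ix4) => *.
  by move: j; apply: ord4_ind; rewrite /dom_ofs /=; lra.
case/floorsS => p [q [b [hq hb ->]]]; rewrite (left_end_cons _ _ hb).
by move: (IH _ _ hb) (visit_ofs_or_bounds hq) => *; lra.
Qed.

Lemma floors_disj k j j' a a' : a \in floors k j -> a' \in floors k j' ->
  a != a' -> left_end v a + v k j <= left_end v a' \/
             left_end v a' + v k j' <= left_end v a.
Proof.
elim: k j j' a a' => [|k IH] j j' a a'.
  rewrite !inE => /eqP -> /eqP -> /=; rewrite eqseq_cons xpair_eqE eqxx /= !andbT.
  move: (v0 0 ix1) (v0 0 ix2) (v0 0 ix3) (v0 0 ix4) => ? ? ? ?; move: j j'.
  by do 2! apply: ord4_ind; rewrite /dom_ofs //=; lra.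
case/floorsS => p [q [b [hq hb ->]]] /floorsS [p' [q' [b' [hq' hb' ->]]]].
rewrite (left_end_cons _ _ hb) (left_end_cons _ _ hb').
have [bb'|bb' _] := eqVneq b b'.
  move: hb'; rewrite -bb' => hb'.
  have pp' : p' = p by rewrite -(tower_of_floors hb') (tower_of_floors hb).
  rewrite pp' in hq' *; rewrite eqseq_cons eqxx andbT => jq.
  have := visit_ofs_disj (v0 k.+1) hq hq' jq.
  by rewrite /visit_ofs_or; case: odd; lra.
move: (IH _ _ _ _ hb hb' bb') (visit_ofs_or_bounds hq) (visit_ofs_or_bounds hq').
lra.
Qed.

Lemma level_subset k p j q a : a \in floors k p ->
  (q < keane_entry (m k.+1) (n k.+1) p j)%N -> level v ((j, q) :: a) `<=` level v a.
Proof.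
move=> ha hq x; rewrite /level /= !in_itv /=.
rewrite -/(left_end v ((j, q) :: a)) (left_end_cons _ _ ha) (width_floors v ha).
rewrite /width /= (size_floors ha) /tower_of /=.
by move: (visit_ofs_or_bounds hq) => /andP[? ?] /andP[? ?]; apply/andP; split; lra.
Qed.

Lemma level_unit k j a : a \in floors k j -> level v a `<=` unit_itv.
Proof.
move=> ha x; rewrite /level /unit_itv /= !in_itv /= (width_floors v ha).
by move: (left_end_bounds ha) => /andP[? ?] /andP[? ?]; apply/andP; split; lra.
Qed.

Lemma level_disj k a a' : a \in all_floors k -> a' \in all_floors k ->
  level v a `&` level v a' !=set0 -> a = a'.
Proof.
case/mem_all_floors => j ha /mem_all_floors [j' ha'].
case=> x []; rewrite /level /= !in_itv /=.
rewrite (width_floors v ha) (width_floors v ha') => /andP[? ?] /andP[? ?].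
by apply/eqP/negPn/negP => /(floors_disj ha ha') []; lra.
Qed.

(** Heights are multiplied on the right by the matrix that recovers the lengths of one stage from
    those of the next, so their pairing with the lengths does not depend on $k$; at stage 0 it is
    the total length. *)
Lemma sum_height k : \sum_p (height k p)%:R * v k p = 1.
Proof.
elim: k => [|k IH].
  by case: fam => _ _ v1; rewrite -[RHS]v1; apply: eq_bigr => p _; rewrite height0 mul1r.
rewrite -[RHS]IH !sum_ord4 !heightS /= !subn0 !natrD !natrM.
have [-> -> -> ->] := vrec k.
rewrite !natrB //; ring.
Qed.

Lemma height_width_le1 k p : (height k p)%:R * v k p <= 1.
Proof.
rewrite -[leRHS](sum_height k) (bigD1 p) //= lerDl.
by apply: sumr_ge0 => i _; rewrite mulr_ge0 // ltW.
Qed.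

Lemma measurable_level a : measurable (level v a : set (measurableTypeR R)).
Proof. exact: measurable_itv. Qed.

Lemma lebesgue_level k j a : a \in floors k j ->
  lebesgue_measure (level v a) = (v k j)%:E.
Proof.
move=> ha; rewrite lebesgue_measure_itv /= (width_floors v ha) lte_fin.
by rewrite ltrDl v0 -EFinB addrAC subrr add0r.
Qed.

Lemma measure_levels (mu : {measure set (measurableTypeR R) -> \bar R}) k
    (s : seq address) : uniq s -> {subset s <= all_floors k} ->
  mu (\bigcup_(a in [set` s]) level v a) = (\sum_(a <- s) mu (level v a))%E.
Proof.
move=> us sk; rewrite measure_fin_bigcup //.
- exact/esym/fsbig_seq.
- exact: finite_seq.
- by move=> a a' /sk ha /sk ha'; exact: level_disj ha ha'.
- by move=> a _; exact: measurable_level.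
Qed.

(** Proved by measure: the disjoint floors have total length 1. They are finitely many and
    half-open, so a missed point [x] would come with a missed interval $[x,x+e[$ inside the unit
    interval, and the total would exceed 1. *)
Lemma level_cover k x : unit_itv x ->
  exists2 a, a \in all_floors k & level v a x.
Proof.
move=> xu; apply: contrapT => nx.
have {nx}nx a : a \in all_floors k -> ~ level v a x.
  by move=> ha lx; apply: nx; exists a.
move: (xu); rewrite /unit_itv /= in_itv /= => /andP[x0 x1].
have [e [e0 e1 he]] : exists e, [/\ 0 < e, e <= 1 - x &
    forall a, a \in all_floors k ->
      left_end v a + width v a <= x \/ x + e <= left_end v a].
  elim: (all_floors k) nx => [|a s IH] nx; first by by exists (1 - x); split; [lra|lra|].
  case: IH => [b bs|e [e0 e1 he]]; first by apply: nx; rewrite inE bs orbT.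
  have := nx _ (mem_head _ _); rewrite /level /= in_itv /= => /negP.
  rewrite negb_and -ltNge -leNgt => /orP[xa|ax].
    exists (Num.min e (left_end v a - x)); split.
    - by rewrite lt_min e0 subr_gt0.
    - by rewrite ge_min e1.
    - move=> b; rewrite inE => /orP[/eqP ->|/he [|h]]; [right|by left|right].
        by rewrite -lerBrDl ge_min lexx orbT.
      by rewrite -lerBrDl ge_min lerBrDl h.
  exists e; split => // b; rewrite inE => /orP[/eqP ->|/he //]; by left.
pose U := \bigcup_(a in [set` all_floors k]) level v a.
have mU : measurable (U : set (measurableTypeR R)).
  by apply: fin_bigcup_measurable => // a _; exact: measurable_level.
have muU : lebesgue_measure U = 1%E.
  rewrite (@measure_levels _ k) ?uniq_all_floors // sum_all_floors.
  rewrite -[in RHS](sum_height k) -sumEFin; apply: eq_bigr => j _.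
  rewrite (eq_big_seq (fun=> (v k j)%:E)); last by move=> a; exact: lebesgue_level.
  by rewrite sumEFin big_const_seq count_predT iter_addr_0 mulr_natl.
pose V : set R := `[x, x + e[%classic.
have : (lebesgue_measure (U `|` V) <= lebesgue_measure (unit_itv : set R))%E.
  apply: le_measure; rewrite ?inE; [by apply: measurableU => //; exact: measurable_itv|exact: measurable_itv|].
  move=> y [[a /mem_all_floors[j ha] ya]|]; first exact: (level_unit ha).
  rewrite /V /unit_itv /= !in_itv /= => /andP[? ?]; apply/andP; split; lra.
rewrite measureU //; [|exact: measurable_itv|]; last first.
  rewrite -subset0 => y [[a /= ha]]; rewrite /V /level /= !in_itv /= => /andP[? ?] /andP[? ?].
  by case: (he _ ha); lra.
have muV : lebesgue_measure V = e%:E.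
  rewrite lebesgue_measure_itv /= lte_fin ltrDl e0 -EFinB.
  by rewrite addrAC subrr add0r.
have mu1 : lebesgue_measure (unit_itv : set R) = 1%E.
  by rewrite lebesgue_measure_itv /= lte_fin ltr01 -EFinB subr0.
rewrite [X in (X + _)%R]muU [X in (_ + X)%R]muV [X in (_ <= X)%E]mu1.
by rewrite -EFinD lee_fin; lra.
Qed.

End Family.
End Levels.
End Addresses.

(** * The exchange moves the floors *)

(** A block will be one passage through a tower of the previous stage: [sv] is the left end of a
    floor, [ev] the left end of its translate, [hv] and [lv] the entry and exit values of the
    passage. *)
Lemma path_flatten (S T : Type) (R : eqType) (B : S -> seq T) (sv ev : T -> R)
    (hv lv : S -> R) (e := fun x y => sv y == ev x) :
  (forall x, exists h t, [/\ B x = h :: t, path e h t, sv h = hv x &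
     ev (last h t) = lv x]) ->
  forall s x, path (fun x y => lv x == hv y) x s ->
  exists h t, [/\ flatten (map B (x :: s)) = h :: t, path e h t, sv h = hv x &
    ev (last h t) = lv (last x s)].
Proof.
move=> HB; elim=> [|y s IH] x /=.
  by move=> _; have [h [t [-> *]]] := HB x; exists h, t; rewrite cats0.
case/andP => /eqP xy /IH [h [t [/= -> ht hh ll]]].
have [h' [t' [-> ht' hh' ll']]] := HB x.
exists h', (t' ++ h :: t); split => //=.
  by rewrite cat_path ht' /= ht andbT /e hh -xy ll'.
by rewrite last_cat.
Qed.

Section Dynamics.
Variables m n : nat -> nat.
Hypotheses (m1 : forall k, (1 < m k.+1)%N) (n1 : forall k, (1 < n k.+1)%N).
Context {R : realType}.
Variable v : nat -> 'I_4 -> R.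
Hypothesis fam : keane_family m n v.
Implicit Types (k q : nat) (p j : 'I_4) (a : address).

Local Notation floors := (floors m n).
Local Notation all_floors := (all_floors m n).

Let m0 k : (0 < m k.+1)%N. Proof. exact: ltnW. Qed.
Let n0 k : (0 < n k.+1)%N. Proof. exact: ltnW. Qed.
Let v0 : forall k p, 0 < v k p. Proof. by case: fam. Qed.
Let vrec : forall k, keane_rec (m k.+1) (n k.+1) (v k) (v k.+1).
Proof. by case: fam. Qed.

(* Left end of the interval on which the k-th induced exchange lives. *)
Fixpoint origin k : R :=
  if k is k'.+1 then origin k' + dom_ofs_or (odd k') (v k') ix4 else 0.

Definition shift p : R := img_ofs (v 0%N) p - dom_ofs (v 0%N) p.

Definition shifted_end a : R := left_end v a + shift (base_of a).

(** Induction on the stage: the floors of one passage are those of a tower of stage $k$, all moved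
    by the same offset, so the chain inside a passage is inherited. [visits_sorted] links
    consecutive passages, [visit_first] and [visit_last] give the two ends. *)
Lemma floors_shift k j : exists h t,
  [/\ floors k j = h :: t, path (fun a b => left_end v b == shifted_end a) h t,
      left_end v h = origin k + dom_ofs_or (odd k) (v k) j
    & shifted_end (last h t) = origin k + img_ofs_or (odd k) (v k) j].
Proof.
elim: k j => [|k IH] j.
  exists [:: (j, 0%N)], [::]; split => //=; rewrite ?add0r //.
  by rewrite /shifted_end /= /shift /base_of /= addrC subrK.
pose vo (x : 'I_4 * nat) := visit_ofs_or (odd k) (v k) (v k.+1) x.1 j x.2.
pose hv x := origin k + dom_ofs_or (odd k) (v k) x.1 + vo x.
pose lv x := origin k + img_ofs_or (odd k) (v k) x.1 + vo x.
have blocks (x : 'I_4 * nat) : exists h t,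
    [/\ [seq (j, x.2) :: a | a <- floors k x.1] = h :: t,
        path (fun a b => left_end v b == shifted_end a) h t,
        left_end v h = hv x & shifted_end (last h t) = lv x].
  have [h [t [ht pt hh ll]]] := IH x.1.
  have le a : a \in h :: t ->
      left_end v ((j, x.2) :: a) = left_end v a + vo x.
    by rewrite -ht => ha; rewrite (left_end_cons m1 n1 _ _ _ ha).
  have se a : a \in h :: t -> shifted_end ((j, x.2) :: a) = shifted_end a + vo x.
    move=> ha; rewrite /shifted_end le // addrAC; congr (_ + shift _ + _).
    by move: ha; rewrite -ht; case: a => [/(size_floors m1 n1)|].
  exists ((j, x.2) :: h), (map (cons (j, x.2)) t); rewrite ht; split => //.
  - rewrite path_map; apply: (@sub_in_path _ [in h :: t]) (pt); last exact/allP.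
    move=> a b ha hb /eqP ab.
    change (left_end v ((j, x.2) :: b) == shifted_end ((j, x.2) :: a)).
    by rewrite le // se // ab.
  - by rewrite le ?mem_head // hh.
  - by rewrite last_map se ?mem_last // ll.
(* At odd stages both left ends become the total length minus the old value minus [v k.+1 j], so the
   equality survives the reflection. *)
have vnext (x y : 'I_4 * nat) :
    visit_next (v k) (v k.+1) j x y -> lv x == hv y.
  rewrite /visit_next /lv /hv /vo /visit_ofs_or /img_ofs_or /dom_ofs_or.
  by move=> /eqP h; apply/eqP; case: odd; lra.
have [q [lastE lastV]] := visit_last (m0 k) (n0 k) (vrec k) j (n1 k).
have := visits_sorted (m0 k) (n0 k) (vrec k) j (m1 k) (n1 k).
have -> : floors k.+1 j = flatten [seq [seq (j, x.2) :: a | a <- floors k x.1]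
  | x <- visits (m k.+1) (n k.+1) j] by [].
have firstV := visit_first (vrec k) j.
move: lastE; rewrite {1 2 3}/visits.
move: (X in (ix4, 0%N) :: X) => s /= lastE srt.
have {}srt : path (fun x y => lv x == hv y) (ix4, 0%N) s by exact: sub_path srt.
have [h [t [fE ht hh ll]]] := path_flatten blocks srt.
exists h, t; split; [exact: fE|exact: ht| |].
  rewrite hh /hv /vo /= /visit_ofs_or /dom_ofs_or /=; case: odd => /=.
    by rewrite firstV sum_ord4; have [_ _ _ ->] := vrec k; lra.
  by rewrite firstV sum_ord4; have [_ _ _ ->] := vrec k; lra.
rewrite ll lastE /lv /vo /= /visit_ofs_or /img_ofs_or /dom_ofs_or /=.
have s4 : v k ix4 = \sum_i v k.+1 i by rewrite sum_ord4; case: (vrec k).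
by case: odd => /=; lra.
Qed.

Section Exchange.
Variable l : 'cV[R]_4.
Hypothesis lv : forall p, l p 0 = v 0%N p.

Lemma iet_leftE p : iet_left l p = dom_ofs (v 0%N) p.
Proof.
rewrite /iet_left big_mkcond sum_ord4 !lv.
by move: p; apply: ord4_ind; rewrite /dom_ofs /= ?addr0 ?add0r.
Qed.

Lemma iet_image_leftE p : iet_image_left l p = img_ofs (v 0%N) p.
Proof.
rewrite /iet_image_left big_mkcond sum_ord4 !lv.
by move: p; apply: ord4_ind; rewrite /img_ofs /= ?addr0 ?add0r; lra.
Qed.

Lemma iet_pieceE p x :
  iet_piece l p x <-> dom_ofs (v 0%N) p <= x < dom_ofs (v 0%N) p + v 0%N p.
Proof. by rewrite /iet_piece /= in_itv /= iet_leftE lv. Qed.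

Lemma iet_piece_level p : iet_piece l p = level v [:: (p, 0%N)].
Proof.
apply/seteqP; split=> x; rewrite iet_pieceE /level /= in_itv /=;
  by rewrite (@width_floors m n m1 n1 R v 0 p) // inE.
Qed.

Lemma iet_on_piece p x : iet_piece l p x -> iet l x = x + shift p.
Proof.
move=> xp; rewrite /iet; congr (_ + _).
rewrite (bigD1 p) //= big1 ?addr0.
  rewrite (_ : x \in _); last by rewrite inE.
  by rewrite mul1r iet_leftE iet_image_leftE.
move=> i ip; rewrite (_ : (x \in _) = false) ?mul0r //.
apply/negbTE/negP; rewrite inE => xi; move: xp xi ip.
rewrite !iet_pieceE => /andP[a1 a2] /andP[b1 b2].
move: (v0 0 ix1) (v0 0 ix2) (v0 0 ix3) (v0 0 ix4) => ? ? ? ?.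
move: i p a1 a2 b1 b2; do 2! apply: ord4_ind; rewrite /dom_ofs //= => *; lra.
Qed.

Lemma level_piece k j a : a \in floors k j ->
  level v a `<=` iet_piece l (base_of a).
Proof.
elim: k j a => [|k IH] j a.
  by rewrite inE => /eqP ->; rewrite iet_piece_level.
case/(floorsS m1 n1) => p [q [b [hq hb ->]]].
apply: subset_trans (level_subset m1 n1 fam hb hq) _.
by move: hb (IH _ _ hb); case: b => [/(size_floors m1 n1)|].
Qed.

Lemma iet_inj x y : unit_itv x -> unit_itv y -> iet l x = iet l y -> x = y.
Proof.
have in_piece z : unit_itv z -> exists p, iet_piece l p z.
  move=> /(level_cover m1 n1 fam 0)[a /mem_all_floors[j ha] za].
  by exists (base_of a); exact: level_piece ha _ za.
move=> /in_piece[p xp] /in_piece[p' yp']; rewrite (iet_on_piece xp) (iet_on_piece yp').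
move: xp yp'; rewrite !iet_pieceE => /andP[a1 a2] /andP[b1 b2].
move: (v0 0 ix1) (v0 0 ix2) (v0 0 ix3) (v0 0 ix4) => ? ? ? ?.
rewrite /shift.
by move: p p' a1 a2 b1 b2; do 2! apply: ord4_ind; rewrite /dom_ofs /img_ofs //= => *; lra.
Qed.

Lemma iet_unit x : unit_itv x -> unit_itv (iet l x).
Proof.
move=> /(level_cover m1 n1 fam 0)[a /mem_all_floors[j ha] za].
have := level_piece ha za; move: (base_of a) => p xp.
rewrite (iet_on_piece xp) /unit_itv /= in_itv /=.
move: xp; rewrite !iet_pieceE /shift => /andP[a1 a2].
have [_ _] := fam; rewrite sum_ord4.
move: (v0 0 ix1) (v0 0 ix2) (v0 0 ix3) (v0 0 ix4) => ? ? ? ? ?.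
move: p a1 a2; apply: ord4_ind; rewrite /dom_ofs /img_ofs //= => *;
  apply/andP; split; lra.
Qed.

(** The bottom floor is excluded: its preimage lies in the top floors and need not be a floor. *)
Lemma preimage_level k j (i : nat) : (i.+1 < height m n k j)%N ->
  unit_itv `&` iet l @^-1` level v (nth [::] (floors k j) i.+1) =
  level v (nth [::] (floors k j) i).
Proof.
move=> ih.
have ha : nth [::] (floors k j) i \in floors k j by apply: mem_nth; exact: ltnW.
have hb : nth [::] (floors k j) i.+1 \in floors k j by exact: mem_nth.
have step : left_end v (nth [::] (floors k j) i.+1) =
    shifted_end (nth [::] (floors k j) i).
  move: ih; rewrite /height; have [h [t [-> /(pathP [::]) pt _ _]]] := floors_shift k j.
  by rewrite /= ltnS => /pt/eqP.
have fwd x : level v (nth [::] (floors k j) i) x ->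
    level v (nth [::] (floors k j) i.+1) (iet l x).
  move=> xa; rewrite (iet_on_piece (level_piece ha xa)).
  move: xa; rewrite /level /= !in_itv /= step !(width_floors m1 n1 v ha, width_floors m1 n1 v hb).
  by rewrite /shifted_end => /andP[? ?]; apply/andP; split; lra.
apply/seteqP; split => x /=; last first.
  by move=> xa; split; [exact: (level_unit m1 n1 fam ha xa)|exact: fwd].
move=> [xu xb]; pose y := iet l x - shift (base_of (nth [::] (floors k j) i)).
have ya : level v (nth [::] (floors k j) i) y.
  move: xb; rewrite /y /level /= !in_itv /= step !(width_floors m1 n1 v ha, width_floors m1 n1 v hb).
  by rewrite /shifted_end => /andP[? ?]; apply/andP; split; lra.
have yu := level_unit m1 n1 fam ha ya.
rewrite (iet_inj xu yu) // (iet_on_piece (level_piece ha ya)) /y; lra.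
Qed.

End Exchange.
End Dynamics.

(** * Growth of the heights *)

(** A strengthening of Keane's condition. The factor 16 pays for the constants lost in
    [height_alpha] ($2\cdot 2$) and in [height_beta] (3) and still leaves a factor 4 per stage. *)
Definition fast_growth (m n : nat -> nat) : Prop :=
  (16 <= n 1)%N /\
  forall k, (16 * n k.+1 <= m k.+1)%N /\ (16 * m k.+1 <= n k.+2)%N.

Section Growth.
Variables m n : nat -> nat.
Hypothesis fg : fast_growth m n.
Local Open Scope nat_scope.

Lemma fast_growth_n k : 16 * 256 ^ k <= n k.+1.
Proof.
case: fg => h1 h2; elim: k => [|k IH]; first by rewrite expn0 muln1.
by have [h3 h4] := h2 k; rewrite expnS; lia.
Qed.

Lemma fast_growth_nm k : 16 * n k.+1 <= m k.+1.
Proof. by case: fg => _ /(_ k) []. Qed.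

Lemma fast_growth_mn k : 16 * m k.+1 <= n k.+2.
Proof. by case: fg => _ /(_ k) []. Qed.

Lemma fast_growth_n16 k : 16 <= n k.+1.
Proof.
by apply: leq_trans (fast_growth_n k); rewrite leq_pmulr // expn_gt0.
Qed.

Lemma fast_growth_m256 k : 256 <= m k.+1.
Proof. by have := fast_growth_nm k; have := fast_growth_n16 k; lia. Qed.

Lemma fast_growth_gt1 k : (1 < m k.+1) * (1 < n k.+1).
Proof.
by split; have := fast_growth_m256 k; have := fast_growth_n16 k; lia.
Qed.

Local Notation B := (height m n).

Lemma height1S k : B k.+1 ix1 = B k ix4 + (m k.+1 - 1) * B k ix2 + n k.+1 * B k ix3.
Proof. by rewrite heightS /= subn0. Qed.

Lemma height2S k : B k.+1 ix2 = B k ix4 + m k.+1 * B k ix2 + n k.+1 * B k ix3.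
Proof. by rewrite heightS /= !subn0. Qed.

Lemma height3S k : B k.+1 ix3 = B k ix4 + B k ix1 + (n k.+1 - 1) * B k ix3.
Proof. by rewrite heightS. Qed.

Lemma height4S k : B k.+1 ix4 = B k ix4 + B k ix1 + n k.+1 * B k ix3.
Proof. by rewrite heightS /= !subn0. Qed.

Lemma height_gt0 k p : 0 < B k p.
Proof.
elim: k p => [|k IH] p; first by rewrite height0.
by rewrite heightS !addn_gt0 IH.
Qed.

(** Reduces every later estimate to the heights of the towers 2 and 3. *)
Lemma height_compare k :
  [/\ B k ix1 <= B k ix2, B k ix3 <= B k ix4, B k ix4 <= 2 * B k ix3 &
      B k ix3 <= B k ix2].
Proof.
elim: k => [|k [h1 h2 h3 h4]]; first by rewrite !height0.
rewrite height1S height2S height3S height4S.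
have hn := fast_growth_n16 k; have hnm := fast_growth_nm k.
have nm3 : (n k.+1 + 2) * B k ix3 <= m k.+1 * B k ix2.
  by apply: leq_mul => //; lia.
have n3 : 16 * B k ix3 <= n k.+1 * B k ix3 by rewrite leq_mul2r hn orbT.
have m2 : 16 * B k ix2 <= m k.+1 * B k ix2 by rewrite leq_mul2r; lia.
by move: nm3; rewrite mulnDl !mulnBl !mul1n; split; lia.
Qed.

Lemma height2_bounds k :
  m k.+1 * B k ix2 <= B k.+1 ix2 <= 2 * m k.+1 * B k ix2.
Proof.
have [h1 h2 h3 h4] := height_compare k; rewrite height2S.
have hn := fast_growth_n16 k; have hnm := fast_growth_nm k.
have nm3 : (n k.+1 + 2) * B k ix3 <= m k.+1 * B k ix2.
  by apply: leq_mul => //; lia.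
by move: nm3; rewrite mulnDl -mulnA; lia.
Qed.

Lemma height3_ge k : (n k.+1 - 1) * B k ix3 <= B k.+1 ix3.
Proof. by rewrite height3S leq_addl. Qed.

Lemma height3_ge2 k : n k.+1 * B k ix3 <= 2 * B k.+1 ix3.
Proof.
have := height3_ge k; have hn := fast_growth_n16 k => h.
have : n k.+1 * B k ix3 <= 2 * (n k.+1 - 1) * B k ix3.
  by rewrite leq_mul2r; apply/orP; right; lia.
by lia.
Qed.

(** Says that the third tower of the next stage consists almost entirely of passages through the
    third tower: the only other large contribution to it, $b_1\le b_2$, is negligible. The induction
    uses $b_{k+1,2}\le 2m\,b_{k,2}$ and $n\,b_{k,3}\le 2b_{k+1,3}$. *)
Lemma height_alpha k : 4 ^ k * B k ix2 <= n k.+1 * B k ix3.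
Proof.
elim: k => [|k IH].
  by rewrite !height0 expn0 !muln1; have := fast_growth_n16 0; lia.
have /andP[_ h2] := height2_bounds k; have h3 := height3_ge2 k.
have hmn := fast_growth_mn k.
apply: (@leq_trans (16 * m k.+1 * B k.+1 ix3)); last by rewrite leq_mul2r hmn orbT.
apply: (@leq_trans (8 * m k.+1 * (n k.+1 * B k ix3))); last by nia.
apply: (@leq_trans (8 * m k.+1 * (4 ^ k * B k ix2))); last by rewrite leq_mul2l IH orbT.
by rewrite expnS; move: (4 ^ k) => t; nia.
Qed.

Lemma height3_le k : B k.+1 ix3 <= 3 * n k.+1 * B k ix3.
Proof.
have [h1 h2 h3 h4] := height_compare k; rewrite height3S.
have hn := fast_growth_n16 k.
have h5 : B k ix2 <= n k.+1 * B k ix3.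
  by apply: leq_trans (height_alpha k); rewrite leq_pmull // expn_gt0.
by nia.
Qed.

(** The counterpart for the second tower, where the large foreign contribution is $n\,b_3$. The loss
    is the 3 of [height3_le], and $4\cdot 3\le 16$. *)
Lemma height_beta k : 4 ^ k * (n k.+1 * B k ix3) <= m k.+1 * B k ix2.
Proof.
elim: k => [|k IH].
  by rewrite !height0 expn0 !muln1 mul1n; have := fast_growth_nm 0; lia.
have /andP[h2 _] := height2_bounds k; have h3 := height3_le k.
have hnm := fast_growth_nm k.+1.
apply: (@leq_trans (16 * n k.+2 * B k.+1 ix2)); last by rewrite leq_mul2r hnm orbT.
apply: (@leq_trans (4 * 4 ^ k * (n k.+2 * (3 * n k.+1 * B k ix3)))).
  by rewrite expnS !leq_mul.
apply: (@leq_trans (12 * n k.+2 * (m k.+1 * B k ix2))); last by nia.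
apply: (@leq_trans (12 * n k.+2 * (4 ^ k * (n k.+1 * B k ix3)))); last first.
  by rewrite leq_mul2l IH orbT.
by move: (4 ^ k) => t; nia.
Qed.

(** Stage $k$ multiplies the heights by at least $2\cdot4^k=2^{(k+1)^2-k^2}$. Hence any factor
    exponential in $k$ is eventually below any positive power of a height. *)
Lemma height_growth k p : 2 ^ (k * k) <= B k p.
Proof.
have hS i : 2 ^ (i.+1 * i.+1) = 2 * 4 ^ i * 2 ^ (i * i).
  rewrite (_ : i.+1 * i.+1 = 1 + 2 * i + i * i); last by lia.
  by rewrite (expnD 2 (1 + 2 * i)) (expnD 2 1 (2 * i)) (expnM 2 2 i) expn1.
have min_ge t c p' : 2 * 4 ^ t <= c -> 2 ^ (t * t) <= B t p' ->
    2 ^ (t.+1 * t.+1) <= c * B t p'.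
  by move=> h1 h2; rewrite hS leq_mul.
have step i : 2 * 4 ^ i <= n i.+1 - 1 /\ 2 * 4 ^ i <= m i.+1 - 1.
  have := fast_growth_n i; have := fast_growth_nm i.
  have : 4 ^ i <= 256 ^ i by case: i => [|i] //; rewrite leq_exp2r.
  have : 0 < 4 ^ i by rewrite expn_gt0.
  by move: (4 ^ i) (256 ^ i) => s t; lia.
elim: k p => [|k IH] p; first by rewrite height0.
have [hn hm] := step k.
have [? ? ? ?] := height_compare k.+1.
have h3 := leq_trans (min_ge _ _ _ hn (IH ix3)) (height3_ge k).
have h1 : 2 ^ (k.+1 * k.+1) <= B k.+1 ix1.
  apply: leq_trans (min_ge _ _ _ hm (IH ix2)) _.
  by rewrite height1S -addnA addnCA leq_addr.
by move: p; apply: ord4_ind; lia.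
Qed.

End Growth.

(** * The limit points *)

Lemma cvgn_geometric_step (R : realType) (u : R^nat) (C : R) : 0 <= C ->
  (forall r, `|u r.+1 - u r| <= C * 4^-1 ^+ r) -> cvgn u.
Proof.
move=> C0 hu.
have -> : u = (fun r => u 0%N + series (telescope u) r).
  by apply/funext => r; rewrite -eq_sum_telescope.
apply: is_cvgD; first exact: is_cvg_cst.
apply: normed_cvg; apply: (@series_le_cvg _ _ (geometric C 4^-1)).
- by move=> r; exact: normr_ge0.
- by move=> r; rewrite /geometric /= mulr_ge0 // exprn_ge0.
- by move=> r; exact: hu.
- by apply: is_cvg_geometric_series; rewrite ger0_norm //; lra.
Qed.

Section KeaneLimit.
Context {R : realType}.
Variables m n : nat -> nat.
Hypothesis fg : fast_growth m n.
Implicit Types (k r : nat) (i p j : 'I_4).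

Local Notation B := (height m n).

Lemma keane_mxE (a b : nat) p j : (0 < a)%N -> (0 < b)%N ->
  keane_mx a b p j = (keane_entry a b p j)%:R :> R.
Proof.
move=> a0 b0; rewrite mxE.
by move: p j; do 2! apply: ord4_ind; rewrite /keane_entry //= -subn1 natrB.
Qed.

Lemma keane_entry_rec (a b : nat) (g : 'I_4 -> R) : (0 < a)%N -> (0 < b)%N ->
  keane_rec a b (fun p => \sum_i (keane_entry a b p i)%:R * g i) g.
Proof.
move=> a0 b0; have e (c : nat) : (0 < c)%N -> (c.-1)%:R = c%:R - 1 :> R.
  by move=> c0; rewrite -subn1 natrB.
by rewrite /keane_rec !sum_ord4 /keane_entry /= !e //; split; ring.
Qed.

Lemma height_sum k j :
  B k.+1 j = (\sum_i B k i * keane_entry (m k.+1) (n k.+1) i j)%N.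
Proof.
rewrite sum_ord4 heightS.
by move: j; apply: ord4_ind; rewrite /keane_entry /= ?subn0 ?subn1; lia.
Qed.

Definition prodA k r : 'M[R]_4 :=
  \prod_(k <= i < r) keane_mx (m i.+1) (n i.+1).

Let m0 k : (0 < m k.+1)%N. Proof. by have := fast_growth_m256 fg k; lia. Qed.
Let n0 k : (0 < n k.+1)%N. Proof. by have := fast_growth_n16 fg k; lia. Qed.

Lemma prodA_recr k r p j : (k <= r)%N -> prodA k r.+1 p j =
  \sum_i prodA k r p i * (keane_entry (m r.+1) (n r.+1) i j)%:R.
Proof.
move=> kr; rewrite /prodA big_nat_recr //= mxE.
by apply: eq_bigr => i _; rewrite keane_mxE.
Qed.

Lemma prodA_recl k r p j : (k < r)%N -> prodA k r p j =
  \sum_i (keane_entry (m k.+1) (n k.+1) p i)%:R * prodA k.+1 r i j.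
Proof.
move=> kr; rewrite /prodA big_ltn //= mxE.
by apply: eq_bigr => i _; rewrite keane_mxE.
Qed.

Lemma prodA_id k p j : prodA k k p j = (p == j)%:R.
Proof. by rewrite /prodA big_geq // mxE. Qed.

Lemma prodA_ge0 k r p j : 0 <= prodA k r p j.
Proof.
have [rk|kr] := leqP r k; first by rewrite /prodA big_geq // mxE.
rewrite -(subnKC (ltnW kr)); elim: (r - k)%N p j => [|d IH] p j.
  by rewrite addn0 prodA_id.
rewrite addnS prodA_recr ?leq_addr //; apply: sumr_ge0 => i _.
by rewrite mulr_ge0.
Qed.

(** The heights at stage $k$ form the row of column sums of $A_1\cdots A_k$, so multiplying by
    $A_{k+1}\cdots A_r$ gives the heights at stage $r$. *)
Lemma sum_height_prodA k r j : (k <= r)%N ->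
  \sum_p (B k p)%:R * prodA k r p j = (B r j)%:R.
Proof.
move=> kr; rewrite -(subnKC kr); elim: (r - k)%N j => [|d IH] j.
  rewrite addn0 (bigD1 j) //= prodA_id eqxx mulr1 big1 ?addr0 // => i ij.
  by rewrite prodA_id (negbTE ij) mulr0.
rewrite addnS height_sum natr_sum.
transitivity (\sum_p \sum_i (B k p)%:R * (prodA k (k + d) p i *
    (keane_entry (m (k + d).+1) (n (k + d).+1) i j)%:R)).
  by apply: eq_bigr => p _; rewrite prodA_recr ?leq_addr // mulr_sumr.
rewrite exchange_big /=; apply: eq_bigr => i _.
by rewrite natrM -IH mulr_suml; apply: eq_bigr => p _; rewrite mulrA.
Qed.

Let B0 k p : 0 < (B k p)%:R :> R.
Proof. by rewrite ltr0n height_gt0. Qed.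

(* The j-th column of A_(k+1) ... A_r, scaled so that [cone_pt 0 r j] is the
   point \bar A_1 ... \bar A_r e_j of the simplex. *)
Definition cone_pt k r j p : R := prodA k r p j / (B r j)%:R.

Lemma cone_pt_ge0 k r j p : 0 <= cone_pt k r j p.
Proof. by rewrite divr_ge0 // prodA_ge0. Qed.

Lemma sum_height_cone_pt k r j : (k <= r)%N ->
  \sum_p (B k p)%:R * cone_pt k r j p = 1.
Proof.
move=> kr; under eq_bigr do rewrite mulrA.
by rewrite -mulr_suml sum_height_prodA // divff // lt0r_neq0.
Qed.

Lemma cone_pt_le1 k r j p : (k <= r)%N -> cone_pt k r j p <= 1.
Proof.
move=> kr; rewrite -(sum_height_cone_pt j kr) (bigD1 p) //=.
apply: (@le_trans _ _ ((B k p)%:R * cone_pt k r j p)).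
  by rewrite ler_peMl ?cone_pt_ge0 // ler1n height_gt0.
by rewrite lerDl sumr_ge0 // => i _; rewrite mulr_ge0 // cone_pt_ge0.
Qed.

(** All stages are divided by the same number [B r j], so normalization does not disturb the linear
    relation between consecutive tails of the product. *)
Lemma cone_pt_rec k r j : (k < r)%N ->
  keane_rec (m k.+1) (n k.+1) (cone_pt k r j) (cone_pt k.+1 r j).
Proof.
move=> kr; have [e1 e2 e3 e4] := keane_entry_rec (cone_pt k.+1 r j) (m0 k) (n0 k).
have e p : cone_pt k r j p =
    \sum_i (keane_entry (m k.+1) (n k.+1) p i)%:R * cone_pt k.+1 r j i.
  rewrite /cone_pt prodA_recl // mulr_suml; apply: eq_bigr => i _.
  by rewrite mulrA.
by split; rewrite e.
Qed.

(** The new point is a convex combination of the old points of all columns, with weights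
    proportional to the time spent in each tower. It differs from the old point of column [j] by at
    most the weight of the other columns. *)
Lemma cone_pt_step k r j p : (k <= r)%N ->
  `|cone_pt k r.+1 j p - cone_pt k r j p| <=
  (\sum_(i | i != j) (B r i * keane_entry (m r.+1) (n r.+1) i j))%N%:R / (B r.+1 j)%:R.
Proof.
move=> kr; pose w i : R := (B r i * keane_entry (m r.+1) (n r.+1) i j)%N%:R / (B r.+1 j)%:R.
have w0 i : 0 <= w i by rewrite divr_ge0.
have w1 : \sum_i w i = 1.
  by rewrite -mulr_suml -natr_sum -height_sum divff // lt0r_neq0.
have e : cone_pt k r.+1 j p = \sum_i w i * cone_pt k r i p.
  rewrite /cone_pt prodA_recr // mulr_suml; apply: eq_bigr => i _.
  by rewrite /w natrM; field; rewrite !lt0r_neq0.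
have -> : cone_pt k r.+1 j p - cone_pt k r j p =
    \sum_i w i * (cone_pt k r i p - cone_pt k r j p).
  rewrite e -{1}[cone_pt k r j p]mul1r -w1 mulr_suml -sumrB.
  by apply: eq_bigr => i _; rewrite mulrBr.
rewrite (bigD1 j) //= subrr mulr0 add0r natr_sum mulr_suml.
apply: le_trans (ler_norm_sum _ _ _) _; apply: ler_sum => i ij.
rewrite normrM ger0_norm // -[leRHS]mulr1 ler_wpM2l //.
have := cone_pt_ge0 k r i p; have := cone_pt_ge0 k r j p.
have := cone_pt_le1 i p kr; have := cone_pt_le1 j p kr.
by rewrite ler_norml => *; apply/andP; split; lra.
Qed.

Lemma off_column_small r j : j \in [:: ix2; ix3] ->
  (4 ^ r * \sum_(i | i != j) (B r i * keane_entry (m r.+1) (n r.+1) i j) <=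
   4 * B r.+1 j)%N.
Proof.
have [c1 c2 c3 c4] := height_compare fg r.
have hb := height_beta fg r; have ha := height_alpha fg r.
have h2 := height2_bounds fg r; have h3 := height3_ge2 fg r.
have n16 := fast_growth_n16 fg r.
have n4 : (2 * 4 ^ r <= n r.+1)%N.
  have := fast_growth_n fg r.
  have : (4 ^ r <= 256 ^ r)%N by case: (r) => [|i] //; rewrite leq_exp2r.
  lia.
rewrite !inE big_mkcond sum_ord4 => /orP[] /eqP ->; rewrite /keane_entry /=.
- have : (4 ^ r * B r ix4 <= 4 ^ r * (n r.+1 * B r ix3))%N.
    rewrite leq_mul2l; apply/orP; right; apply: leq_trans c3 _.
    by rewrite leq_mul2r; apply/orP; right; lia.
  rewrite !muln0 !muln1 !mulnDr ?muln0 [(B r ix3 * _)%N]mulnC. lia.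
- have : (4 ^ r * B r ix1 <= n r.+1 * B r ix3)%N.
    by apply: leq_trans ha; rewrite leq_mul2l c1 orbT.
  have : (4 ^ r * B r ix4 <= n r.+1 * B r ix3)%N.
    apply: (@leq_trans (4 ^ r * (2 * B r ix3))); first by rewrite leq_mul2l c3 orbT.
    by rewrite mulnA leq_mul2r [(_ * 2)%N]mulnC n4 orbT.
  rewrite !muln0 !muln1 !mulnDr ?muln0. lia.
Qed.

Definition lim_vec j k p : R := lim (cone_pt k r j p @[r --> \oo]).

Section Column.
Variable j : 'I_4.
Hypothesis hj : j \in [:: ix2; ix3].

Lemma cvg_cone_pt k p : cone_pt k r j p @[r --> \oo] --> lim_vec j k p.
Proof.
have : cvgn (fun d => cone_pt k (d + k) j p).
  (* The constant 4 comes from [off_column_small]; its decay $4^{-(d+k)}$ is weakened to $4^{-d}$.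
     The shift by [k] is there because [cone_pt_step] needs $k\le r$. *)
  apply: (@cvgn_geometric_step _ _ 4) => // d.
  rewrite addSn; apply: le_trans (cone_pt_step _ _ (leq_addl _ _)) _.
  rewrite exprVn ler_pdivrMr // -mulrA mulrCA ler_pdivlMl ?exprn_gt0 //.
  rewrite -natrX -!natrM ler_nat.
  apply: leq_trans (off_column_small (d + k) hj).
  by rewrite leq_mul2r leq_exp2l // leq_addr orbT.
move=> /cvg_ex[l]; rewrite (cvg_shiftn k (fun r => cone_pt k r j p)) => hl.
by rewrite /lim_vec (cvg_lim _ hl).
Qed.

Lemma lim_vec_ge0 k p : 0 <= lim_vec j k p.
Proof.
apply: (cvgr_to_ge (@cvg_cone_pt k p)).
by apply: nearW => r; exact: cone_pt_ge0.
Qed.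

Lemma lim_vec_rec k :
  keane_rec (m k.+1) (n k.+1) (lim_vec j k) (lim_vec j k.+1).
Proof.
have near_rec := fun r (kr : (k < r)%N) => cone_pt_rec j kr.
have c i := @cvg_cone_pt k.+1 i.
have lim_eq p (F : nat -> R) (L : R) : F @ \oo --> L ->
    (forall r, (k < r)%N -> cone_pt k r j p = F r) -> lim_vec j k p = L.
  move=> FL eF; apply/(cvg_unique _ (@cvg_cone_pt k p)) => //.
  apply: cvg_trans FL; apply: near_eq_cvg; near=> r; apply/esym/eF.
  by near: r; exact: nbhs_infty_gt.
split.
- apply: (lim_eq _ _ _ (cvgD (c ix3) (c ix4))) => r /near_rec [-> _ _ _] //.
- apply: (lim_eq _ _ _ (cvgD (cvgMl_tmp (c ix1)) (cvgMl_tmp (c ix2)))).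
  by move=> r /near_rec [_ -> _ _].
- apply: (lim_eq _ _ _ (cvgD (cvgMl_tmp (cvgD (cvgD (c ix1) (c ix2)) (c ix4)))
    (cvgMl_tmp (c ix3)))).
  by move=> r /near_rec [_ _ -> _].
- apply: (lim_eq _ _ _ (cvgD (cvgD (cvgD (c ix1) (c ix2)) (c ix3)) (c ix4))).
  by move=> r /near_rec [_ _ _ ->].
Unshelve. all: by end_near. Qed.

Lemma sum_height_lim_vec k : \sum_p (B k p)%:R * lim_vec j k p = 1.
Proof.
rewrite sum_ord4.
have c i : (B k i)%:R * cone_pt k r j i @[r --> \oo] -->
    (B k i)%:R * lim_vec j k i by exact: cvgMl_tmp (@cvg_cone_pt k i).
pose f r := (B k ix1)%:R * cone_pt k r j ix1 + (B k ix2)%:R * cone_pt k r j ix2 +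
  (B k ix3)%:R * cone_pt k r j ix3 + (B k ix4)%:R * cone_pt k r j ix4.
have h1 : f @ \oo --> (B k ix1)%:R * lim_vec j k ix1 +
  (B k ix2)%:R * lim_vec j k ix2 + (B k ix3)%:R * lim_vec j k ix3 +
  (B k ix4)%:R * lim_vec j k ix4 by do ![apply: cvgD => //].
have h2 : (fun=> 1 : R) @ \oo --> (1 : R) by exact: cvg_cst.
apply/(cvg_unique _ h1) => //; apply: cvg_trans h2.
apply: near_eq_cvg; near=> r.
rewrite -(@sum_height_cone_pt k r j) ?sum_ord4 //.
by near: r; exact: nbhs_infty_ge.
Unshelve. all: by end_near. Qed.

(** Only strict positivity is new. If the fourth entry vanished, so would the whole vector of the
    next stage, contrary to [sum_height_lim_vec]; the recursion then spreads positivity to the other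
    entries. *)
Lemma lim_vec_family : keane_family m n (lim_vec j).
Proof.
have vrec := lim_vec_rec; have v0 := lim_vec_ge0.
have v4 k : 0 < lim_vec j k ix4.
  have [_ _ _ ->] := vrec k; rewrite lt_def !addr_ge0 // andbT.
  apply/negP => /eqP s0; have := sum_height_lim_vec k.+1; rewrite sum_ord4.
  have [g1 g2 g3 g4] := And4 (v0 k.+1 ix1) (v0 k.+1 ix2) (v0 k.+1 ix3) (v0 k.+1 ix4).
  have -> : lim_vec j k.+1 ix1 = 0 by lra.
  have -> : lim_vec j k.+1 ix2 = 0 by lra.
  have -> : lim_vec j k.+1 ix3 = 0 by lra.
  have -> : lim_vec j k.+1 ix4 = 0 by lra.
  by rewrite !mulr0 !addr0 => /esym/eqP; rewrite oner_eq0.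
have m1 k : 1 < (m k.+1)%:R :> R by rewrite ltr1n (fast_growth_gt1 fg k).
have n1 k : 1 < (n k.+1)%:R :> R by rewrite ltr1n (fast_growth_gt1 fg k).
have v1 k : 0 < lim_vec j k ix1.
  by have [-> _ _ _] := vrec k; rewrite ltr_wpDl.
split=> //.
  move=> k; apply: ord4_ind => //.
    have [_ -> _ _] := vrec k; have := m1 k; have := v1 k.+1; have := v0 k.+1 ix2.
    by move=> *; rewrite ltr_pwDl ?mulr_ge0 ?mulr_gt0 //; lra.
  have [_ _ -> _] := vrec k; have := n1 k; have := v1 k.+1; have := v4 k.+1.
  have := v0 k.+1 ix2; have := v0 k.+1 ix3.
  by move=> *; rewrite ltr_pwDl ?mulr_ge0 ?mulr_gt0 //; lra.
rewrite -[RHS](sum_height_lim_vec 0); apply: eq_bigr => p _.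
by rewrite height0 mul1r.
Qed.

(** Arbitrary coefficients encode any linear inequality, so the invariant cones below pass to the
    limit. *)
Lemma lim_vec_le (a b : 'I_4 -> R) k :
  (forall r, (k <= r)%N ->
    \sum_p a p * cone_pt k r j p <= \sum_p b p * cone_pt k r j p) ->
  \sum_p a p * lim_vec j k p <= \sum_p b p * lim_vec j k p.
Proof.
move=> h.
have c (a' : 'I_4 -> R) : \sum_p a' p * cone_pt k r j p @[r --> \oo] -->
    \sum_p a' p * lim_vec j k p.
  under eq_cvg do rewrite sum_ord4.
  rewrite sum_ord4.
  by do ! apply: cvgD; apply: cvgMl_tmp; exact: cvg_cone_pt.
apply: (ler_cvg_to (c a) (c b)); near=> r; apply: h.
by near: r; exact: nbhs_infty_ge.
Unshelve. all: by end_near. Qed.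

End Column.

Lemma cone_pt_id r j p : cone_pt r r j p = (p == j)%:R / (B r j)%:R.
Proof. by rewrite /cone_pt prodA_id. Qed.

Let mnR k : [/\ 16 <= (n k.+1)%:R :> R, 16 * (n k.+1)%:R <= (m k.+1)%:R :> R &
  16 * (m k.+1)%:R <= (n k.+2)%:R :> R].
Proof.
split; rewrite -?natrM ler_nat.
- exact: fast_growth_n16 fg k.
- exact: fast_growth_nm fg k.
- exact: fast_growth_mn fg k.
Qed.

(** An invariant cone: it contains the scaled basis vector at $k=r$ and is preserved when $k$
    decreases, because $16n\le m$ gives $2(n+1)\le m-1$. *)
Lemma cone_pt2_le k r : (k <= r)%N ->
  cone_pt k r ix2 ix3 + cone_pt k r ix2 ix4 <= cone_pt k r ix2 ix2 /\
  cone_pt k r ix2 ix1 <= cone_pt k r ix2 ix4.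
Proof.
move=> kr; rewrite -(subKn kr); elim: (r - k)%N (leq_subr k r) => [_|d IH dr].
  by rewrite subn0 !cone_pt_id /= !mul0r add0r !mul1r invr_ge0 ltW.
have {}IH := IH (ltnW dr).
have dS : (r - d = (r - d.+1).+1)%N by rewrite subnSK.
have lt : (r - d.+1 < r)%N by rewrite -dS leq_subr.
have [-> -> -> ->] := cone_pt_rec ix2 lt.
have [h1 h2 h3] := mnR (r - d.+1); rewrite dS in IH.
have c i := cone_pt_ge0 (r - d.+1).+1 r ix2 i.
move: (c ix1) (c ix2) (c ix3) (c ix4) IH; clear dS lt.
move: (cone_pt _ _ _ ix1) (cone_pt _ _ _ ix2) (cone_pt _ _ _ ix3) (cone_pt _ _ _ ix4).
move: (n _)%:R (m _)%:R h1 h2 h3 => N M h1 h2 h3 g1 g2 g3 g4 p1 p2 p3 p4 [q1 q2].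
split; last by lra.
have : 2 * (N + 1) * (g1 + g2) <= (M - 1) * (g1 + g2) by apply: ler_wpM2r; lra.
have : (N + 1) * (g1 + g2 + g3 + g4) <= (N + 1) * (2 * (g1 + g2)).
  by apply: ler_wpM2l; lra.
nra.
Qed.

(** Same downward induction for the third column; here the inequality at the next stage, together
    with $16m_{k+1}\le n_{k+2}$, controls the term $m(g_1+g_2)$ of the second entry. *)
Lemma cone_pt3_le k r : (k <= r)%N ->
  (n k.+1)%:R * (cone_pt k r ix3 ix1 + cone_pt k r ix3 ix2 + cone_pt k r ix3 ix4)
  <= 3 * cone_pt k r ix3 ix3.
Proof.
move=> kr; rewrite -(subKn kr); elim: (r - k)%N (leq_subr k r) => [_|d IH dr].
  rewrite subn0 !cone_pt_id /= !mul0r !addr0 mulr0 mul1r.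
  by rewrite mulr_ge0 // invr_ge0 ltW.
have {}IH := IH (ltnW dr).
have dS : (r - d = (r - d.+1).+1)%N by rewrite subnSK.
have lt : (r - d.+1 < r)%N by rewrite -dS leq_subr.
have [-> -> -> ->] := cone_pt_rec ix3 lt.
have [h1 h2 h3] := mnR (r - d.+1); rewrite dS in IH.
have c i := cone_pt_ge0 (r - d.+1).+1 r ix3 i.
move: (c ix1) (c ix2) (c ix3) (c ix4) IH; clear dS lt.
move: (cone_pt _ _ _ ix1) (cone_pt _ _ _ ix2) (cone_pt _ _ _ ix3) (cone_pt _ _ _ ix4).
move: h1 h2 h3; move: (n _)%:R (m _)%:R (n _)%:R.
move=> N' M N h1 h2 h3 g1 g2 g3 g4 p1 p2 p3 p4 q.
have : 16 * M * (g1 + g2) <= N' * (g1 + g2) by apply: ler_wpM2r; lra.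
have : 0 <= N' * g4 by apply: mulr_ge0; lra.
have : 0 <= M * g1 by apply: mulr_ge0; lra.
move=> a1 a2 a3.
(* $35/16=2+3/16$: the induction hypothesis gives $M(g_1+g_2)\le\frac3{16}g_3$, and the rest is at
   most twice the total. *)
have b : g3 + g4 + ((M - 1) * g1 + M * g2) + (g1 + g2 + g3 + g4) <=
    (35 / 16) * (g1 + g2 + g3 + g4) by lra.
have : N * (g3 + g4 + ((M - 1) * g1 + M * g2) + (g1 + g2 + g3 + g4)) <=
    N * ((35 / 16) * (g1 + g2 + g3 + g4)) by apply: ler_wpM2l => //; lra.
have : 16 * (g1 + g2 + g3 + g4) <= N * (g1 + g2 + g3 + g4) by apply: ler_wpM2r; lra.
nra.
Qed.

End KeaneLimit.

(** * Normalized iterates and their limits *)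

Section KeaneLimitPoint.
Context {R : realType}.
Variables m n : nat -> nat.
Hypothesis fg : fast_growth m n.
Implicit Types (k r : nat) (i p j : 'I_4).

Local Notation B := (height m n).
Local Notation prodA := (@prodA R m n).
Local Notation cone_pt := (@cone_pt R m n).
Local Notation lim_vec := (@lim_vec R m n).

Definition simplex_proj (w : 'cV[R]_4) : 'cV[R]_4 := (sum_entries w)^-1 *: w.

Lemma sum_entriesZ (c : R) (w : 'cV[R]_4) :
  sum_entries (c *: w) = c * sum_entries w.
Proof. by rewrite /sum_entries mulr_sumr; apply: eq_bigr => i _; rewrite mxE. Qed.

(** The normalized map ignores scaling of its argument, so a composite can be normalized once, at
    the end. *)
Lemma keane_map_proj (a b : nat) (w : 'cV[R]_4) : sum_entries w != 0 ->
  keane_map a b (simplex_proj w) = simplex_proj (keane_mx a b *m w).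
Proof.
move=> w0; rewrite /keane_map /simplex_proj -scalemxAr sum_entriesZ scalerA.
by rewrite invfM invrK mulrAC mulfV // mul1r.
Qed.

Lemma sum_prodA_neq0 k r j : (k <= r)%N -> \sum_p prodA k r p j != 0.
Proof.
move=> kr; apply/negP => /eqP/psumr_eq0P h.
have /eqP := @sum_height_prodA R m n fg k r j kr.
rewrite big1 => [|p _]; last by rewrite h ?mulr0 // => i _; exact: prodA_ge0.
by rewrite eq_sym pnatr_eq0 gtn_eqF // height_gt0.
Qed.

Lemma sum_entries_col k r j :
  sum_entries (prodA k r *m basis_vec j) = \sum_p prodA k r p j.
Proof. by apply: eq_bigr => p _; rewrite /basis_vec -colE mxE. Qed.

Lemma keane_iterE j r :
  keane_iter m n (basis_vec j) r = \col_p cone_pt 0 r j p.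
Proof.
have it d k : foldr (fun i : nat => keane_map (m i) (n i)) (basis_vec j) (iota k.+1 d) =
    simplex_proj (prodA k (k + d) *m basis_vec j).
  elim: d k => [|d IH] k /=.
    rewrite addn0 /prodA big_geq // mul1mx /simplex_proj.
    rewrite (_ : sum_entries _ = 1) ?invr1 ?scale1r //.
    rewrite /sum_entries (bigD1 j) //= /basis_vec !mxE !eqxx big1 ?addr0 // => i ij.
    by rewrite mxE (negbTE ij).
  rewrite IH keane_map_proj; last first.
    by rewrite sum_entries_col sum_prodA_neq0 // leq_addr.
  by rewrite mulmxA addSnnS /prodA [in RHS]big_ltn // -addSnnS ltnS leq_addr.
rewrite /keane_iter it add0n; apply/colP => p.
have e : (prodA 0 r *m basis_vec j) p 0 = prodA 0 r p j.
  by rewrite /basis_vec -colE mxE.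
rewrite /simplex_proj [RHS]mxE [LHS]mxE sum_entries_col e /cone_pt mulrC.
congr (_ / _); rewrite -(@sum_height_prodA R m n fg 0 r j) //.
by apply: eq_bigr => i _; rewrite height0 mul1r.
Qed.

Definition limit_pt j : 'cV[R]_4 := \col_p lim_vec j 0 p.

Lemma is_keane_limit_pt j : j \in [:: ix2; ix3] ->
  is_keane_limit m n j (limit_pt j).
Proof.
move=> hj; apply/cvg_ballP => e e0.
have near_p p : \forall r \near \oo, ball (lim_vec j 0 p) e (cone_pt 0 r j p).
  by have /cvg_ballP := @cvg_cone_pt R m n fg j hj 0%N p; exact.
have : \forall r \near \oo, forall p, ball (lim_vec j 0 p) e (cone_pt 0 r j p).
  exact: filter_forall near_p.
apply: filterS => r h; split=> // p q.
by rewrite keane_iterE !mxE.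
Qed.

Lemma limit_pt_simplex j : j \in [:: ix2; ix3] -> open_simplex (limit_pt j).
Proof.
move=> hj; have [v0 _ v1] := @lim_vec_family R m n fg j hj; split=> [p|].
  by rewrite mxE.
by rewrite -[RHS]v1; apply: eq_bigr => p _; rewrite mxE.
Qed.

(** Gives the exchange of lengths $cL_2+(1-c)L_3$ the same addresses as the two extreme exchanges,
    with other widths. *)
Lemma keane_family_convex (v w : nat -> 'I_4 -> R) (c : R) : 0 <= c <= 1 ->
  keane_family m n v -> keane_family m n w ->
  keane_family m n (fun k p => c * v k p + (1 - c) * w k p).
Proof.
move=> /andP[c0 c1] [v0 vr v1] [w0 wr w1]; split=> [k p|k|].
- have := v0 k p; have := w0 k p => ? ?.
  have [->|cn0] := eqVneq c 0; first by rewrite mul0r add0r subr0 mul1r.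
  have cp : 0 < c by rewrite lt_def cn0.
  have : 0 <= (1 - c) * w k p by rewrite mulr_ge0 ?subr_ge0 // ltW.
  by have := mulr_gt0 cp (v0 k p); lra.
- have [a1 a2 a3 a4] := vr k; have [b1 b2 b3 b4] := wr k.
  by split; rewrite ?a1 ?a2 ?a3 ?a4 ?b1 ?b2 ?b3 ?b4; ring.
- rewrite big_split /= -!mulr_sumr v1 w1; ring.
Qed.

End KeaneLimitPoint.

(** * Masses of the floors for the two ergodic measures *)

Section Widths.
Context {R : realType}.
Variables m n : nat -> nat.
Hypothesis fg : fast_growth m n.
Implicit Types (k : nat) (p : 'I_4).
Local Notation b k p := ((height m n k p)%:R : R).
Local Notation M k := ((m k.+1)%:R : R).
Local Notation N k := ((n k.+1)%:R : R).

Let m1 k : (1 < m k.+1)%N. Proof. by have [] := fast_growth_gt1 fg k. Qed.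
Let n1 k : (1 < n k.+1)%N. Proof. by have [] := fast_growth_gt1 fg k. Qed.

Definition lam2 : nat -> 'I_4 -> R := lim_vec m n ix2.
Definition lam3 : nat -> 'I_4 -> R := lim_vec m n ix3.

Lemma lam2_family : keane_family m n lam2.
Proof. exact: lim_vec_family. Qed.

Lemma lam3_family : keane_family m n lam3.
Proof. exact: lim_vec_family. Qed.

Let b0 k p : 0 < b k p. Proof. by rewrite ltr0n height_gt0. Qed.

Lemma family_height_le1 v k p : keane_family m n v -> b k p * v k p <= 1.
Proof. by move=> fv; exact: height_width_le1. Qed.

Lemma lam2_cone k : lam2 k ix3 + lam2 k ix4 <= lam2 k ix2 /\
  lam2 k ix1 <= lam2 k ix4.
Proof.
split.
  have := @lim_vec_le R m n fg ix2 isT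
    (fun p => if (1 < p)%N then 1 else 0) (fun p => (p == ix2)%:R) k.
  rewrite !sum_ord4 /= !mul0r !mul1r !add0r !addr0; apply => r kr.
  by rewrite !sum_ord4 /= !mul0r !mul1r !add0r !addr0; case: (@cone_pt2_le R m n fg _ _ kr).
have := @lim_vec_le R m n fg ix2 isT
  (fun p => (p == ix1)%:R) (fun p => (p == ix4)%:R) k.
rewrite !sum_ord4 /= !mul0r !mul1r !add0r !addr0; apply => r kr.
by rewrite !sum_ord4 /= !mul0r !mul1r !add0r !addr0; case: (@cone_pt2_le R m n fg _ _ kr).
Qed.

Lemma lam3_cone k :
  N k * (lam3 k ix1 + lam3 k ix2 + lam3 k ix4) <= 3 * lam3 k ix3.
Proof.
have := @lim_vec_le R m n fg ix3 isT
  (fun p => if p == ix3 then 0 else N k) (fun p => if p == ix3 then 3 else 0) k.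
rewrite !sum_ord4 /= !mul0r !add0r !addr0 !mulrDr; apply => r kr.
rewrite !sum_ord4 /= !mul0r !add0r !addr0 -!mulrDr; exact: cone_pt3_le.
Qed.


Let nR k : 16 <= N k. Proof. by rewrite ler_nat; exact: fast_growth_n16 fg k. Qed.

Let nmR k : 16 * N k <= M k.
Proof. by rewrite -natrM ler_nat; exact: fast_growth_nm fg k. Qed.

Let n4R k : 16 * 4 ^+ k <= N k.
Proof.
rewrite -natrX -natrM ler_nat; apply: leq_trans (fast_growth_n fg k).
by rewrite leq_mul2l /=; case: k => [|i] //; rewrite leq_exp2r.
Qed.

Let p4 k : 0 < 4 ^+ k :> R. Proof. by rewrite exprn_gt0. Qed.

Let betaR k : 4 ^+ k * (N k * b k ix3) <= M k * b k ix2.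
Proof. by rewrite -natrX -!natrM ler_nat; exact: height_beta fg k. Qed.

Let alphaR k : 4 ^+ k * b k ix2 <= N k * b k ix3.
Proof. by rewrite -natrX -!natrM ler_nat; exact: height_alpha fg k. Qed.

Let compareR k : [/\ b k ix1 <= b k ix2, b k ix4 <= 2 * b k ix3 & b k ix3 <= b k ix2].
Proof.
have [h1 _ h3 h4] := height_compare fg k.
by split; rewrite -?natrM ler_nat.
Qed.

Let height2R k : M k * b k ix2 <= b k.+1 ix2.
Proof.
by rewrite -natrM ler_nat; case/andP: (height2_bounds fg k).
Qed.

Let sum_lam2 k : lam2 k.+1 ix1 + lam2 k.+1 ix2 + lam2 k.+1 ix3 + lam2 k.+1 ix4
  <= 3 / b k.+1 ix2.
Proof.
have [c1 c2] := lam2_cone k.+1; have [v0 _ _] := lam2_family.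
have := family_height_le1 k.+1 ix2 lam2_family.
rewrite mulrC -ler_pdivlMr // mul1r => h.
have := v0 k.+1 ix1; have := v0 k.+1 ix2; have := v0 k.+1 ix3; have := v0 k.+1 ix4.
lra.
Qed.

(** The third entry is at most $n_{k+1}$ times the total of the next stage. By [lam2_cone] that
    total is at most three times its second entry, hence at most $3/b_{k+1,2}$. *)
Lemma lam2_3_le k : lam2 k ix3 <= 3 * N k / b k.+1 ix2.
Proof.
have [v0 rec _] := lam2_family; have [_ _ -> _] := rec k.
have h := sum_lam2 k; rewrite mulrAC [leRHS]mulrC.
have : N k * (lam2 k.+1 ix1 + lam2 k.+1 ix2 + lam2 k.+1 ix3 + lam2 k.+1 ix4) <=
  N k * (3 / b k.+1 ix2) by rewrite ler_wpM2l.
have := v0 k.+1 ix3; lra.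
Qed.

(** $7=3+1+3$: the masses of the towers 3, 4 and 1, in units of $4^{-k}$. The gain $4^{-k}$ comes
    from [height_beta] for the towers 3 and 4 and from the size of $m_{k+1}$ for tower 1. *)
Lemma lam2_mass k : 1 - 7 / 4 ^+ k <= b k ix2 * lam2 k ix2.
Proof.
have := sum_height m1 n1 lam2_family k; rewrite sum_ord4.
have [c1 c2 c3] := compareR k; have [d1 d2] := lam2_cone k.
have [v0 rec _] := lam2_family.
have Mb : 0 < M k * b k ix2.
  by rewrite mulr_gt0 //; have := nmR k; have := nR k; lra.
have inv_le : (b k.+1 ix2)^-1 <= (M k * b k ix2)^-1.
  by rewrite lef_pV2 ?posrE.
have M0 : 0 < M k by have := nmR k; have := nR k; lra.
have v3 : b k ix3 * lam2 k ix3 <= 3 / 4 ^+ k.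
  apply: (@le_trans _ _ (b k ix3 * (3 * N k / (M k * b k ix2)))).
    rewrite ler_wpM2l //; apply: le_trans (lam2_3_le k) _.
    by rewrite ler_wpM2l // mulr_ge0.
  rewrite ler_pdivlMr // !mulrA mulrAC ler_pdivrMr //.
  have := betaR k; lra.
have v4le : lam2 k ix4 <= 3 / (M k * b k ix2).
  have [_ _ _ ->] := rec k; apply: le_trans (sum_lam2 k) _.
  by rewrite ler_wpM2l.
have v4 : b k ix4 * lam2 k ix4 <= 1 / 4 ^+ k.
  apply: (@le_trans _ _ (2 * b k ix3 * (3 / (M k * b k ix2)))).
    by rewrite ler_pM // ltW.
  rewrite ler_pdivlMr // !mulrA mulrAC ler_pdivrMr //.
  have := betaR k; have : 0 <= (N k - 16) * (4 ^+ k * b k ix3).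
    by rewrite mulr_ge0 ?mulr_ge0 ?subr_ge0 // ltW.
  have : 0 <= 4 ^+ k * b k ix3 by rewrite mulr_ge0 // ltW.
  lra.
have v1 : b k ix1 * lam2 k ix1 <= 3 / 4 ^+ k.
  apply: (@le_trans _ _ (b k ix2 * (3 / (M k * b k ix2)))).
    by apply: ler_pM => //; [exact: ltW | exact: le_trans v4le].
  have -> : b k ix2 * (3 / (M k * b k ix2)) = 3 / M k.
    by field; rewrite !gt_eqF.
  rewrite ler_wpM2l // lef_pV2 ?posrE //.
  by have := n4R k; have := nmR k; have := nR k; have := p4 k; lra.
lra.
Qed.

(** Stage 2 is the first where $7/4^k\le 1/2$; this causes the index shifts in the lower bounds
    below. *)
Let half k : 1 / 2 <= 1 - 7 / 4 ^+ k.+2 :> R.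
Proof.
have : 4 ^+ 2 <= 4 ^+ k.+2 :> R by rewrite ler_weXn2l //; lra.
move=> h; have : (4 ^+ k.+2)^-1 <= (4 ^+ 2)^-1 :> R by rewrite lef_pV2 ?posrE.
lra.
Qed.

Lemma lam2_3_ge k : N k.+1 / (2 * b k.+2 ix2) <= lam2 k.+1 ix3.
Proof.
have [v0 rec _] := lam2_family; have [_ _ -> _] := rec k.+1.
have h : 1 / (2 * b k.+2 ix2) <= lam2 k.+2 ix2.
  rewrite ler_pdivrMr ?mulr_gt0 //; have := lam2_mass k.+2; have := half k; lra.
have := v0 k.+2 ix1; have := v0 k.+2 ix3; have := v0 k.+2 ix4; have := nR k.+1.
move=> h1 h2 h3 h4.
have : N k.+1 * (1 / (2 * b k.+2 ix2)) <= N k.+1 * lam2 k.+2 ix2.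
  by rewrite ler_wpM2l.
have : 0 <= N k.+1 * lam2 k.+2 ix1 by rewrite mulr_ge0 // ltW.
have : 0 <= N k.+1 * lam2 k.+2 ix4 by rewrite mulr_ge0 // ltW.
have : 0 <= (N k.+1 - 1) * lam2 k.+2 ix3 by rewrite mulr_ge0 ?ltW //; lra.
lra.
Qed.

Lemma lam3_2_le k : lam3 k ix2 <= 3 * M k / (N k.+1 * b k.+1 ix3).
Proof.
have [v0 rec _] := lam3_family; have [_ -> _ _] := rec k.
have N0 : 0 < N k.+1 by have := nR k.+1; lra.
rewrite ler_pdivlMr ?mulr_gt0 //.
have h := family_height_le1 k.+1 ix3 lam3_family.
have c := lam3_cone k.+1.
have d1 : N k.+1 * (lam3 k.+1 ix1 + lam3 k.+1 ix2) <= 3 * lam3 k.+1 ix3.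
  by apply: le_trans c; rewrite ler_wpM2l // lerDl ltW.
have d2 : b k.+1 ix3 * (N k.+1 * (lam3 k.+1 ix1 + lam3 k.+1 ix2)) <= 3.
  apply: (@le_trans _ _ (b k.+1 ix3 * (3 * lam3 k.+1 ix3))); last by lra.
  by rewrite ler_wpM2l.
have d3 : M k * (b k.+1 ix3 * (N k.+1 * (lam3 k.+1 ix1 + lam3 k.+1 ix2))) <= M k * 3.
  by rewrite ler_wpM2l.
have d4 : 0 <= lam3 k.+1 ix1 * (N k.+1 * b k.+1 ix3).
  by rewrite !mulr_ge0 // ltW.
lra.
Qed.

(** The towers 2, 1 and 4 have masses at most $3/4$, 3 and 1 in units of $4^{-k}$; the constant 7 is
    kept so that both measures satisfy the same estimate. *)
Lemma lam3_mass k : 1 - 7 / 4 ^+ k <= b k ix3 * lam3 k ix3.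
Proof.
have := sum_height m1 n1 lam3_family k; rewrite sum_ord4.
have [c1 c2 c3] := compareR k; have cone := lam3_cone k.
have [v0 rec _] := lam3_family.
have N0 : 0 < N k by have := nR k; lra.
have N1 : 0 < N k.+1 by have := nR k.+1; lra.
have v2 : b k ix2 * lam3 k ix2 <= 3 / 4 ^+ k / 4.
  apply: (@le_trans _ _ (b k ix2 * (3 * M k / (N k.+1 * b k.+1 ix3)))).
    by rewrite ler_wpM2l // lam3_2_le.
  rewrite !ler_pdivlMr // !mulrA -mulrA mulrAC ler_pdivrMr ?mulr_gt0 //.
  have := alphaR k.+1; rewrite exprS => h1.
  have h2 : 4 * 4 ^+ k * (M k * b k ix2) <= 4 * 4 ^+ k * b k.+1 ix2.
    by rewrite ler_wpM2l // mulr_ge0 // ltW.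
  by lra.
have hb : b k ix3 * lam3 k ix3 <= 1 := family_height_le1 k ix3 lam3_family.
have div_le i : i != ix3 -> lam3 k i <= 3 * lam3 k ix3 / N k.
  have [g1 g2 g4] := And3 (v0 k ix1) (v0 k ix2) (v0 k ix4).
  have g1' : 0 <= N k * lam3 k ix1 by rewrite mulr_ge0 // ltW.
  have g2' : 0 <= N k * lam3 k ix2 by rewrite mulr_ge0 // ltW.
  have g4' : 0 <= N k * lam3 k ix4 by rewrite mulr_ge0 // ltW.
  by rewrite ler_pdivlMr //; move: i; apply: ord4_ind => //= _; lra.
have v1 : b k ix1 * lam3 k ix1 <= 3 / 4 ^+ k.
  apply: (@le_trans _ _ (b k ix2 * (3 * lam3 k ix3 / N k))).
    by rewrite ler_pM // ?div_le // ltW.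
  rewrite ler_pdivlMr // !mulrA mulrAC ler_pdivrMr //.
  have : 4 ^+ k * b k ix2 * lam3 k ix3 <= N k * b k ix3 * lam3 k ix3.
    by rewrite ler_wpM2r ?alphaR // ltW.
  have : N k * (b k ix3 * lam3 k ix3) <= N k * 1 by rewrite ler_wpM2l.
  lra.
have v4 : b k ix4 * lam3 k ix4 <= 1 / 4 ^+ k.
  apply: (@le_trans _ _ (2 * b k ix3 * (3 * lam3 k ix3 / N k))).
    by rewrite ler_pM // ?div_le // ltW.
  rewrite ler_pdivlMr // !mulrA mulrAC ler_pdivrMr //.
  have : b k ix3 * lam3 k ix3 * 4 ^+ k <= 1 * 4 ^+ k by rewrite ler_wpM2r // ltW.
  have := n4R k; have := p4 k; lra.
have := p4 k; rewrite -invr_gt0 => p4'; lra.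
Qed.

Let height3R k : b k.+1 ix3 <= 3 * N k * b k ix3.
Proof. by rewrite -!natrM ler_nat; exact: height3_le fg k. Qed.

(** The mass is followed through two stages: the second entry dominates $m-1$ first entries of the
    next stage, and each of these dominates the third entry two stages ahead, known by [lam3_mass].
    Then $12=2\cdot2\cdot3$, from $m-1\ge m/2$, from [half] and from [height3_le]. *)
Lemma lam3_2_ge k : M k / (12 * (N k.+1 * b k.+1 ix3)) <= lam3 k ix2.
Proof.
have [v0 rec _] := lam3_family; have [_ e _ _] := rec k.
have [e1 _ _ _] := rec k.+1.
have N1 : 0 < N k.+1 by have := nR k.+1; lra.
have h : 1 / (2 * b k.+2 ix3) <= lam3 k.+2 ix3.
  rewrite ler_pdivrMr ?mulr_gt0 //; have := lam3_mass k.+2; have := half k; lra.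
have h' : 1 / (6 * (N k.+1 * b k.+1 ix3)) <= 1 / (2 * b k.+2 ix3).
  rewrite ler_wpM2l // lef_pV2 ?posrE ?mulr_gt0 //; have := height3R k.+1; lra.
have g : 1 / (6 * (N k.+1 * b k.+1 ix3)) <= lam3 k.+1 ix1.
  rewrite e1; have := v0 k.+2 ix4; lra.
have M2 : 2 <= M k by have := nmR k; have := nR k; lra.
have g2 : 0 <= M k * lam3 k.+1 ix2 by rewrite mulr_ge0 // ltW.
have g3 : M k / 2 * (1 / (6 * (N k.+1 * b k.+1 ix3))) <= (M k - 1) * lam3 k.+1 ix1.
  apply: ler_pM => //; lra.
have e3 : M k / (12 * (N k.+1 * b k.+1 ix3)) =
    M k / 2 * (1 / (6 * (N k.+1 * b k.+1 ix3))).
  by field; rewrite !gt_eqF //.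
rewrite e3 e; lra.
Qed.

(** With $m=16n$ the ratio $b_2/b_3$ grows by at most $2\cdot16\cdot2=64$ per stage. The leading 64
    is $2\cdot2\cdot16$, from [lam2_3_ge], [height2_bounds] and $m=16n$. *)
Lemma lam2_3_rate k : (forall i, m i.+1 = 16 * n i.+1)%N ->
  1 <= 64 * 64 ^+ k.+1 * (lam2 k.+1 ix3 * b k.+1 ix3).
Proof.
move=> mn; have MN i : M i = 16 * N i by rewrite mn natrM.
have ratio i : b i ix2 <= 64 ^+ i * b i ix3.
  elim: i => [|i IH]; first by rewrite !height0 expr0 mulr1.
  have h1 : b i.+1 ix2 <= 2 * M i * b i ix2.
    by rewrite -!natrM ler_nat; case/andP: (height2_bounds fg i).
  have h2 : N i * b i ix3 <= 2 * b i.+1 ix3.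
    by rewrite -!natrM ler_nat; exact: height3_ge2 fg i.
  have h3 : 2 * M i * b i ix2 <= 2 * M i * (64 ^+ i * b i ix3).
    by rewrite ler_wpM2l // mulr_ge0.
  have h4 : 32 * 64 ^+ i * (N i * b i ix3) <= 32 * 64 ^+ i * (2 * b i.+1 ix3).
    by rewrite ler_wpM2l // mulr_ge0 // exprn_ge0.
  rewrite exprS; move: h1 h3; rewrite MN; lra.
have N0 : 0 < N k.+1 by have := nR k.+1; lra.
have h2 : b k.+2 ix2 <= 2 * M k.+1 * b k.+1 ix2.
  by rewrite -!natrM ler_nat; case/andP: (height2_bounds fg k.+1).
have g : 1 <= 64 * b k.+1 ix2 * lam2 k.+1 ix3.
  have := lam2_3_ge k; rewrite ler_pdivrMr ?mulr_gt0 // => g.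
  have [v0 _ _] := lam2_family.
  have g2 : lam2 k.+1 ix3 * (2 * b k.+2 ix2) <=
    lam2 k.+1 ix3 * (2 * (2 * M k.+1 * b k.+1 ix2)).
    by rewrite ler_wpM2l ?ler_wpM2l // ltW.
  move: g2; rewrite MN => g2; rewrite -(ler_pM2l N0); lra.
have [v0 _ _] := lam2_family.
have : lam2 k.+1 ix3 * b k.+1 ix2 <= lam2 k.+1 ix3 * (64 ^+ k.+1 * b k.+1 ix3).
  by rewrite ler_wpM2l // ltW.
lra.
Qed.

(** The ratio $b_{k+1,3}/b_{k,2}$ starts below $3n_1$ and grows by at most $3\cdot16=48$ per stage;
    $576=12\cdot16\cdot3$, with the 12 of [lam3_2_ge]. *)
Lemma lam3_2_rate k : (forall i, n i.+2 = 16 * m i.+1)%N ->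
  1 <= 576 * N 0 * 48 ^+ k * (lam3 k ix2 * b k ix2).
Proof.
move=> nm; have NM i : N i.+1 = 16 * M i by rewrite nm natrM.
have ratio i : b i.+1 ix3 <= 3 * N 0 * 48 ^+ i * b i ix2.
  elim: i => [|i IH].
    by have := height3R 0; rewrite !height0 expr0 !mulr1.
  have h1 := height3R i.+1; rewrite NM in h1.
  have h2 : 48 * M i * b i.+1 ix3 <= 48 * M i * (3 * N 0 * 48 ^+ i * b i ix2).
    by rewrite ler_wpM2l // mulr_ge0.
  have h3 : 48 * (3 * N 0 * 48 ^+ i) * (M i * b i ix2) <=
      48 * (3 * N 0 * 48 ^+ i) * b i.+1 ix2.
    by rewrite ler_wpM2l // !mulr_ge0 // exprn_ge0.
  rewrite exprS; lra.
have M0 : 0 < M k by have := nmR k; have := nR k; lra.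
have [v0 _ _] := lam3_family.
have := lam3_2_ge k; rewrite NM ler_pdivrMr; last by rewrite !mulr_gt0.
have : lam3 k ix2 * b k.+1 ix3 <= lam3 k ix2 * (3 * N 0 * 48 ^+ k * b k ix2).
  by rewrite ler_wpM2l // ltW.
move=> h1 h2; rewrite -(ler_pM2l M0).
have : M k * (lam3 k ix2 * b k.+1 ix3) <=
  M k * (lam3 k ix2 * (3 * N 0 * 48 ^+ k * b k ix2)) by rewrite ler_wpM2l // ltW.
lra.
Qed.

Let mono a c e : (a <= c)%N -> (a ^ e <= c ^ e)%N.
Proof. by case: e => // e h; rewrite leq_exp2r. Qed.

Lemma height2_le_exp k : (height m n k ix2 <= n k.+1 ^ k)%N.
Proof.
elim: k => [|k IH]; first by rewrite height0.
have /andP[_ h] := height2_bounds fg k; apply: leq_trans h _.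
have h2 := fast_growth_mn fg k; have h1 := fast_growth_nm fg k.
rewrite expnS; apply: leq_mul; first by lia.
by apply: leq_trans IH _; apply: mono; lia.
Qed.

(** This bound dictates the exponent $1+2k^2$ of the fast growth in [next_term]: $2^k h\le a^{2k}$,
    hence its $k$-th power is at most $a^{2k^2}$. *)
Let small_pow (a h k : nat) : (1 < a)%N -> (h <= a ^ k)%N ->
  ((2 ^ k * h) ^ k <= a ^ (2 * (k.+1 * k.+1)))%N.
Proof.
move=> a1 hh; apply: (@leq_trans ((a ^ k * a ^ k) ^ k)).
  by apply: mono; apply: leq_mul => //; exact: mono.
rewrite -expnD -expnM leq_exp2l //; lia.
Qed.

(** The mass is at most $3n/m$, and one factor $n$ cancels. The $k$-th power on the left is what
    forces dimension 0: each $s>0$ eventually satisfies $ks\ge1$. *)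
Lemma lam2_3_small k : (m k.+1 = 16 * n k.+1 ^ (1 + 2 * (k.+1 * k.+1)))%N ->
  ((2 ^ k * height m n k ix3) ^ k)%:R * lam2 k ix3 <= 3.
Proof.
move=> mE; have [_ _ _ h32] := height_compare fg k.
have X := small_pow (n1 k) (leq_trans h32 (height2_le_exp k)).
have N0 : 0 < N k by have := nR k; lra.
have M0 : 0 < M k by have := nmR k; lra.
have h1 : lam2 k ix3 <= 3 * N k / M k.
  apply: le_trans (lam2_3_le k) _; rewrite ler_wpM2l ?mulr_ge0 //.
  rewrite lef_pV2 ?posrE //; apply: le_trans (height2R k).
  by rewrite ler_peMr // ler1n height_gt0.
apply: le_trans (ler_wpM2l (ler0n _ _) h1) _.
rewrite mulrA ler_pdivrMr // mE add1n expnS !natrM.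
move: X; rewrite -(ler_nat R) => X.
have : N k * ((2 ^ k * height m n k ix3) ^ k)%:R <=
  N k * (n k.+1 ^ (2 * (k.+1 * k.+1)))%:R by rewrite ler_wpM2l.
have : 0 <= N k * (n k.+1 ^ (2 * (k.+1 * k.+1)))%:R by rewrite mulr_ge0.
lra.
Qed.

Lemma lam3_2_small k : (n k.+2 = 16 * m k.+1 ^ (1 + 2 * (k.+1 * k.+1)))%N ->
  ((2 ^ k * height m n k ix2) ^ k)%:R * lam3 k ix2 <= 3.
Proof.
move=> nE; have hm : (height m n k ix2 <= m k.+1 ^ k)%N.
  apply: leq_trans (height2_le_exp k) _; apply: mono.
  by have := fast_growth_nm fg k; lia.
have X := small_pow (m1 k) hm.
have N0 : 0 < N k.+1 by have := nR k.+1; lra.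
have M0 : 0 < M k by have := nmR k; have := nR k; lra.
have h1 : lam3 k ix2 <= 3 * M k / N k.+1.
  apply: le_trans (lam3_2_le k) _; rewrite ler_wpM2l ?mulr_ge0 //.
  rewrite lef_pV2 ?posrE ?mulr_gt0 //.
  by rewrite ler_peMr ?ler1n ?height_gt0 // ltW.
apply: le_trans (ler_wpM2l (ler0n _ _) h1) _.
rewrite mulrA ler_pdivrMr // nE add1n expnS !natrM.
move: X; rewrite -(ler_nat R) => X.
have : M k * ((2 ^ k * height m n k ix2) ^ k)%:R <=
  M k * (m k.+1 ^ (2 * (k.+1 * k.+1)))%:R by rewrite ler_wpM2l.
have : 0 <= M k * (m k.+1 ^ (2 * (k.+1 * k.+1)))%:R by rewrite mulr_ge0.
lra.
Qed.

End Widths.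

(** * The ergodic measures *)

Section ImageMeasure.
Context {R : realType}.
Implicit Types (f : measurableTypeR R -> measurableTypeR R).

Lemma image_probability (P : probability (measurableTypeR R) R) f :
  measurable_fun [set: measurableTypeR R] f ->
  exists Q : probability (measurableTypeR R) R, forall A, Q A = P (f @^-1` A).
Proof.
move=> mf.
pose F : {mfun measurableTypeR R >-> measurableTypeR R} :=
  HB.pack f (isMeasurableFun.Build _ _ _ _ f mf).
by exists (distribution P F).
Qed.

Lemma measurable_unit : measurable (unit_itv : set (measurableTypeR R)).
Proof. exact: measurable_itv. Qed.

Definition unit_lebesgue : set (measurableTypeR R) -> \bar R :=
  mrestr lebesgue_measure measurable_unit.

HB.instance Definition _ := Measure.on unit_lebesgue.

Let unit_lebesgueT : unit_lebesgue setT = 1%E.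
Proof.
rewrite /unit_lebesgue /mrestr setTI.
have -> : lebesgue_measure (unit_itv : set R) = 1%E; last by [].
by rewrite lebesgue_measure_itv /= lte_fin ltr01 -EFinB subr0.
Qed.

HB.instance Definition _ := Measure_isProbability.Build _ _ _ unit_lebesgue
  unit_lebesgueT.

End ImageMeasure.

(** * Measures determined by the masses of the floors *)

Section FamilyMesh.
Variables m n : nat -> nat.
Hypothesis fg : fast_growth m n.
Context {R : realType}.
Variable v : nat -> 'I_4 -> R.
Hypothesis fam : keane_family m n v.

Let m1 k : (1 < m k.+1)%N. Proof. by have [] := fast_growth_gt1 fg k. Qed.
Let n1 k : (1 < n k.+1)%N. Proof. by have [] := fast_growth_gt1 fg k. Qed.
Let v0 : forall k p, 0 < v k p. Proof. by case: fam. Qed.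

Lemma family_le_pow k p : v k p <= 4 * 4^-1 ^+ k.
Proof.
have h := height_width_le1 m1 n1 fam k p.
have h0 : 0 < (height m n k p)%:R :> R by rewrite ltr0n height_gt0.
rewrite exprVn ler_pdivlMr ?exprn_gt0 //.
have : 4 ^+ k <= 4 * (height m n k p)%:R :> R.
  rewrite -natrX -natrM ler_nat (@leq_trans (4 * 2 ^ (k * k))) //; last first.
    by rewrite leq_mul2l height_growth // orbT.
  have -> : (4 ^ k = 2 ^ (2 * k))%N by rewrite expnM.
  have -> : (4 * 2 ^ (k * k) = 2 ^ (2 + k * k))%N by rewrite expnD.
  by rewrite leq_exp2l //; case: k {h h0} => [|[|k]] //; nia.
move=> h4; apply: (@le_trans _ _ (v k p * (4 * (height m n k p)%:R))).
  by rewrite ler_wpM2l // ltW.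
lra.
Qed.

Lemma small_pow (e : R) : 0 < e -> exists k, forall i, (k <= i)%N -> 4 * 4^-1 ^+ i <= e.
Proof.
move=> e0; have : (fun k : nat => (4 : R) * 4^-1 ^+ k) @ \oo --> 0.
  by apply: cvg_geometric; rewrite ger0_norm //; lra.
move=> /cvgrPdist_le /(_ _ e0) [k _ hk]; exists k => i ki.
by have := hk i ki; rewrite sub0r normrN ger0_norm // mulr_ge0 // exprn_ge0.
Qed.

Lemma family_small (e : R) : 0 < e -> exists k, forall i p, (k <= i)%N -> v i p <= e.
Proof.
move=> /small_pow [k hk]; exists k => i p ki.
by apply: le_trans (hk _ ki); exact: family_le_pow.
Qed.

(* At each stage a ray cuts at most one level, so its measure is known up to the
   measure of one level. *)
Lemma eq_measure_levels (mu nu : {measure set (measurableTypeR R) -> \bar R}) :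
  (mu setT < +oo)%E -> (nu setT < +oo)%E ->
  mu (~` unit_itv) = 0%E -> nu (~` unit_itv) = 0%E ->
  (forall e, 0 < e -> exists k,
    \sum_(a <- all_floors m n k) `|fine (mu (level v a)) - fine (nu (level v a))| <= e /\
    forall a, a \in all_floors m n k ->
      fine (mu (level v a)) <= e /\ fine (nu (level v a)) <= e) ->
  forall A, measurable A -> mu A = nu A.
Proof.
move=> muT nuT muU nuU H.
have fin (la : {measure set (measurableTypeR R) -> \bar R})
    (X : set (measurableTypeR R)) : (la setT < +oo)%E -> measurable X ->
    la X \is a fin_num.
  move=> laT mX; rewrite ge0_fin_numE //; apply: le_lt_trans laT.
  by apply: le_measure; rewrite ?inE.
have mray t : measurable (`]-oo, t[%classic : set (measurableTypeR R)).
  exact: measurable_itv.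
have ray (la : {measure set (measurableTypeR R) -> \bar R}) t k e :
    (la setT < +oo)%E -> la (~` unit_itv) = 0%E ->
    (forall a, a \in all_floors m n k -> fine (la (level v a)) <= e) -> 0 <= e ->
    let s := [seq a <- all_floors m n k | left_end v a + width v a <= t] in
    \sum_(a <- s) fine (la (level v a)) <= fine (la `]-oo, t[%classic) <=
    \sum_(a <- s) fine (la (level v a)) + e.
  move=> laT laU lae e0; cbv zeta; set s := seq.filter _ _.
  have mL := @measurable_level R v.
  pose U1 : set (measurableTypeR R) := \bigcup_(a in [set` s]) level v a.
  have mU1 : measurable U1 by apply: fin_bigcup_measurable => // a _; exact: mL.
  have laU1 : fine (la U1) = \sum_(a <- s) fine (la (level v a)).
    rewrite (measure_levels m1 n1 fam la (k := k)).
    - by rewrite sum_fine // => a _; exact: fin.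
    - by rewrite filter_uniq // uniq_all_floors.
    - by move=> a; rewrite mem_filter => /andP[].
  have U1I : U1 `<=` `]-oo, t[.
    move=> x [a /=]; rewrite mem_filter /level /= !in_itv /= => /andP[h _] /andP[_].
    by move=> /lt_le_trans; exact.
  have [U2 [mU2 U2e hU2]] : exists U2 : set (measurableTypeR R),
      [/\ measurable U2, fine (la U2) <= e & forall a, a \in all_floors m n k ->
          left_end v a <= t < left_end v a + width v a -> level v a `<=` U2].
    have [[a0 [ha0 ta0]]|no] := pselect (exists a, a \in all_floors m n k /\
        left_end v a <= t < left_end v a + width v a).
      exists (level v a0); split; [exact: mL|exact: lae|].
      move=> a ha ta; rewrite (level_disj m1 n1 fam ha ha0) //.
      by exists t; split; rewrite /level /= in_itv.
    exists set0; split => //; first by rewrite measure0.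
    by move=> a ha ta; exfalso; apply: no; exists a.
  have IU : `]-oo, t[ `<=` ~` unit_itv `|` (U1 `|` U2).
    move=> x; rewrite /= in_itv /= => xt.
    have [xu|] := pselect (unit_itv x); [right|by left].
    have [a ha xa] := level_cover m1 n1 fam k xu.
    have [at'|ta] := leP (left_end v a + width v a) t.
      by left; exists a => //=; rewrite mem_filter at' ha.
    right; apply: (hU2 a ha) => //; rewrite ta andbT ltW //.
    by move: xa; rewrite /level /= in_itv /= => /andP[/le_lt_trans h _]; exact: h.
  rewrite -laU1; apply/andP; split.
    by apply: fine_le; rewrite ?fin //; apply: le_measure; rewrite ?inE.
  apply: (@le_trans _ _ (fine (la U1 + la U2)%E)); last first.
    by rewrite fineD ?fin // lerD2l.
  apply: fine_le; rewrite ?fin // ?fin_numD ?fin //.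
  have mu' := measurableC (@measurable_unit R).
  apply: (@le_trans _ _ (la (~` unit_itv `|` (U1 `|` U2)))).
    by apply: le_measure; rewrite ?inE //; do ?[apply: measurableU => //].
  apply: le_trans (measureU2 _ _ _) _ => //; first exact: measurableU.
  by rewrite [X in (X + _)%E]laU add0e; exact: measureU2.
move=> A mA; apply: (@measure_unique _ R (measurableTypeR R)
  (@measurable_realfun.RGenInftyO.G R)
  (fun k : nat => `]-oo, k%:R[%classic) _ _ _ _ mu nu) => //.
- exact: measurable_realfun.RGenInftyO.measurableE.
- move=> _ _ [x ->] [y ->]; exists (Num.min x y).
  apply/seteqP; split=> z /=; rewrite !in_itv /= lt_min; last by move/andP.
  by move=> [-> ->].
- by move=> i; exists i%:R.
- apply/seteqP; split=> // x _; exists (Num.truncn `|x|).+1 => //=.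
  by rewrite in_itv /=; apply: le_lt_trans (ler_norm x) (truncnS_gt _).
- move=> _ [t ->].
  rewrite -[LHS]fineK ?fin // -[RHS]fineK ?fin //; congr (_%:E).
  apply/eqP; rewrite -subr_eq0; apply/negPn/negP; rewrite -normr_gt0 => d0.
  set d := `| _ | in d0.
  (* The two masses of the ray differ by at most $d/4$ from the floors below [t] and $d/4$ from the
     cut floor, which is less than their difference $d$. *)
  have d4 : 0 < d / 4 by rewrite divr_gt0.
  have [k [hs he]] := H _ d4.
  have /= /andP[r1 r2] := ray mu t k (d / 4) muT muU (fun a ha => (he a ha).1) (ltW d4).
  have /= /andP[r3 r4] := ray nu t k (d / 4) nuT nuU (fun a ha => (he a ha).2) (ltW d4).
  move: r1 r2 r3 r4; set s := seq.filter _ _ => r1 r2 r3 r4.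
  have hs' : `|\sum_(a <- s) fine (mu (level v a)) -
      \sum_(a <- s) fine (nu (level v a))| <= d / 4.
    rewrite -sumrB; apply: le_trans (ler_norm_sum _ _ _) _; apply: le_trans hs.
    rewrite /s big_filter [leLHS]big_mkcond /=; apply: ler_sum => a _.
    by case: ifP.
  have : d <= d / 4 + d / 4.
    rewrite {1}/d; move: hs' r1 r2 r3 r4; rewrite !ler_norml.
    by move=> /andP[? ?] *; apply/andP; split; lra.
  lra.
- by move=> k; apply: le_lt_trans muT; apply: le_measure; rewrite ?inE.
Qed.

End FamilyMesh.

(** * Transport of Lebesgue measure between two families *)

Section MassTransfer.
Variables m n : nat -> nat.
Hypothesis fg : fast_growth m n.
Context {R : realType}.
Variables u v : nat -> 'I_4 -> R.
Hypotheses (famu : keane_family m n u) (famv : keane_family m n v).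

Local Notation floors := (floors m n).
Local Notation all_floors := (all_floors m n).

Let m1 k : (1 < m k.+1)%N. Proof. by have [] := fast_growth_gt1 fg k. Qed.
Let n1 k : (1 < n k.+1)%N. Proof. by have [] := fast_growth_gt1 fg k. Qed.
Let u0 : forall k p, 0 < u k p. Proof. by case: famu. Qed.
Let v0 : forall k p, 0 < v k p. Proof. by case: famv. Qed.

(** Stage-$k$ approximation of the conjugacy from lengths [u] to lengths [v]: a floor goes to the
    left end of the floor with the same address. *)
Definition step_map k (x : measurableTypeR R) : measurableTypeR R :=
  \sum_(a <- all_floors k) left_end v a * \1_(level u a) x.

Let measurable_step_map k : measurable_fun setT (step_map k).
Proof.
apply: measurable_sum => a; apply: measurable_funM; first exact: measurable_cst.
by apply: measurable_indic; exact: measurable_level.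
Qed.

Let step_map_level k a x : a \in all_floors k -> level u a x ->
  step_map k x = left_end v a.
Proof.
move=> ha xa; rewrite /step_map (bigD1_seq a) //= ?uniq_all_floors //.
rewrite indicE mem_set // mulr1 big1_seq ?addr0 // => b /andP[ba hb].
rewrite indicE memNset ?mulr0 // => xb; move/eqP: ba; apply.
by apply: (level_disj m1 n1 famu hb ha); exists x.
Qed.

Let step_map_out k x : ~ unit_itv x -> step_map k x = 0.
Proof.
move=> xu; rewrite /step_map big1_seq // => a /= /mem_all_floors[j ha].
by rewrite indicE memNset ?mulr0 // => xa; apply/xu/(level_unit m1 n1 famu ha).
Qed.

(** The address of [x] at a later stage extends the one at stage [k], and an extended address gives
    a smaller floor in every family. So later approximations stay in the floor already reached. *)
Let step_map_next k d j a x : a \in floors k j -> level u a x ->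
  exists i b, [/\ b \in floors (k + d) i, level u b x & level v b `<=` level v a].
Proof.
move=> ha xa; elim: d => [|d [i [b [hb xb sb]]]]; first by exists j, a; rewrite addn0; split.
have xu := level_unit m1 n1 famu ha xa.
have [c /mem_all_floors[i' hc] xc] := level_cover m1 n1 famu (k + d).+1 xu.
exists i', c; rewrite addnS; split=> //.
have [p [q [b' [hq hb' e]]]] := floorsS m1 n1 _ _ _ hc.
have xb' : level u b' x by apply: (level_subset m1 n1 famu hb' hq); rewrite -e.
have eb : b' = b.
  apply: (level_disj m1 n1 famu (k := k + d)); last by exists x.
  - by apply/mem_all_floors; exists p.
  - by apply/mem_all_floors; exists i.
rewrite e; apply: subset_trans (level_subset m1 n1 famv hb' hq) _.
by rewrite eb.
Qed.

Let left_end_level k j a : a \in floors k j -> level v a (left_end v a).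
Proof.
by move=> ha; rewrite /level /= in_itv /= lexx ltrDl (width_floors m1 n1 v ha) v0.
Qed.

Let step_map_bounds k d j a x : a \in floors k j -> level u a x ->
  left_end v a <= step_map (k + d) x <= left_end v a + v k j.
Proof.
move=> ha xa; have [i [b [hb xb sb]]] := step_map_next d ha xa.
rewrite (step_map_level _ xb); last by apply/mem_all_floors; exists i.
have := sb _ (left_end_level hb).
by rewrite /level /= in_itv /= (width_floors m1 n1 v ha) => /andP[-> /ltW].
Qed.

Let cvg_step_map x : cvgn (step_map ^~ x).
Proof.
apply: (@cvgn_geometric_step _ _ 4) => // k.
have [xu|xu] := pselect (unit_itv x); last first.
  by rewrite !step_map_out // subrr normr0 mulr_ge0 // exprn_ge0.
have [a /mem_all_floors[j ha] xa] := level_cover m1 n1 famu k xu.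
have := step_map_bounds 1 ha xa; have := step_map_bounds 0 ha xa.
rewrite addn0 addn1 (step_map_level _ xa); last by apply/mem_all_floors; exists j.
have := family_le_pow fg famv k j.
by rewrite ler_norml => ? /andP[? ?] /andP[? ?]; apply/andP; split; lra.
Qed.

Let conj_map (x : measurableTypeR R) : measurableTypeR R := lim (step_map k x @[k --> \oo]).

Let measurable_conj_map : measurable_fun setT conj_map.
Proof.
apply: (measurable_fun_cvg measurable_step_map) => x _.
exact: cvg_step_map.
Qed.

(** The upper bound is not strict, since the limit may reach the right end of a half-open floor;
    [conj_map_point] shows that this happens on a null set. *)
Let conj_map_bounds k j a x : a \in floors k j -> level u a x ->
  left_end v a <= conj_map x <= left_end v a + v k j.
Proof.
move=> ha xa; have bd r : (k <= r)%N ->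
    left_end v a <= step_map r x <= left_end v a + v k j.
  by move=> kr; rewrite -(subnKC kr); exact: step_map_bounds.
apply/andP; split.
  apply: limr_ge; first exact: cvg_step_map.
  near=> r; have /bd /andP[] // : (k <= r)%N.
  by near: r; exact: nbhs_infty_ge.
apply: limr_le; first exact: cvg_step_map.
near=> r; have /bd /andP[] // : (k <= r)%N.
by near: r; exact: nbhs_infty_ge.
Unshelve. all: by end_near. Qed.

Lemma sum_family_floors k :
  (\sum_(a <- all_floors k) (u k (tower_of a))%:E)%E = 1%E.
Proof.
rewrite sumEFin sum_all_floors -[in RHS](sum_height m1 n1 famu k); congr (_%:E).
apply: eq_bigr => j _.
rewrite (eq_big_seq (fun=> u k j)) => [|a ha]; last by rewrite (tower_of_floors m1 n1 ha).
by rewrite big_const_seq count_predT iter_addr_0 mulr_natl.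
Qed.

Let one_level (P : address -> Prop) k (e : R) : 0 <= e ->
  (forall a b, a \in all_floors k -> b \in all_floors k -> P a -> P b -> a = b) ->
  (forall p, u k p <= e) ->
  exists U : set (measurableTypeR R), [/\ measurable U, (unit_lebesgue U <= e%:E)%E &
    forall a, a \in all_floors k -> P a -> level u a `<=` U].
Proof.
move=> e0 uniqP ue.
have [[a [ha Pa]]|no] := pselect (exists a, a \in all_floors k /\ P a).
  have /mem_all_floors[j hj] := ha.
  exists (level u a); split; first exact: measurable_level.
    apply: (@le_trans _ _ (lebesgue_measure (level u a))); last first.
      by rewrite (lebesgue_level m1 n1 famu hj) lee_fin.
    rewrite /unit_lebesgue /mrestr setIidl //; exact: level_unit hj.
  by move=> b hb Pb; rewrite (uniqP _ _ hb ha Pb Pa).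
exists set0; split => //; first by rewrite measure0 lee_fin.
by move=> a ha Pa; exfalso; apply: no; exists a.
Qed.

(** At each stage the preimage meets at most two floors: the one whose image floor contains [t] and
    the one whose image floor ends at [t]. Both are arbitrarily short. *)
Let conj_map_point (t : R) : unit_lebesgue (conj_map @^-1` [set t]) = 0%E.
Proof.
have mpt : measurable (conj_map @^-1` [set t]).
  rewrite -[X in measurable X]setTI; apply: measurable_conj_map.
    exact: measurableT.
  exact: (measurable_set1 t).
apply/eqP; rewrite eq_le measure_ge0 andbT; apply/lee_addgt0Pr => e e0.
rewrite add0e.
have [k hk] := family_small fg famu (divr_gt0 e0 (ltr0n _ 2)).
have e20 : 0 <= e / 2 by rewrite divr_ge0 // ltW.
have ue p : u k p <= e / 2 by exact: hk.
have [|U1 [mU1 U1e hU1]] := @one_level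
    (fun a => left_end v a <= t < left_end v a + width v a) k _ e20 _ ue.
  move=> a b ha hb ta tb; apply: (level_disj m1 n1 famv ha hb).
  by exists t; split; rewrite /level /= in_itv.
have [|U2 [mU2 U2e hU2]] := @one_level
    (fun a => t = left_end v a + width v a) k _ e20 _ ue.
  move=> a b /mem_all_floors[i ha] /mem_all_floors[j hb].
  rewrite (width_floors m1 n1 v ha) (width_floors m1 n1 v hb) => ta tb.
  apply/eqP/negPn/negP => /(floors_disj m1 n1 famv ha hb).
  by have := v0 k i; have := v0 k j; lra.
have sub : conj_map @^-1` [set t] `<=` ~` unit_itv `|` (U1 `|` U2).
  move=> x /= xt; have [xu|] := pselect (unit_itv x); [right|by left].
  have [a ha xa] := level_cover m1 n1 famu k xu.
  have /mem_all_floors[j hj] := ha.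
  have := conj_map_bounds hj xa; rewrite xt => /andP[t1].
  rewrite le_eqVlt -(width_floors m1 n1 v hj) => /orP[/eqP t2|t2].
    by right; exact: (hU2 a).
  by left; apply: (hU1 a) => //; rewrite t1.
have mC := measurableC (@measurable_unit R).
have C0 : unit_lebesgue (~` unit_itv : set (measurableTypeR R)) = 0%E.
  by rewrite /unit_lebesgue /mrestr setICl measure0.
apply: (@le_trans _ _ (unit_lebesgue (~` unit_itv `|` (U1 `|` U2)))).
  by apply: le_measure; rewrite ?inE //; do ?[apply: measurableU => //].
apply: le_trans (measureU2 _ _ _) _ => //; first exact: measurableU.
rewrite [X in (X + _)%E]C0 add0e; apply: le_trans (measureU2 _ _ _) _ => //.
rewrite (_ : e%:E = ((e / 2)%:E + (e / 2)%:E)%E); first exact: leeD.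
by rewrite -EFinD -splitr.
Qed.

(** Only $\ge$ is proved floor by floor. The right-hand sides add up to 1 and the left-hand sides to
    at most 1, so equality holds on every floor. *)
Lemma exists_mass_transfer : exists la : probability (measurableTypeR R) R,
  forall k j a, a \in floors k j -> la (level v a) = (u k j)%:E.
Proof.
have [la laE] := image_probability (@unit_lebesgue R) measurable_conj_map.
exists la.
have mL a := @measurable_level R v a.
have mpre A : measurable A -> measurable (conj_map @^-1` A).
  by move=> mA; rewrite -[X in measurable X]setTI; exact: measurable_conj_map.
have finla (A : set (measurableTypeR R)) : measurable A -> la A \is a fin_num.
  by move=> mA; rewrite fin_num_measure.
have ge_u k j a : a \in floors k j -> u k j <= fine (la (level v a)).
  move=> ha; rewrite -lee_fin fineK ?finla // laE.
  pose Y := conj_map @^-1` [set left_end v a + width v a].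
  have mY : measurable Y by apply: mpre; exact: (measurable_set1 (left_end v a + width v a)).
  rewrite -(lebesgue_level m1 n1 famu ha).
  apply: (@le_trans _ _ (unit_lebesgue (conj_map @^-1` level v a `|` Y))).
    have -> : lebesgue_measure (level u a) = unit_lebesgue (level u a).
      by rewrite /unit_lebesgue /mrestr setIidl //; exact: level_unit ha.
    apply: le_measure; rewrite ?inE; [exact: measurable_level| |].
      by apply: measurableU => //; apply: mpre; exact: mL.
    move=> x xa; have := conj_map_bounds ha xa.
    rewrite -(width_floors m1 n1 v ha) => /andP[h1].
    rewrite le_eqVlt => /orP[/eqP h2|h2]; [by right|left].
    by rewrite /level /= in_itv /= h1.
  apply: le_trans (measureU2 _ _ _) _ => //; first by apply: mpre; exact: mL.
  by rewrite [X in (_ + X)%E]conj_map_point adde0.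
move=> k j a ha; apply/eqP; rewrite eq_le; apply/andP; split; last first.
  by rewrite -[leRHS]fineK ?finla // lee_fin; exact: ge_u.
rewrite -[leLHS]fineK ?finla // lee_fin.
have haa : a \in all_floors k by apply/mem_all_floors; exists j.
have ua := uniq_all_floors m1 n1 k.
have h1 : \sum_(b <- all_floors k) fine (la (level v b)) <= 1.
  rewrite -lee_fin -sumEFin.
  rewrite (eq_bigr (fun b => la (level v b))); last by move=> b _; rewrite fineK ?finla.
  rewrite -(measure_levels m1 n1 famv la (k := k)) //; apply: probability_le1.
  by apply: fin_bigcup_measurable => // b _; exact: mL.
have h2 : \sum_(b <- all_floors k) u k (tower_of b) = 1.
  by have := sum_family_floors k; rewrite sumEFin => -[].
move: h1; rewrite -h2 !(bigD1_seq a) //= (tower_of_floors m1 n1 ha).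
have : \sum_(b <- all_floors k | b != a) u k (tower_of b) <=
       \sum_(b <- all_floors k | b != a) fine (la (level v b)).
  rewrite big_seq_cond [leRHS]big_seq_cond; apply: ler_sum => b /andP[hb _].
  have /mem_all_floors[i hi] := hb.
  by rewrite (tower_of_floors m1 n1 hi); exact: ge_u hi.
lra.
Qed.

End MassTransfer.

(** * Invariance and ergodicity of the transported measure *)

Section ErgodicMeasure.
Variables m n : nat -> nat.
Hypothesis fg : fast_growth m n.
Context {R : realType}.
Variables u v : nat -> 'I_4 -> R.
Hypotheses (famu : keane_family m n u) (famv : keane_family m n v).
Variable l : 'cV[R]_4.
Hypothesis lv : forall p, l p 0 = v 0%N p.
Variable la : probability (measurableTypeR R) R.
Hypothesis la_level : forall k j a, a \in floors m n k j ->
  la (level v a) = (u k j)%:E.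

Local Notation floors := (floors m n).
Local Notation all_floors := (all_floors m n).
Local Notation T := (iet l).

Let m1 k : (1 < m k.+1)%N. Proof. by have [] := fast_growth_gt1 fg k. Qed.
Let n1 k : (1 < n k.+1)%N. Proof. by have [] := fast_growth_gt1 fg k. Qed.
Let u0 : forall k p, 0 < u k p. Proof. by case: famu. Qed.
Let mL a : measurable (level v a : set (measurableTypeR R)).
Proof. exact: measurable_level. Qed.
Let mU : measurable (unit_itv : set (measurableTypeR R)).
Proof. exact: measurable_unit. Qed.

Let la_fin (A : set (measurableTypeR R)) : measurable A -> la A \is a fin_num.
Proof. by move=> mA; rewrite fin_num_measure. Qed.

Lemma transfer_unit : la unit_itv = 1%E.
Proof.
apply/eqP; rewrite eq_le probability_le1 //=.
rewrite -(sum_family_floors fg famu 0).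
rewrite (eq_big_seq (fun a => la (level v a))); last first.
  move=> a /mem_all_floors[j ha].
  by rewrite (tower_of_floors m1 n1 ha) (la_level ha).
rewrite -(measure_levels m1 n1 famv la (k := 0)) ?uniq_all_floors //.
apply: le_measure; rewrite ?inE //.
  by apply: fin_bigcup_measurable => // a _; exact: mL.
by move=> x [a /= /mem_all_floors[j ha]]; exact: (level_unit m1 n1 famv ha).
Qed.

Lemma transfer_unitC : la (~` unit_itv) = 0%E.
Proof. by rewrite probability_setC // transfer_unit subee. Qed.

Let la_unitI (A : set (measurableTypeR R)) : measurable A ->
  la A = la (unit_itv `&` A).
Proof.
move=> mA; rewrite -[in LHS](setTI A) -(setUv unit_itv) setIUl measureU //.
- rewrite [X in (_ + X)%E](_ : _ = 0%E) ?adde0 //.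
  apply: (subset_measure0 _ (measurableC mU) _ transfer_unitC).
  + by apply: measurableI => //; exact: measurableC.
  + by move=> x [].
- exact: measurableI.
- by apply: measurableI => //; exact: measurableC.
- by rewrite setIACA setICr set0I.
Qed.

Let measurable_iet : measurable_fun [set: measurableTypeR R]
  (T : measurableTypeR R -> measurableTypeR R).
Proof.
apply: measurable_funD; first exact: measurable_id.
apply: measurable_sum => j; apply: measurable_funM; last exact: measurable_cst.
by apply: measurable_indic; exact: measurable_itv.
Qed.

Let mpre (A : set (measurableTypeR R)) : measurable A -> measurable (T @^-1` A).
Proof.
by move=> mA; rewrite -[X in measurable X]setTI; apply: measurable_iet.
Qed.

(** The image measure agrees with [la] on every floor except the four bottom ones, by
    [preimage_level]. As its total on floors is at most 1, on the bottom floors it cannot exceed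
    [la] in total, and there [la] is small. *)
Lemma transfer_invariant : invariant_measure T la.
Proof.
have [nu nuE] := image_probability la measurable_iet.
suff eq_nu A : measurable A -> nu A = la A.
  move=> A mA _; rewrite -la_unitI; last exact: mpre.
  by rewrite -(eq_nu A) // nuE.
have nu_fin (B : set (measurableTypeR R)) : measurable B -> nu B \is a fin_num.
  by move=> mB; rewrite fin_num_measure.
have nuC : nu (~` unit_itv) = 0%E.
  rewrite nuE.
  apply: (subset_measure0 _ (measurableC mU) _ transfer_unitC).
    by apply: mpre; exact: measurableC.
  by move=> x /= xu xu'; apply: xu; exact: (iet_unit m1 n1 famv lv xu').
have setT_fin (P : probability (measurableTypeR R) R) : (P setT < +oo)%E.
  by rewrite probability_setT ltry.
move=> mA; apply: (eq_measure_levels fg famv) => //; [exact: setT_fin|exact: setT_fin|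
  exact: transfer_unitC|].
move=> e e0.
(* Four bottom floors of mass at most $e/8$ have mass at most $e/2$ for [la], hence also for its
   image, and the two contributions add up to $e$. *)
have [k hk] := family_small fg famu (divr_gt0 e0 (ltr0n _ 8)).
have ue p : u k p <= e / 8 by exact: hk.
exists k.
pose f a := fine (nu (level v a)); pose g a := u k (tower_of a).
pose is_base a := a == head [::] (floors k (tower_of a)).
have laE a : a \in all_floors k -> fine (la (level v a)) = g a.
  move=> /mem_all_floors[j ha].
  by rewrite (la_level ha) /g (tower_of_floors m1 n1 ha).
have f0 a : 0 <= f a by exact: fine_ge0.
have g0 a : 0 <= g a by rewrite /g ltW.
have fg_eq a : a \in all_floors k -> ~~ is_base a -> f a = g a.
  move=> /mem_all_floors[j ha]; rewrite /is_base (tower_of_floors m1 n1 ha).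
  have [i ij ia] := (nthP [::] ha); rewrite -ia.
  case: i ij {ia} => [|i] ij; first by rewrite nth0 eqxx.
  move=> _; rewrite /f nuE la_unitI; last exact: mpre.
  rewrite (preimage_level m1 n1 famv lv ij) (la_level (k := k) (j := j)); last first.
    by apply: mem_nth; exact: ltnW.
  by rewrite /g (@tower_of_floors m n m1 n1 k j) // mem_nth.
have sumg : \sum_(a <- all_floors k) g a = 1.
  by have := sum_family_floors fg famu k; rewrite sumEFin => -[].
have sumf : \sum_(a <- all_floors k) f a <= 1.
  rewrite -lee_fin -sumEFin (eq_bigr (fun a => nu (level v a))); last first.
    by move=> a _; rewrite fineK ?nu_fin.
  rewrite -(measure_levels m1 n1 famv nu (k := k)) ?uniq_all_floors //.
  apply: probability_le1.
  by apply: fin_bigcup_measurable => // a _; exact: mL.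
have sumgb : \sum_(a <- all_floors k | is_base a) g a <= e / 2.
  rewrite big_mkcond sum_all_floors sum_ord4.
  have tow j : \sum_(a <- floors k j) (if is_base a then g a else 0) <= e / 8.
    have [h [t [ht _ _ _]]] := floors_shift m1 n1 famv k j.
    have uq := uniq_floors m1 n1 k j.
    have hh : h \in floors k j by rewrite ht mem_head.
    rewrite ht big_cons big1_seq ?addr0.
      by case: ifP => _; [rewrite /g|rewrite divr_ge0 // ltW].
    move=> a /= at'; rewrite /is_base.
    have ha : a \in floors k j by rewrite ht inE at' orbT.
    rewrite (tower_of_floors m1 n1 ha) ht /=; case: eqP => // ah.
    by move: uq; rewrite ht /= -ah at'.
  by have := tow ix1; have := tow ix2; have := tow ix3; have := tow ix4; lra.
have split_base (F : address -> R) : \sum_(a <- all_floors k) F a =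
    \sum_(a <- all_floors k | is_base a) F a +
    \sum_(a <- all_floors k | ~~ is_base a) F a by rewrite (bigID is_base).
have nb : \sum_(a <- all_floors k | ~~ is_base a) f a =
    \sum_(a <- all_floors k | ~~ is_base a) g a.
  rewrite big_seq_cond [RHS]big_seq_cond.
  by apply: eq_bigr => a /andP[ha ba]; exact: fg_eq.
have sumfb : \sum_(a <- all_floors k | is_base a) f a <= e / 2.
  by have := split_base f; have := split_base g; rewrite nb; lra.
split.
  rewrite split_base [X in _ + X]big1_seq ?addr0; last first.
    by move=> a /andP[ba ha]; rewrite laE // -/(f a) fg_eq // subrr normr0.
  apply: (@le_trans _ _ (\sum_(a <- all_floors k | is_base a) (f a + g a))).
    rewrite big_seq_cond [leRHS]big_seq_cond; apply: ler_sum => a /andP[ha _].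
    rewrite laE // -/(f a) ler_norml; have := f0 a; have := g0 a.
    by move=> *; apply/andP; split; lra.
  by rewrite big_split /=; lra.
move=> a ha; split; last by rewrite laE //; have := ue (tower_of a); rewrite /g; lra.
rewrite -/(f a); have [ba|ba] := boolP (is_base a); last first.
  by rewrite fg_eq //; have := ue (tower_of a); rewrite /g; lra.
apply: (@le_trans _ _ (e / 2)); last by lra.
apply: le_trans sumfb; rewrite big_mkcond (bigD1_seq a) //= ?uniq_all_floors //.
by rewrite ba lerDl; apply: sumr_ge0 => b _; case: ifP.
Qed.

(** The trace of an invariant set has the same mass [kap j] on all floors of tower [j]. One tower
    carries almost everything, so the trace is nearly proportional to [la] on floors. *)
Lemma transfer_ergodic (t : 'I_4) :
  (forall e, 0 < e -> exists k0, forall k, (k0 <= k)%N ->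
     1 - e <= (height m n k t)%:R * u k t) ->
  ergodic_measure T la.
Proof.
move=> conc A mA AU invA.
pose c := fine (la A).
have c0 : 0 <= c by exact: fine_ge0.
have c1 : c <= 1.
  by rewrite -lee_fin fineK ?la_fin //; exact: probability_le1.
pose mu1 := mrestr la mA.
pose mu2 := mscale (NngNum c0) la.
(* Evaluated at [A] itself the proportionality reads $c=c^2$. *)
suff eqA : mu1 A = mu2 A.
  move: eqA; rewrite /mu1 /mu2 /mrestr /mscale setIid /=.
  rewrite -[la A]fineK ?la_fin // -/c -EFinM => -[/eqP].
  rewrite -subr_eq0 -{1}[c]mulr1 -mulrBr mulf_eq0 subr_eq0.
  by case/orP=> [/eqP ->|/eqP <-]; [left|right].
apply: (eq_measure_levels fg famv) => //.
- rewrite /= /mu1 /mrestr setTI; apply: le_lt_trans (probability_le1 la mA) _.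
  exact: ltry.
- by rewrite /= /mu2 /mscale [X in (_ * X)%E](probability_setT la) mule1 ltry.
- rewrite /= /mu1 /mrestr (_ : _ `&` _ = set0) ?measure0 //.
  by rewrite -subset0 => x [xu /AU].
- by rewrite /= /mu2 /mscale [X in (_ * X)%E]transfer_unitC mule0.
move=> e e0.
have [k1 hk1] := family_small fg famu e0.
have [k2 hk2] := conc _ (divr_gt0 e0 (ltr0n _ 2)).
pose k := maxn k1 k2; exists k.
have ue p : u k p <= e by apply: hk1; exact: leq_maxl.
have ct : 1 - e / 2 <= (height m n k t)%:R * u k t by apply: hk2; exact: leq_maxr.
pose f a := fine (mu1 (level v a)); pose g a := u k (tower_of a).
have mu2E a : a \in all_floors k -> fine (mu2 (level v a)) = c * g a.
  move=> /mem_all_floors[j ha].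
  rewrite /mu2 /= /mscale [X in (_ * X)%E](la_level ha) /=.
  by rewrite /g (tower_of_floors m1 n1 ha).
have f0 a : 0 <= f a by apply: fine_ge0; apply: measure_ge0; exact: measurableI.
have fle a : a \in all_floors k -> f a <= g a.
  move=> /mem_all_floors[j ha]; rewrite /f /g (tower_of_floors m1 n1 ha).
  rewrite -lee_fin fineK; last by apply: la_fin; exact: measurableI.
  rewrite -(la_level ha); apply: le_measure; rewrite ?inE;
    [exact: measurableI|exact: mL|by move=> x []].
have g0 a : 0 <= g a by rewrite /g ltW.
pose kap j := f (head [::] (floors k j)).
have f_tower j a : a \in floors k j -> f a = kap j.
  move=> /(nthP [::])[i ij <-]; elim: i ij => [|i IH] ij.
    by rewrite /kap nth0.
  rewrite -(IH (ltnW ij)) /f; congr fine; rewrite /mu1 /mrestr.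
  rewrite la_unitI; last exact: measurableI.
  have mi : measurable (level v (nth [::] (floors k j) i.+1) `&` A
    : set (measurableTypeR R)) by exact: measurableI.
  rewrite -la_unitI // -(transfer_invariant mi); last by move=> x [_ /AU].
  rewrite preimage_setI -[in LHS](setIid unit_itv) setIACA.
  by rewrite (preimage_level m1 n1 famv lv ij) invA.
have tow_sum (F : address -> R) (K : 'I_4 -> R) j :
    (forall a, a \in floors k j -> F a = K j) ->
    \sum_(a <- floors k j) F a = (height m n k j)%:R * K j.
  move=> FK; rewrite (eq_big_seq (fun=> K j)) //.
  by rewrite big_const_seq count_predT iter_addr_0 mulr_natl.
have sumf : \sum_(a <- all_floors k) f a = c.
  apply: EFin_inj; rewrite -sumEFin (eq_bigr (fun a => mu1 (level v a))); last first.
    by move=> a _; rewrite fineK // la_fin //; exact: measurableI.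
  rewrite -(measure_levels m1 n1 famv mu1 (k := k)) ?uniq_all_floors //.
  rewrite /= /mu1 /mrestr (_ : _ `&` A = A); first by rewrite fineK ?la_fin.
  apply/seteqP; split=> [x []//|x Ax]; split=> //.
  have [a ha xa] := level_cover m1 n1 famv k (AU _ Ax).
  by exists a.
have sumK : \sum_j (height m n k j)%:R * kap j = c.
  rewrite -sumf sum_all_floors; apply: eq_bigr => j _.
  by rewrite (@tow_sum f kap j) // => a; exact: f_tower.
have sumU := sum_height m1 n1 famu k.
have kap_le j : 0 <= kap j <= u k j.
  have [h [s [hs _ _ _]]] := floors_shift m1 n1 famv k j.
  have hh : h \in floors k j by rewrite hs mem_head.
  rewrite /kap hs /= f0 /=; apply: le_trans (fle h _) _.
    by apply/mem_all_floors; exists j.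
  by rewrite /g (tower_of_floors m1 n1 hh).
split; last first.
  move=> a ha; split; first by apply: le_trans (fle a ha) _; exact: ue.
  rewrite mu2E //; apply: le_trans (ue (tower_of a)).
  by rewrite ler_piMl.
rewrite sum_all_floors.
rewrite (eq_bigr (fun j => (height m n k j)%:R * `|kap j - c * u k j|)); last first.
  move=> j _; apply: (@tow_sum _ (fun j => `|kap j - c * u k j|)) => a ha.
  rewrite mu2E; last by apply/mem_all_floors; exists j.
  by rewrite -/(f a) (f_tower _ _ ha) /g (tower_of_floors m1 n1 ha).
have diff_le j : `|kap j - c * u k j| <= u k j.
  have /andP[k0 k1'] := kap_le j; have : c * u k j <= u k j by rewrite ler_piMl // ltW.
  have : 0 <= c * u k j by rewrite mulr_ge0 // ltW.
  by rewrite ler_norml => *; apply/andP; split; lra.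
have rest : \sum_(j | j != t) (height m n k j)%:R * u k j <= e / 2.
  by move: sumU; rewrite (bigD1 t) //=; lra.
have rest' : \sum_(j | j != t) (height m n k j)%:R * `|kap j - c * u k j| <= e / 2.
  by apply: le_trans rest; apply: ler_sum => j _; rewrite ler_wpM2l.
rewrite (bigD1 t) //=.
suff : (height m n k t)%:R * `|kap t - c * u k t| <= e / 2 by lra.
(* Both $\sum_j b_j\,\mathrm{kap}_j$ and $c\sum_j b_ju_j$ equal $c$, so the deviation on the main
   tower is opposite to that on the three small towers. *)
have -> : (height m n k t)%:R * `|kap t - c * u k t| =
    `|\sum_(j | j != t) (height m n k j)%:R * (kap j - c * u k j)|.
  have : \sum_j (height m n k j)%:R * (kap j - c * u k j) = 0.
    under eq_bigr do rewrite mulrBr mulrCA.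
    by rewrite sumrB sumK -mulr_sumr sumU mulr1 subrr.
  rewrite (bigD1 t) //= => /eqP; rewrite addr_eq0 => /eqP h.
  by rewrite -[X in X * _]normr_nat -normrM h normrN.
apply: le_trans (ler_norm_sum _ _ _) _; apply: le_trans rest'.
by apply: ler_sum => j _; rewrite normrM normr_nat.
Qed.

Lemma transfer_keane_measure (L : 'cV[R]_4) (t : 'I_4) :
  (forall p, L p 0 = u 0%N p) ->
  (forall e, 0 < e -> exists k0, forall k, (k0 <= k)%N ->
     1 - e <= (height m n k t)%:R * u k t) ->
  is_keane_measure l L la.
Proof.
move=> Lu conc; split.
- exact: transfer_unit.
- exact: transfer_invariant.
- exact: transfer_ergodic conc.
- move=> j; rewrite (iet_piece_level m1 n1 lv) (la_level (k := 0) (j := j)) ?Lu //.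
  by rewrite inE.
Qed.

Lemma transfer_atomless (x : R) : la [set x] = 0%E.
Proof.
have mx : measurable ([set x] : set (measurableTypeR R)).
  exact: (measurable_set1 x).
have [xu|xu] := pselect (unit_itv x); last first.
  apply: (subset_measure0 _ (measurableC mU) _ transfer_unitC) => //.
  by move=> _ ->.
apply/eqP; rewrite eq_le measure_ge0 andbT; apply/lee_addgt0Pr => e e0.
rewrite add0e; have [k hk] := family_small fg famu e0.
have [a /mem_all_floors[j ha] xa] := level_cover m1 n1 famv k xu.
apply: (@le_trans _ _ (la (level v a))).
  by apply: le_measure; rewrite ?inE // => _ ->.
by rewrite (la_level ha) lee_fin; exact: hk.
Qed.

End ErgodicMeasure.

(** * Hausdorff dimension of a measure *)

Section DoubleSeries.
Context {R : realType}.
Local Open Scope ereal_scope.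

Lemma nneseries_pair (g : nat -> nat -> \bar R) : (forall i j, 0 <= g i j) ->
  exists f : nat -> nat * nat, (forall p, exists i, f i = p) /\
    \sum_(i <oo) g (f i).1 (f i).2 = \sum_(i <oo) \sum_(j <oo) g i j.
Proof.
move=> g0.
have /ppcard_eqP[f] : ([set: nat] #= [set: nat * nat])%card.
  by rewrite card_eq_sym; exact: card_nat2.
exists f; split.
  by move=> p; exists (f^-1%FUN p); rewrite invK ?inE.
apply/esym; transitivity (\esum_(l in [set: nat] `*` [set: nat]) g l.1 l.2).
  rewrite (_ : _ `*` _ = setT `*`` (fun=> setT)); last by apply/seteqP; split.
  rewrite -(@esum_esum _ _ _ _ _ (fun i j => g i j))//.
  rewrite nneseries_esumT; last by move=> i; exact: nneseries_ge0.
  by apply: eq_esum => i _; rewrite nneseries_esumT.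
rewrite (reindex_esum [set: nat] _ f); last first.
  have := @bijTT _ _ f.
  by rewrite -setTT_bijective/= -[in X in set_bij _ X _ -> _](@setXTT nat nat).
by rewrite nneseries_esumT.
Qed.

End DoubleSeries.

Section HausdorffGeneral.
Context {R : realType} {T : Type}.
Variables (X : set T) (d : T -> T -> R).
Local Open Scope ereal_scope.

Lemma diam_pow_ge0 (s : R) (U : set T) : 0 <= diam_pow d s U.
Proof. by rewrite /diam_pow; case: ifP => // _; exact: poweR_ge0. Qed.

Lemma hausdorff_premeasure_ge0 (s delta : R) (S : set T) :
  0 <= hausdorff_premeasure X d s delta S.
Proof.
apply: le_ereal_inf_tmp => _ [U _ ->]; apply: nneseries_ge0 => i _ _.
exact: diam_pow_ge0.
Qed.

Lemma hausdorff_measure_eq0 (s : R) (S : set T) :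
  (forall delta, (0 < delta)%R -> hausdorff_premeasure X d s delta S = 0) ->
  hausdorff_measure X d s S = 0.
Proof.
move=> h; apply/cvg_lim => //.
apply: (@cvg_trans _ ((fun=> 0 : \bar R) delta @[delta --> (0%R : R)^'+])).
  apply: near_eq_cvg; apply: filterS (@nbhs_right_gt R 0%R) => x x0.
  by rewrite h.
exact: cvg_cst.
Qed.

Lemma hausdorff_premeasure_eq0 (s : R) (S : set T) :
  hausdorff_measure X d s S = 0 ->
  forall delta, (0 < delta)%R -> hausdorff_premeasure X d s delta S = 0.
Proof.
move=> h delta d0; apply/eqP; rewrite eq_le hausdorff_premeasure_ge0 andbT.
have mono : {in Interval (BRight (0 : R)%R) (BInfty R false) &,
    nonincreasing_fun (fun x => hausdorff_premeasure X d s x S)}.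
  move=> x y _ _ xy; apply: ereal_inf_le_tmp => _ [U [c1 c2 c3] ->].
  exists U => //; split=> // i; apply: le_trans (c2 i) _.
  by rewrite lee_fin.
have := @nonincreasing_at_right_cvge R _ 0%R (BInfty R false) isT mono.
move=> /(cvg_lim (@ereal_hausdorff R)) e.
rewrite -h /hausdorff_measure e; apply: ereal_sup_ubound.
by exists delta => //=; rewrite in_itv /= d0.
Qed.

Lemma hausdorff_dim_le (s : R) (S : set T) : (0 <= s)%R ->
  hausdorff_measure X d s S = 0 -> hausdorff_dim X d S <= s%:E.
Proof. by move=> s0 h; apply: ereal_inf_lbound; exists s. Qed.

Lemma hausdorff_dim_ge0 (S : set T) : 0 <= hausdorff_dim X d S.
Proof.
by apply: le_ereal_inf_tmp => _ [s [s0 _] <-]; rewrite lee_fin.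
Qed.

Lemma diam_pow_le (s w : R) (U : set T) : (0 <= s)%R -> (0 <= w)%R ->
  (forall x, U x -> (0 <= d x x)%R) ->
  (forall x y, U x -> U y -> (d x y <= w)%R) ->
  diam d U <= w%:E /\ diam_pow d s U <= (w `^ s)%:E.
Proof.
move=> s0 w0 dxx dw.
have dU : diam d U <= w%:E.
  by apply: ge_ereal_sup => _ [x [y [Ux Uy ->]]]; rewrite lee_fin; exact: dw.
split=> //; rewrite /diam_pow; case: ifPn => [_|/set0P[x Ux]].
  by rewrite lee_fin powR_ge0.
rewrite -poweR_EFin; apply: gt0_ler_poweR => //.
- rewrite in_itv /= leey andbT; apply: (@le_trans _ _ (d x x)%:E).
    by rewrite lee_fin; exact: dxx.
  by apply: ereal_sup_ubound; exists x, x.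
- by rewrite in_itv /= lee_fin w0 leey.
Qed.

End HausdorffGeneral.

Section MeasureDist.
Context {R : realType}.
Variable nu : probability (measurableTypeR R) R.
Hypothesis nu_atomless : forall x, nu [set x] = 0%E.
Local Notation d := (measure_dist nu).

Let nu_fin (A : set (measurableTypeR R)) : measurable A -> nu A \is a fin_num.
Proof. by move=> mA; rewrite fin_num_measure. Qed.

Let mI (i : interval R) : measurable ([set` i] : set (measurableTypeR R)).
Proof. exact: measurable_itv. Qed.

Lemma measure_dist_ge0 x y : 0 <= d x y.
Proof. by apply: fine_ge0; apply: measure_ge0. Qed.

Lemma measure_dist_sym x y : d x y = d y x.
Proof. by rewrite /measure_dist minC maxC. Qed.

Lemma measure_distxx x : d x x = 0.
Proof. by rewrite /measure_dist minxx maxxx set_itv1 nu_atomless. Qed.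

Lemma measure_dist_triangle x y z : d x z <= d x y + d y z.
Proof.
rewrite /measure_dist -fineD ?nu_fin //; apply: fine_le.
- by rewrite nu_fin.
- by rewrite fin_numD !nu_fin.
apply: le_trans (measureU2 _ (mI _) (mI _)).
apply: le_measure; rewrite ?inE //; first by apply: measurableU.
move=> t /=; rewrite !in_itv /=.
by case: (leP x z); case: (leP x y); case: (leP y z) => ? ? ? /andP[? ?];
  have [?|?] := leP t y; (try by [left; apply/andP; split; lra]);
  right; apply/andP; split; lra.
Qed.

Lemma measure_dist_le (E : set (measurableTypeR R)) x y : measurable E ->
  is_interval (E : set R) -> E x -> E y -> d x y <= fine (nu E).
Proof.
move=> mE iE Ex Ey; apply: fine_le; rewrite ?nu_fin //.
apply: le_measure; rewrite ?inE // => t /=; rewrite in_itv /= => /andP[h1 h2].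
move: h1 h2; case: (leP x y) => _ h1 h2; first by apply: (iE x y) => //; rewrite h1.
by apply: (iE y x) => //; rewrite h1.
Qed.

(** Covers must be open for the distance of the measure, which a floor need not be; thickening by
    half its size $w$ gives diameter at most $w/2+w+w/2=2w$. *)
Definition thicken (E : set R) (e : R) : set R :=
  [set y | unit_itv y /\ exists2 x, E x & d x y < e].

Lemma thicken_open (E : set R) (e : R) : metric_open unit_itv d (thicken E e).
Proof.
split=> [x []//|y [yu [x Ex xy]]]; exists (e - d x y); first by rewrite subr_gt0.
move=> z zu yz; split=> //; exists x => //.
by have := measure_dist_triangle x y z; lra.
Qed.

Lemma subset_thicken (E : set R) (e : R) : 0 < e -> E `<=` unit_itv ->
  E `<=` thicken E e.
Proof.
by move=> e0 EU x Ex; split; [exact: EU|exists x => //; rewrite measure_distxx].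
Qed.

Lemma thicken_diam (E : set R) (w s : R) : 0 < w -> 0 <= s ->
  (forall x y, E x -> E y -> d x y <= w) ->
  (diam d (thicken E (w / 2)) <= (2 * w)%:E)%E /\
  (diam_pow d s (thicken E (w / 2)) <= ((2 * w) `^ s)%:E)%E.
Proof.
move=> w0 s0 Ew; apply: diam_pow_le => //; first by rewrite mulr_ge0 // ltW.
  by move=> x _; exact: measure_dist_ge0.
move=> x y [_ [x' Ex xx]] [_ [y' Ey yy]].
have := measure_dist_triangle x x' y; have := measure_dist_triangle x' y' y.
have := Ew _ _ Ex Ey; rewrite (measure_dist_sym x x'); lra.
Qed.

(** Borel-Cantelli argument: a point lying in sets of arbitrarily late families is covered by the
    families after any stage $K$, and the sums of these form the tail $2C/2^K$ of a geometric
    series. *)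
Lemma hausdorff_measure_limsup (I : eqType) (F : nat -> seq I) (E : I -> set R)
    (w : I -> R) (s C : R) (k0 : nat) (S : set R) :
  0 < s -> 0 <= C ->
  (forall k a, a \in F k -> [/\ E a `<=` unit_itv, 0 < w a &
     forall x y, E a x -> E a y -> d x y <= w a]) ->
  (forall delta, 0 < delta -> exists K, forall k a, (K <= k)%N -> a \in F k ->
     2 * w a <= delta) ->
  (forall k, (k0 <= k)%N -> \sum_(a <- F k) (2 * w a) `^ s <= C / 2 ^+ k) ->
  (forall x, S x -> forall K, exists k a, [/\ (K <= k)%N, a \in F k & E a x]) ->
  hausdorff_measure unit_itv d s S = 0%E.
Proof.
move=> s0 C0 HF Hsmall Hsum HS; apply: hausdorff_measure_eq0 => delta delta0.
apply/eqP; rewrite eq_le hausdorff_premeasure_ge0 andbT.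
apply/lee_addgt0Pr => e e0; rewrite add0e.
have [K1 hK1] := Hsmall _ delta0.
have [K2 hK2] : exists K2, forall k, (K2 <= k)%N -> 2 * C / 2 ^+ k <= e.
  have : (fun k : nat => (2 * C) * 2^-1 ^+ k) @ \oo --> (0 : R).
    by apply: cvg_geometric; rewrite ger0_norm //; lra.
  move=> /cvgrPdist_le /(_ _ e0) [k _ hk]; exists k => i ki.
  have := hk i ki; rewrite sub0r normrN exprVn ger0_norm //.
  by rewrite divr_ge0 // mulr_ge0.
pose K := maxn k0 (maxn K1 K2).
have [kK0 kK1 kK2] : [/\ (k0 <= K)%N, (K1 <= K)%N & (K2 <= K)%N].
  by rewrite /K !leq_max !leqnn !orbT.
(* [drop] reads the $j$-th member without a default element; past the end of the list the set is
   empty and contributes 0. *)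
pose V k j := if drop j (F (K + k)%N) is a :: _ then thicken (E a) (w a / 2) else set0.
have V_diam k j : (diam d (V k j) <= delta%:E)%E.
  rewrite /V; case e1: (drop j _) => [|a r].
    by apply: ge_ereal_sup => z [x [y []]].
  have aF : a \in F (K + k)%N by rewrite (@mem_drop j) // e1 mem_head.
  have [Eu w0 Ew] := HF _ _ aF.
  apply: le_trans (thicken_diam w0 (ltW s0) Ew).1 _; rewrite lee_fin.
  by apply: hK1 aF; apply: leq_trans kK1 _; exact: leq_addr.
have V_open k j : metric_open unit_itv d (V k j).
  rewrite /V; case: (drop j _) => [|a r]; last exact: thicken_open.
  by split.
have g0 k j : (0 <= diam_pow d s (V k j))%E by exact: diam_pow_ge0.
have [f [f_surj f_sum]] := nneseries_pair g0.
apply: (@le_trans _ _ (\sum_(i <oo) diam_pow d s (V (f i).1 (f i).2))%E).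
  apply: ereal_inf_lbound; exists (fun i => V (f i).1 (f i).2) => //.
  split=> // x Sx; have [k [a [kK aF Eax]]] := HS x Sx K.
  have [i fi] := f_surj ((k - K)%N, index a (F k)).
  exists i => //; rewrite fi /V /= subnKC //.
  rewrite (drop_nth a) ?index_mem // nth_index //.
  have [Eu w0 Ew] := HF _ _ aF.
  by apply: subset_thicken => //; rewrite divr_gt0.
rewrite f_sum.
apply: (@le_trans _ _ (\sum_(k <oo) (2 * C / (2 ^ (k + K.+1))%:R)%:E)%E); last first.
  have := @cvg_geometric_eseries_half R (2 * C) K.
  move=> /(cvg_lim (@ereal_hausdorff R)) ->.
  by rewrite lee_fin; exact: hK2.
apply: lee_nneseries => [k _ _|k _]; first exact: nneseries_ge0.
rewrite (nneseries_split 0 (size (F (K + k)%N))) //.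
rewrite [X in (_ + X)%E]eseries0 ?adde0; last first.
  move=> j jk _; rewrite /V drop_oversize //.
  by rewrite /diam_pow eqxx.
apply: (@le_trans _ _ (\sum_(a <- F (K + k)%N) ((2 * w a) `^ s)%:E)%E).
  case e1 : (F (K + k)%N) => [|a0 r0]; first by rewrite big_geq ?big_nil.
  rewrite (big_nth a0) -e1 add0n big_seq_cond [leRHS]big_seq_cond.
  apply: lee_sum => j; rewrite mem_index_iota andbT => /andP[_ jF].
  rewrite /V (drop_nth a0) //.
  have [Eu w0 Ew] := HF _ _ (mem_nth a0 jF).
  exact: (thicken_diam w0 (ltW s0) Ew).2.
rewrite sumEFin lee_fin; apply: le_trans (Hsum _ _) _.
  by apply: leq_trans kK0 _; exact: leq_addr.
rewrite natrX addnS exprS invfM mulrA addnC.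
by rewrite [2 * C]mulrC mulfK.
Qed.

End MeasureDist.

Section Superexponential.
Context {R : realType}.

Lemma exp_le_superexp (M rho : R) : 1 <= M -> 0 < rho ->
  exists k0, forall k, (k0 <= k)%N ->
    M ^+ k.+1 <= ((2 ^ (k * k))%N%:R : R) `^ rho.
Proof.
move=> M1 rho0.
have [t Mt] : exists t : nat, M <= 2 ^+ t.
  exists (Num.truncn M).+1; apply: ltW; apply: lt_le_trans (truncnS_gt M) _.
  by rewrite -natrX ler_nat ltnW // ltn_expl.
have [k0 hk0] : exists k0 : nat, 2 * t%:R / rho <= k0%:R.
  exists (Num.truncn (2 * t%:R / rho)).+1; apply: ltW; exact: truncnS_gt.
exists (maxn k0 1) => k; rewrite geq_max => /andP[k0k k1].
rewrite natrX -(powR_mulrn (k * k)) // -powRrM.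
apply: (@le_trans _ _ ((2 ^+ t) ^+ k.+1)); first by rewrite lerXn2r ?nnegrE //; lra.
rewrite -exprM -(powR_mulrn (t * k.+1)) //; apply: ler_powR; first by lra.
have k0k' : k0%:R <= k%:R :> R by rewrite ler_nat.
have k1' : 1 <= k%:R :> R by rewrite ler1n.
have h : 2 * t%:R <= k%:R * rho by rewrite -ler_pdivrMr //; lra.
rewrite !natrM -natr1.
have : k%:R * (2 * t%:R) <= k%:R * (k%:R * rho) by rewrite ler_wpM2l.
have : 0 <= (k%:R - 1) * t%:R :> R by rewrite mulr_ge0 // subr_ge0.
lra.
Qed.

End Superexponential.

(** * Upper bound on the dimension of a measure *)

Section UpperBound.
Context {R : realType}.
Variables mu nu : probability (measurableTypeR R) R.
Hypothesis nu_atomless : forall x, nu [set x] = 0%E.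
Local Notation d := (measure_dist nu).
Variables (J : eqType) (F : nat -> seq J) (E : J -> set R) (w : J -> R).
Hypothesis HE : forall k a, a \in F k ->
  [/\ measurable (E a : set (measurableTypeR R)), E a `<=` unit_itv, 0 < w a &
     forall x y, E a x -> E a y -> d x y <= w a].
Hypothesis Hsmall : forall delta, 0 < delta ->
  exists K, forall k a, (K <= k)%N -> a \in F k -> 2 * w a <= delta.

Let tower k : set (measurableTypeR R) := \bigcup_(a in [set` F k]) E a.

Hypothesis conc : forall e, 0 < e -> exists k0, forall k, (k0 <= k)%N ->
  ((1 - e)%:E <= mu (tower k))%E.

(** The witness of full mass is the set of points that lie in infinitely many of the sets [tower k]:
    each union of late towers has mass 1, because the masses of single towers tend to 1. *)
Lemma hausdorff_dim_measure_le (sigma : R) : 0 <= sigma ->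
  (forall s, sigma < s -> exists C k0, 0 <= C /\ forall k, (k0 <= k)%N ->
     \sum_(a <- F k) (2 * w a) `^ s <= C / 2 ^+ k) ->
  (hausdorff_dim_measure mu d <= sigma%:E)%E.
Proof.
move=> sigma0 Hsum.
have mT k : measurable (tower k).
  by apply: fin_bigcup_measurable => // a ha; case: (HE ha).
pose late K : set (measurableTypeR R) := \bigcup_k tower (K + k)%N.
have mlate K : measurable (late K) by apply: bigcup_measurable => k _; exact: mT.
pose S : set (measurableTypeR R) := \bigcap_K late K.
have mS : measurable S by apply: bigcap_measurable => // K _; exact: mlate.
have late1 K : mu (~` late K) = 0%E.
  suff -> : mu (~` late K) = (1 - 1)%E by rewrite subee.
  rewrite probability_setC //; congr (_ - _)%E.
  apply/eqP; rewrite eq_le probability_le1 //=; apply/lee_addgt0Pr => e e0.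
  have [k0 hk0] := conc e0.
  have := hk0 (K + k0)%N (leq_addl _ _).
  rewrite EFinB leeBlDr // => /le_trans; apply; rewrite leeD2r //.
  by apply: le_measure; rewrite ?inE // => x Tx; exists k0.
have S1 : mu S = 1%E.
  have SC : mu (~` S) = 0%E.
    apply/eqP; rewrite eq_le measure_ge0 andbT.
    apply: (@le_trans _ _ (\sum_(K <oo) mu (~` late K))%E).
      apply: measure_sigma_subadditive => [K||]; [exact: measurableC|exact: measurableC|].
      by rewrite /S setC_bigcap.
    by rewrite eseries0.
  by rewrite -[S]setCK probability_setC ?SC ?sube0 //; exact: measurableC.
apply/lee_addgt0Pr => e e0.
apply: (@le_trans _ _ (hausdorff_dim unit_itv d S)).
  apply: ereal_inf_lbound; exists S => //; split=> // x Sx.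
  have [k _ [a /= ha]] := Sx 0%N Logic.I.
  by have [_ EU _ _] := HE ha => xa; exact: EU.
have [C [k0 [C0 hC]]] := Hsum (sigma + e) (ltr_pwDr e0 (lexx _)).
rewrite -EFinD; apply: hausdorff_dim_le; first by rewrite addr_ge0 // ltW.
apply: (@hausdorff_measure_limsup _ nu nu_atomless _ F E w _ C k0) => //.
- by rewrite ltr_wpDl.
- move=> k a ha; by have [_ h1 h2 h3] := HE ha; split.
- move=> x Sx K; have [k _ [a /= ha xa]] := Sx K Logic.I.
  by exists (K + k)%N, a; rewrite leq_addr.
Qed.

End UpperBound.

(** * Lower bound on the dimension: mass distribution *)

Section LowerBound.
Context {R : realType}.
Variables mu nu : probability (measurableTypeR R) R.
Local Notation d := (measure_dist nu).
Variables (J : choiceType) (F : nat -> seq J) (lo len : J -> R) (w : nat -> R).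
Let E a : set R := `[lo a, lo a + len a[.
Let N k : R := (size (F k))%:R.
Hypothesis F_uniq : forall k, uniq (F k).
Hypothesis E_disj : forall k a b, a \in F k -> b \in F k -> a != b ->
  lo a + len a <= lo b \/ lo b + len b <= lo a.
Hypothesis nuE : forall k a, a \in F k -> nu (E a) = (w k)%:E.
Hypothesis muE : forall k a, a \in F k -> (mu (E a) <= (N k)^-1%:E)%E.
Hypothesis w_gt0 : forall k, 0 < w k.
Hypothesis wN_le1 : forall k, w k * N k <= 1.
Hypothesis N_growth : forall k, (2 ^ (k * k) <= size (F k))%N.
Variables C M : R.
Hypotheses (C1 : 1 <= C) (M1 : 1 <= M).
Hypothesis wN_ge : forall k, (0 < k)%N -> 1 <= C * M ^+ k * (w k * N k).
Let tower k : set (measurableTypeR R) := \bigcup_(a in [set` F k]) E a.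
Hypothesis conc : forall k, ((1 - 7 / 4 ^+ k)%:E <= mu (tower k))%E.

Let mE a : measurable (E a : set (measurableTypeR R)).
Proof. exact: measurable_itv. Qed.

Let N_gt0 k : 0 < N k.
Proof. by rewrite ltr0n; apply: leq_trans (N_growth k); rewrite expn_gt0. Qed.

Let measure_sub (la : {measure set (measurableTypeR R) -> \bar R}) k (s : seq J) :
  uniq s -> {subset s <= F k} ->
  la (\bigcup_(a in [set` s]) E a) = (\sum_(a <- s) la (E a))%E.
Proof.
move=> us sF; rewrite measure_fin_bigcup //.
- exact/esym/fsbig_seq.
- move=> a b /sF ha /sF hb [x []]; rewrite /E /= !in_itv /= => /andP[? ?] /andP[? ?].
  by apply/eqP/negPn/negP => /(E_disj ha hb); lra.
Qed.

(** A member of a cover need not be an interval, while the distance measures intervals. The hull is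
    a measurable interval, and all but two of the floors meeting it lie between two points of
    [U]. *)
Definition hull (U : set R) : set (measurableTypeR R) :=
  [set z | exists x y, [/\ U x, U y & x <= z <= y]].

Let measurable_hull U : measurable (hull U).
Proof.
apply: is_interval_measurable => x y [x1 [x2 [? ? /andP[? ?]]]].
move=> [y1 [y2 [? ? /andP[? ?]]]] z /andP[? ?]; exists x1, y2; split=> //.
by apply/andP; split; lra.
Qed.

Let seq_min (f : J -> R) (s : seq J) : s != [::] ->
  exists2 a, a \in s & forall b, b \in s -> f a <= f b.
Proof.
elim: s => // a [|b s] IH _.
  by exists a; rewrite ?mem_head // => b; rewrite inE => /eqP ->.
have [c cs hc] := IH isT.
have [ac|ca] := leP (f a) (f c).
  exists a; rewrite ?mem_head // => e; rewrite inE => /orP[/eqP -> //|/hc].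
  exact: le_trans.
exists c; first by rewrite inE cs orbT.
by move=> e; rewrite inE => /orP[/eqP ->|/hc //]; exact: ltW.
Qed.

(* All the levels meeting the hull, except the two extreme ones, lie between two
   points of U, and their nu-measures add up to at most r. *)
Let hull_bound k (U : set R) (r : R) : 0 <= r ->
  (forall x y, U x -> U y -> d x y <= r) ->
  (mu (hull U `&` tower k) <= ((r / w k + 2) / N k)%:E)%E.
Proof.
move=> r0 Ur.
pose s := [seq a <- F k | `[< E a `&` hull U !=set0 >]].
have us : uniq s by rewrite filter_uniq.
have sF : {subset s <= F k} by move=> a; rewrite mem_filter => /andP[].
have ssize : (size s)%:R <= r / w k + 2.
  have [->|s0] := eqVneq s [::]; first by rewrite addr_ge0 // divr_ge0 // ltW.
  have [a1 a1s ha1] := seq_min lo s0.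
  have [a2 a2s ha2] := seq_min (fun a => - lo a) s0.
  pose s' := [seq a <- s | (a != a1) && (a != a2)].
  have s's : {subset s' <= s} by move=> a; rewrite mem_filter => /andP[].
  have size_s : (size s <= size s' + 2)%N.
    rewrite (_ : (size s' + 2)%N = size (a1 :: a2 :: s')); last by rewrite addn2.
    apply: uniq_leq_size => // a as'; rewrite !inE mem_filter as' andbT.
    by case: eqP; case: eqP.
  have size_s' : (size s')%:R * w k <= r.
    have [->|s'0] := eqVneq s' [::]; first by rewrite mul0r.
    have mem a : a \in s -> exists2 z, E a z & hull U z.
      by rewrite mem_filter => /andP[/asboolP[z [? ?]] _]; exists z.
    have [z1 z1E [x1 [y1 [Ux1 _ /andP[xz1 _]]]]] := mem _ a1s.
    have [z2 z2E [x2 [y2 [_ Uy2 /andP[_ zy2]]]]] := mem _ a2s.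
    have sub a : a \in s' -> E a `<=` `[x1, y2].
      rewrite mem_filter => /andP[/andP[aa1 aa2] as'] z.
      have := E_disj (sF _ as') (sF _ a1s) aa1; have := ha1 _ as'.
      have := E_disj (sF _ as') (sF _ a2s) aa2; have := ha2 _ as'.
      move: z1E z2E; rewrite /E /= !in_itv /= => /andP[? ?] /andP[? ?] ? ? ? ?.
      move=> /andP[? ?]; apply/andP; split; lra.
    have xy : x1 <= y2.
      have [a as'] : exists a, a \in s'.
        by case: (s') s'0 => // b t' _; exists b; rewrite mem_head.
      have [z za _] := mem _ (s's _ as').
      by have := sub _ as' _ za; rewrite /= in_itv /= => /andP[/le_trans h /h].
    rewrite -lee_fin; apply: (@le_trans _ _ (nu (\bigcup_(a in [set` s']) E a))).
      rewrite (measure_sub nu (k := k)) ?filter_uniq //; last first.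
        by move=> a /s's /sF.
      rewrite (eq_big_seq (fun=> (w k)%:E)); last first.
        by move=> a /s's /sF ha; exact: nuE.
      by rewrite sumEFin big_const_seq count_predT iter_addr_0 mulr_natl.
    apply: (@le_trans _ _ (d x1 y2)%:E); last by rewrite lee_fin; exact: Ur.
    rewrite /measure_dist fineK; last first.
      by apply: fin_num_measure; exact: measurable_itv.
    rewrite (min_idPl xy) (max_idPr xy); apply: le_measure; rewrite ?inE.
    - by apply: fin_bigcup_measurable => // a _; exact: mE.
    - exact: measurable_itv.
    - by move=> z [a /= /sub]; exact.
  have : (size s)%:R <= (size s')%:R + 2 :> R by rewrite -natrD ler_nat.
  have : (size s')%:R <= r / w k by rewrite ler_pdivlMr.
  lra.
apply: (@le_trans _ _ (mu (\bigcup_(a in [set` s]) E a))).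
  apply: le_measure; rewrite ?inE.
  - apply: measurableI => //; apply: fin_bigcup_measurable => // a _; exact: mE.
  - by apply: fin_bigcup_measurable => // a _; exact: mE.
  move=> z [zU [a /= aF za]]; exists a => //=; rewrite mem_filter aF andbT.
  by apply/asboolP; exists z.
rewrite (measure_sub mu (k := k)) //.
apply: (@le_trans _ _ (\sum_(a <- s) (N k)^-1%:E)%E).
  rewrite big_seq_cond [leRHS]big_seq_cond; apply: lee_sum => a /andP[/sF ha _].
  exact: muE ha.
rewrite sumEFin big_const_seq count_predT iter_addr_0 lee_fin -[leLHS]mulr_natl.
by rewrite ler_wpM2r // invr_ge0 ltW.
Qed.

Let four_pow k : 4 ^+ k <= 4 * N k.
Proof.
rewrite -natrX -natrM ler_nat (@leq_trans (4 * 2 ^ (k * k))) //; last first.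
  by rewrite leq_mul2l N_growth orbT.
have -> : (4 ^ k = 2 ^ (2 * k))%N by rewrite expnM.
have -> : (4 * 2 ^ (k * k) = 2 ^ (2 + k * k))%N by rewrite expnD.
by rewrite leq_exp2l //; case: k => [|[|k]] //; nia.
Qed.

Let scale (r : R) K : 0 < r -> r < w K ->
  exists2 k, (K <= k)%N & w k.+1 <= r < w k.
Proof.
move=> r0 rK.
have w_small k : w k <= 4 * 4^-1 ^+ k.
  have h := four_pow k.
  rewrite exprVn ler_pdivlMr ?exprn_gt0 //.
  apply: (@le_trans _ _ (w k * (4 * N k))); first by rewrite ler_wpM2l // ltW.
  by have := wN_le1 k; lra.
have ex : exists k, (K <= k)%N && (w k.+1 <= r).
  have : (fun k : nat => (4 : R) * 4^-1 ^+ k) @ \oo --> 0.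
    by apply: cvg_geometric; rewrite ger0_norm //; lra.
  move=> /cvgrPdist_le /(_ _ r0) [k _ hk]; exists (maxn K k).
  rewrite leq_maxl /=; apply: le_trans (w_small _) _.
  have := hk (maxn K k).+1 (leqW (leq_maxr _ _)).
  by rewrite sub0r normrN ger0_norm // mulr_ge0 // exprn_ge0.
case: (ex_minnP ex) => k /andP[Kk wk] mink; exists k => //; rewrite wk /=.
move: Kk; rewrite leq_eqVlt => /orP[/eqP <- //|Kk].
case: k Kk wk mink => // k Kk wk mink; rewrite ltNge; apply/negP => wr.
by have := mink k; rewrite wr andbT => /(_ Kk); rewrite ltnn.
Qed.

(** Suppose $s<1$ has measure zero. For $w_{k+1}\le r<w_k$ a set of diameter at most $r$ has hull
    mass, inside the late towers, at most $3r/(w_{k+1}N_{k+1})\le 3C\,r\,M^{k+1}$. Superexponential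
    growth gives $M^{k+1}\le N_k^{1-s}\le r^{s-1}$, so this is at most $3C\,r^s$. *)
Lemma hausdorff_dim_measure_ge1 : (1 <= hausdorff_dim_measure mu d)%E.
Proof.
have mT k : measurable (tower k).
  by apply: fin_bigcup_measurable => // a _; exact: mE.
apply: le_ereal_inf_tmp => _ [S [mS SU S1] <-].
apply: le_ereal_inf_tmp => _ [s [s0 Hs] <-]; rewrite lee_fin leNgt.
apply/negP => s1.
have rho0 : 0 < 1 - s by rewrite subr_gt0.
have [k0 hk0] := exp_le_superexp M1 rho0.
(* From stage 4 on, $2(K+k)\ge 3+(k+K+1)$, so the discarded mass $7/4^{K+k}$ is at most
   $\frac78/2^{k+K+1}$, a summable bound in dyadic form. *)
pose K := maxn k0 4.
have [Kk0 K4] : (k0 <= K)%N /\ (4 <= K)%N by rewrite leq_maxl leq_maxr.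
pose G : set (measurableTypeR R) := \bigcap_k tower (K + k)%N.
have mG : measurable G by apply: bigcap_measurable => // k _; exact: mT.
have GC : (mu (~` G) <= (1 / 2)%:E)%E.
  have tC k : (mu (~` tower (K + k)%N) <= (7 / 8 / (2 ^ (k + K.+1))%:R)%:E)%E.
    rewrite probability_setC // leeBlDr ?fin_num_measure //.
    have := conc (K + k)%N; rewrite -[X in (X + _)%E]/(_%:E) => h.
    apply: (@le_trans _ _ ((7 / 8 / (2 ^ (k + K.+1))%:R)%:E +
       (1 - 7 / 4 ^+ (K + k))%:E)%E); last by rewrite leeD2l.
    rewrite -EFinD lee_fin.
    suff : 7 / 4 ^+ (K + k) <= 7 / 8 / (2 ^ (k + K.+1))%:R :> R by lra.
    rewrite -mulrA -invfM ler_wpM2l // lef_pV2 ?posrE ?mulr_gt0 ?exprn_gt0 ?ltr0n ?expn_gt0 //.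
    rewrite -natrX -natrM ler_nat (_ : 8 = 2 ^ 3)%N // -expnD.
    rewrite (_ : 4 = 2 ^ 2)%N // -expnM leq_exp2l //; lia.
  apply: (@le_trans _ _ (\sum_(k <oo) mu (~` tower (K + k)%N))%E).
    apply: measure_sigma_subadditive => [k||]; [exact: measurableC|exact: measurableC|].
    by rewrite /G setC_bigcap.
  apply: (@le_trans _ _ (\sum_(k <oo) (7 / 8 / (2 ^ (k + K.+1))%:R)%:E)%E).
    by apply: lee_nneseries.
  have := @cvg_geometric_eseries_half R (7 / 8) K.
  move=> /(cvg_lim (@ereal_hausdorff R)) ->; rewrite lee_fin.
  rewrite ler_pdivrMr ?exprn_gt0 //.
  have : 2 ^+ 4 <= 2 ^+ K :> R by rewrite ler_weXn2l //; lra.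
  lra.
have Gk k (A : set (measurableTypeR R)) : (K <= k)%N -> measurable A ->
    (mu (A `&` G) <= mu (A `&` tower k))%E.
  move=> Kk mA; apply: le_measure; rewrite ?inE; [exact: measurableI|exact: measurableI|].
  by move=> x [Ax Gx]; split=> //; have := Gx (k - K)%N Logic.I; rewrite subnKC.
pose C' := 3 * C.
have key (U : set R) (r : R) : 0 < r -> r < w K ->
    (forall x y, U x -> U y -> d x y <= r) ->
    (mu (hull U `&` G) <= (C' * r `^ s)%:E)%E.
  move=> r0 rK Ur; have [k Kk /andP[w1 w2]] := scale r0 rK.
  have mH : measurable (hull U) by exact: measurable_hull.
  apply: (le_trans (Gk k.+1 (hull U) (leqW Kk) mH)).
  apply: (le_trans (hull_bound k.+1 (ltW r0) Ur)); rewrite lee_fin.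
  have Nk : N k <= r^-1.
    have := wN_le1 k => h; rewrite -[r^-1]mul1r ler_pdivlMr //.
    apply: le_trans h; rewrite mulrC; apply: ler_wpM2r; [exact: ltW|exact: ltW].
  have Mk : M ^+ k.+1 <= r `^ (s - 1).
    apply: le_trans (hk0 _ (leq_trans Kk0 Kk)) _.
    have -> : r `^ (s - 1) = (r^-1) `^ (1 - s).
      by rewrite -powR_inv1 ?ltW // -powRrM; congr (_ `^ _); ring.
    apply: ge0_ler_powR; [exact: ltW|by rewrite nnegrE|by rewrite nnegrE invr_ge0 ltW|].
    by apply: le_trans Nk; rewrite ler_nat; exact: N_growth.
  (* The two extreme floors of [hull_bound] are absorbed because $r\ge w_{k+1}$. *)
  have r2 : r / w k.+1 + 2 <= 3 * r / w k.+1.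
    have : 1 <= r / w k.+1 by rewrite ler_pdivlMr // mul1r.
    lra.
  apply: (@le_trans _ _ (3 * r / w k.+1 / N k.+1)).
    by rewrite ler_wpM2r // invr_ge0 ltW.
  have inv_le : (w k.+1 * N k.+1)^-1 <= C * M ^+ k.+1.
    rewrite -[X in X <= _]mul1r ler_pdivrMr ?mulr_gt0 //; exact: wN_ge.
  rewrite -mulrA -invfM.
  apply: (@le_trans _ _ (3 * r * (C * r `^ (s - 1)))).
    apply: ler_wpM2l; [by rewrite mulr_ge0 // ltW|]; apply: le_trans inv_le _.
    by rewrite ler_wpM2l // (le_trans ler01).
  have e : r `^ s = r * r `^ (s - 1).
    rewrite -{2}[r]powRr1 ?ltW // -powRD; first by congr (_ `^ _); ring.
    by apply/implyP => _; rewrite gt_eqF.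
  by rewrite e /C'; lra.
have C'0 : 0 < C' by have := C1; rewrite /C'; lra.
(* Such a cover makes the mass of $S\cap G$ at most $1/4$; the complement of $G$ has mass at most
   $1/2$, so $S$ cannot have mass 1. The diameter bound $w_K/2$ keeps every $r$ strictly below
   $w_K$. *)
have [U [Uo Ud US] Usum] : exists2 U, open_cover unit_itv d S (w K / 2) U &
    (\sum_(i <oo) diam_pow d s (U i) < (1 / (4 * C'))%:E)%E.
  have wK2 : 0 < w K / 2 by rewrite divr_gt0.
  have := hausdorff_premeasure_eq0 Hs wK2.
  have e0 : (0 < (1 / (4 * C'))%:E :> \bar R)%E by rewrite lte_fin divr_gt0 // mulr_gt0.
  move=> h; move: e0; rewrite -{1}h => /ereal_inf_lt [_ [U cU ->] ltU].
  by exists U.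
have hull_le i : (mu (hull (U i) `&` G) <= C'%:E * diam_pow d s (U i))%E.
  have mH : measurable (hull (U i)) by exact: measurable_hull.
  have [U0|/set0P[x Ux]] := eqVneq (U i) set0.
    rewrite (_ : hull (U i) `&` G = set0) ?measure0 ?mule_ge0 ?diam_pow_ge0 //.
      by rewrite lee_fin ltW.
    by rewrite -subset0 U0 => z [[x [y []]]].
  have dxx : (0 <= diam d (U i))%E.
    apply: (@le_trans _ _ (d x x)%:E); first by rewrite lee_fin measure_dist_ge0.
    by apply: ereal_sup_ubound; exists x, x.
  have dfin : diam d (U i) \is a fin_num.
    by rewrite ge0_fin_numE //; apply: le_lt_trans (Ud i) (ltry _).
  pose r := fine (diam d (U i)).
  have dE : diam d (U i) = r%:E by rewrite fineK.
  have r0 : 0 <= r by exact: fine_ge0.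
  have rK : r <= w K / 2 by rewrite -lee_fin -dE.
  have wK0 := w_gt0 K.
  have Ur y z : U i y -> U i z -> d y z <= r.
    by move=> Uy Uz; rewrite -lee_fin -dE; apply: ereal_sup_ubound; exists y, z.
  have -> : diam_pow d s (U i) = (r `^ s)%:E.
    rewrite /diam_pow ifF; first by rewrite dE poweR_EFin.
    by apply/negbTE/set0P; exists x.
  rewrite -EFinM; have [r_gt0|] := ltP 0 r; first by apply: key => //; lra.
  (* No scale matches diameter 0; instead [hull_bound] with $r=0$ bounds the mass by $2/N_j$ at
     every late stage $j$. *)
  move=> r_le0; have rE : r = 0 by lra.
  apply: (@le_trans _ _ 0%:E); last by rewrite lee_fin mulr_ge0 ?powR_ge0 // ltW.
  apply/lee_addgt0Pr => e e0; rewrite add0e.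
  have [k hk] : exists k, forall i, (k <= i)%N -> 8 * 4^-1 ^+ i <= e.
    have : (fun k : nat => (8 : R) * 4^-1 ^+ k) @ \oo --> 0.
      by apply: cvg_geometric; rewrite ger0_norm //; lra.
    move=> /cvgrPdist_le /(_ _ e0) [k _ hk]; exists k => j kj.
    by have := hk j kj; rewrite sub0r normrN ger0_norm // mulr_ge0 // exprn_ge0.
  pose j := maxn K k.
  apply: (le_trans (Gk j _ (leq_maxl _ _) mH)).
  apply: (le_trans (hull_bound j r0 Ur)); rewrite lee_fin rE mul0r add0r.
  apply: le_trans (hk j (leq_maxr _ _)).
  rewrite ler_pdivrMr // exprVn -mulrA [_^-1 * _]mulrC mulrA ler_pdivlMr ?exprn_gt0 //.
  by have := four_pow j; lra.
have S12 : (mu (S `&` G) <= (1 / 4)%:E)%E.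
  apply: (@le_trans _ _ (\sum_(i <oo) mu (hull (U i) `&` G))%E).
    apply: measure_sigma_subadditive => [i||]; [|exact: measurableI|].
      by apply: measurableI => //; exact: measurable_hull.
    move=> x [Sx Gx]; have [i _ Uix] := US x Sx; exists i => //; split=> //.
    by exists x, x; rewrite lexx.
  apply: (@le_trans _ _ (\sum_(i <oo) C'%:E * diam_pow d s (U i))%E).
    by apply: lee_nneseries => i *; [exact: measure_ge0|exact: hull_le].
  rewrite nneseriesZl; last by move=> i _; exact: diam_pow_ge0.
  apply: (@le_trans _ _ (C'%:E * (1 / (4 * C'))%:E)%E).
    by rewrite lee_wpmul2l ?lee_fin ?ltW.
  rewrite -EFinM lee_fin (_ : C' * _ = 1 / 4) //.
  by field; rewrite gt_eqF.
have : (mu S <= mu (S `&` G) + mu (~` G))%E.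
  apply: le_trans (measureU2 _ _ _); [|exact: measurableI|exact: measurableC].
  apply: le_measure; rewrite ?inE //.
    by apply: measurableU; [exact: measurableI|exact: measurableC].
  by move=> x Sx; have [Gx|Gx] := pselect (G x); [left|right].
rewrite S1 => /le_trans /(_ (leeD S12 GC)).
by rewrite -EFinD lee_fin; lra.
Qed.

End LowerBound.

(** * Choice of the sequences *)

Section TowerDimension.
Variables m n : nat -> nat.
Hypothesis fg : fast_growth m n.
Context {R : realType}.
Variables f g v : nat -> 'I_4 -> R.
Hypotheses (famf : keane_family m n f) (famg : keane_family m n g)
  (famv : keane_family m n v).
Variables mu nu : probability (measurableTypeR R) R.
Hypothesis mu_level : forall k j a, a \in floors m n k j ->
  mu (level v a) = (f k j)%:E.
Hypothesis nu_level : forall k j a, a \in floors m n k j ->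
  nu (level v a) = (g k j)%:E.
Variable t : 'I_4.
Hypothesis mass : forall k, 1 - 7 / 4 ^+ k <= (height m n k t)%:R * f k t.

Local Notation floors := (floors m n).
Local Notation all_floors := (all_floors m n).
Local Notation b k p := ((height m n k p)%:R : R).

Let m1 k : (1 < m k.+1)%N. Proof. by have [] := fast_growth_gt1 fg k. Qed.
Let n1 k : (1 < n k.+1)%N. Proof. by have [] := fast_growth_gt1 fg k. Qed.
Let g0 : forall k p, 0 < g k p. Proof. by case: famg. Qed.
Let b1 k p : 1 <= b k p.
Proof. by rewrite ler1n height_gt0. Qed.

Let nu_atomless x : nu [set x] = 0%E.
Proof. exact: (transfer_atomless fg famg famv nu_level). Qed.

Let level_prop k j a : a \in floors k j ->
  [/\ measurable (level v a : set (measurableTypeR R)), level v a `<=` unit_itv,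
     0 < width g a &
     forall x y, level v a x -> level v a y -> measure_dist nu x y <= width g a].
Proof.
move=> ha; split.
- exact: measurable_level.
- exact: level_unit ha.
- by rewrite (width_floors m1 n1 g ha).
- move=> x y xa ya; rewrite (width_floors m1 n1 g ha).
  have -> : g k j = fine (nu (level v a)) by rewrite (nu_level ha).
  apply: measure_dist_le => //; first exact: measurable_level.
  exact: interval_is_interval.
Qed.

Let widths_small delta : 0 < delta ->
  exists K, forall k j a, (K <= k)%N -> a \in floors k j -> 2 * width g a <= delta.
Proof.
move=> d0; have [K hK] := family_small fg famg (divr_gt0 d0 (ltr0n _ 2)).
exists K => k j a Kk ha; rewrite (width_floors m1 n1 g ha).
by have := hK _ j Kk; lra.
Qed.

Lemma tower_conc (e : R) : 0 < e -> exists k0, forall k, (k0 <= k)%N ->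
  1 - e <= b k t * f k t.
Proof.
move=> e0; have [k0 hk0] := small_pow e0; exists k0.+1 => -[//|k] k0k.
apply: le_trans (mass k.+1); rewrite lerB //.
have := hk0 _ k0k; rewrite exprVn exprS invfM.
have : 0 < (4 ^+ k)^-1 :> R by rewrite invr_gt0 exprn_gt0.
lra.
Qed.

Let mu_tower k : mu (\bigcup_(a in [set` floors k t]) level v a) =
  (b k t * f k t)%:E.
Proof.
rewrite (measure_levels m1 n1 famv mu (k := k)); last 2 first.
- exact: uniq_floors.
- by move=> a ha; apply/mem_all_floors; exists t.
rewrite (eq_big_seq (fun=> (f k t)%:E)); last by move=> a; exact: mu_level.
by rewrite sumEFin big_const_seq count_predT iter_addr_0 mulr_natl.
Qed.

(** With $X=2^kb$ and $ks\ge1$, $2^k\,b\,(2g)^s=X(2g)^s\le(2gX^k)^s\le6^s$, so the sums over the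
    floors decay like $2^{-k}$ for every $s>0$. *)
Lemma hausdorff_dim_measure_eq0 :
  (forall k, ((2 ^ k * height m n k t) ^ k)%:R * g k t <= 3) ->
  hausdorff_dim_measure mu (measure_dist nu) = 0%E.
Proof.
move=> small; apply/eqP; rewrite eq_le; apply/andP; split; last first.
  by apply: le_ereal_inf_tmp => _ [S _ <-]; exact: hausdorff_dim_ge0.
apply: (hausdorff_dim_measure_le nu_atomless (F := floors ^~ t)
  (E := level v) (w := width g)) => //.
- by move=> k a ha; exact: level_prop ha.
- by move=> delta /widths_small[K hK]; exists K => k a; exact: hK.
- move=> e /tower_conc[k0 hk0]; exists k0 => k k0k.
  by rewrite mu_tower lee_fin; exact: hk0.
move=> s s0.
have [k0 hk0] : exists k0 : nat, s^-1 <= k0%:R.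
  by exists (Num.truncn s^-1).+1; apply: ltW; exact: truncnS_gt.
exists (6 `^ s), k0; split=> [|k k0k]; first exact: powR_ge0.
rewrite (eq_big_seq (fun=> (2 * g k t) `^ s)); last first.
  by move=> a ha; rewrite (width_floors m1 n1 g ha).
rewrite big_const_seq count_predT iter_addr_0 -[_ *+ _]mulr_natl.
rewrite -/(height m n k t) ler_pdivlMr ?exprn_gt0 //.
pose X : R := (2 ^ k * height m n k t)%:R.
have X1 : 1 <= X by rewrite ler1n muln_gt0 expn_gt0 height_gt0.
have XE : X = 2 ^+ k * b k t by rewrite /X natrM natrX.
have ks : 1 <= k%:R * s.
  rewrite -ler_pdivrMr // mul1r; apply: le_trans hk0 _.
  by rewrite ler_nat.
apply: (@le_trans _ _ ((2 * g k t) `^ s * X)); first by rewrite XE; lra.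
have Xk : X <= (X ^+ k) `^ s.
  rewrite -powR_mulrn ?(le_trans ler01) // -powRrM.
  by rewrite -{1}[X]powRr1 ?(le_trans ler01) //; exact: ler_powR.
have gk : 0 <= 2 * g k t by rewrite mulr_ge0 // ltW.
apply: (@le_trans _ _ ((2 * g k t) `^ s * (X ^+ k) `^ s)).
  by rewrite ler_wpM2l // powR_ge0.
have X0 : 0 <= X ^+ k by rewrite exprn_ge0 // (le_trans ler01).
rewrite -powRM //; apply: ge0_ler_powR.
- exact: ltW.
- by rewrite nnegrE mulr_ge0.
- by rewrite nnegrE.
by have := small k; rewrite natrX -/X; lra.
Qed.

(** For the upper bound the floors of all four towers serve as covers: $bg\le1$ gives
    $b(2g)^s\le2(2/b)^{s-1}$, and $b^{s-1}$ beats $2^{k+1}$ when $s>1$. The lower bound uses the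
    floors of the tower [t] alone. *)
Lemma hausdorff_dim_measure_eq1 (C M : R) : 1 <= C -> 1 <= M ->
  (forall k, (0 < k)%N -> 1 <= C * M ^+ k * (g k t * b k t)) ->
  hausdorff_dim_measure mu (measure_dist nu) = 1%E.
Proof.
move=> C1 M1 rate; apply/eqP; rewrite eq_le; apply/andP; split.
- apply: (hausdorff_dim_measure_le nu_atomless (F := all_floors)
    (E := level v) (w := width g)) => //.
  + by move=> k a /mem_all_floors[j ha]; exact: level_prop ha.
  + move=> delta /widths_small[K hK]; exists K => k a Kk /mem_all_floors[j ha].
    exact: hK ha.
  + move=> e e0; exists 0%N => k _.
    rewrite (_ : \bigcup_(a in _) _ = unit_itv); last first.
      apply/seteqP; split=> [x [a /= /mem_all_floors[j ha]]|x xu].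
        exact: (level_unit m1 n1 famv ha).
      by have [a ha xa] := level_cover m1 n1 famv k xu; exists a.
    by rewrite (transfer_unit fg famf famv mu_level) lee_fin; lra.
  move=> s s1; have rho0 : 0 < s - 1 by rewrite subr_gt0.
  have [k0 hk0] := @exp_le_superexp R 2 _ (ler1n _ 2) rho0.
  exists (4 * 2 `^ (s - 1)), k0; split=> [|k k0k].
    by rewrite mulr_ge0 // powR_ge0.
  have term j : b k j * (2 * g k j) `^ s <= 2 `^ (s - 1) / 2 ^+ k.
    have g2 : 0 < 2 * g k j by rewrite mulr_gt0.
    have gb := height_width_le1 m1 n1 famg k j.
    rewrite ler_pdivlMr ?exprn_gt0 //.
    have -> : (2 * g k j) `^ s = 2 * g k j * (2 * g k j) `^ (s - 1).
      by rewrite mulr_powRB1 ?ltW //; lra.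
    have h : 2 ^+ k.+1 <= b k j `^ (s - 1).
      apply: le_trans (hk0 _ k0k) _; apply: ge0_ler_powR; rewrite ?nnegrE //.
        exact: ltW.
      by rewrite ler_nat; exact: height_growth.
    have p0 := powR_ge0 (2 * g k j) (s - 1).
    have h2 : (2 * g k j) `^ (s - 1) * 2 ^+ k.+1 <= 2 `^ (s - 1).
      apply: (@le_trans _ _ ((2 * g k j) `^ (s - 1) * b k j `^ (s - 1))).
        by rewrite ler_wpM2l.
      rewrite -powRM ?(ltW g2) //; apply: ge0_ler_powR.
      - exact: ltW.
      - by rewrite nnegrE mulr_ge0 // ltW.
      - by rewrite nnegrE.
      by lra.
    have h3 : b k j * g k j * ((2 * g k j) `^ (s - 1) * 2 ^+ k.+1) <= 2 `^ (s - 1).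
      apply: le_trans h2; rewrite ler_piMl // mulr_ge0 // exprn_ge0 //.
    by move: h3; rewrite exprS; lra.
  rewrite sum_all_floors sum_ord4.
  have tow j : \sum_(a <- floors k j) (2 * width g a) `^ s <= 2 `^ (s - 1) / 2 ^+ k.
    apply: le_trans (term j).
    rewrite (eq_big_seq (fun=> (2 * g k j) `^ s)); last first.
      by move=> a ha; rewrite (width_floors m1 n1 g ha).
    by rewrite big_const_seq count_predT iter_addr_0 -[leLHS]mulr_natl.
  by have := tow ix1; have := tow ix2; have := tow ix3; have := tow ix4; lra.
apply: (hausdorff_dim_measure_ge1 (F := floors ^~ t) (lo := left_end v)
  (len := width v) (w := g ^~ t) _ _ _ _ _ _ _ C1 M1) => //.
- by move=> k; exact: uniq_floors.
- move=> k a c ha hc ac.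
  rewrite (width_floors m1 n1 v ha) (width_floors m1 n1 v hc).
  exact: (floors_disj m1 n1 famv ha hc ac).
- by move=> k a ha; exact: nu_level ha.
- move=> k a ha; rewrite -/(level v a) (mu_level ha) lee_fin.
  have b0 : 0 < b k t by exact: lt_le_trans (b1 k t).
  rewrite -[X in _ <= X]mul1r ler_pdivlMr // mulrC.
  exact: height_width_le1.
- by move=> k; rewrite mulrC; exact: height_width_le1.
- by move=> k; exact: height_growth.
- by move=> k; rewrite [X in (_ <= X)%E]mu_tower lee_fin.
Qed.

End TowerDimension.

Section Sequences.
Variables tame_n tame_m : bool.

(* Tame growth of [n_seq] gives dimension 1 to lambda_2, and tame growth of
   [m_seq] gives dimension 1 to lambda_3; the other growth gives dimension 0. *)
Definition next_term (tame : bool) (k x : nat) : nat :=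
  16 * x ^ (if tame then 1 else 1 + 2 * (k * k)).

(** The intermediate term of the other sequence is inlined to keep the recursion structural. The
    seed 1 at index 0 gives $n_1=256$ in all four cases, since the exponents at index 0 are 1. *)
Fixpoint n_seq (k : nat) : nat :=
  if k is i.+1 then next_term tame_n i (next_term tame_m i (n_seq i)) else 1.

Definition m_seq (k : nat) : nat := next_term tame_m k (n_seq k).

Let next_term_ge tame k x : (0 < x)%N -> (16 * x <= next_term tame k x)%N.
Proof.
move=> x0; rewrite /next_term leq_mul2l /=; case: tame; first by rewrite expn1.
by rewrite expnD expn1 leq_pmulr // expn_gt0 x0.
Qed.

Let n_seq_gt0 k : (0 < n_seq k)%N.
Proof.
elim: k => // k IH; apply: leq_trans (next_term_ge _ _ _).
  by rewrite muln_gt0 /= muln_gt0 /= expn_gt0 IH.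
by rewrite muln_gt0 /= expn_gt0 IH.
Qed.

Let m_seq_gt0 k : (0 < m_seq k)%N.
Proof. by rewrite muln_gt0 /= expn_gt0 n_seq_gt0. Qed.

Lemma fast_growth_seq : fast_growth m_seq n_seq.
Proof.
split; first by rewrite /= /next_term; case: tame_n; case: tame_m.
move=> k; split; first exact: next_term_ge.
exact: (next_term_ge tame_n k.+1 (m_seq_gt0 k.+1)).
Qed.

Lemma keane_condition_seq : keane_condition m_seq n_seq.
Proof.
have [n16 mn] := fast_growth_seq.
split=> [k _|[//|k] _|].
- by rewrite m_seq_gt0 n_seq_gt0.
- have [h1 h2] := mn k; have := n_seq_gt0 k.+1; lia.
- exact: leq_trans n16.
Qed.

End Sequences.

Theorem theorem2 (R : realType) (a b : R)
    (hab : (a, b) \in [:: (0, 0); (1, 0); (0, 1); (1, 1)]) :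
  exists m n : nat -> nat, keane_condition m n /\
  exists L2 L3 : 'cV[R]_4,
    [/\ is_keane_limit m n ix2 L2, is_keane_limit m n ix3 L3,
        open_simplex L2, open_simplex L3 &
        forall c : R, 0 <= c <= 1 ->
        exists lambda2 lambda3 : probability (measurableTypeR R) R,
          [/\ is_keane_measure (c *: L2 + (1 - c) *: L3) L2 lambda2,
              is_keane_measure (c *: L2 + (1 - c) *: L3) L3 lambda3 &
              (hausdorff_dim_measure lambda2 (measure_dist lambda3),
               hausdorff_dim_measure lambda3 (measure_dist lambda2))
              = (a%:E, b%:E)]].
Proof.
have [ta [tb [-> ->]]] : exists ta tb : bool, a = ta%:R /\ b = tb%:R.
  move: hab; rewrite !inE !xpair_eqE.
  by case/or4P => /andP[/eqP -> /eqP ->];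
    [exists false, false|exists true, false|exists false, true|exists true, true].
pose m := m_seq ta tb; pose n := n_seq ta tb.
have fg : fast_growth m n := fast_growth_seq ta tb.
exists m, n; split; first exact: keane_condition_seq.
exists (limit_pt m n ix2), (limit_pt m n ix3); split.
- exact: is_keane_limit_pt.
- exact: is_keane_limit_pt.
- exact: limit_pt_simplex.
- exact: limit_pt_simplex.
move=> c c01.
(* Lengths of the exchange at all stages. Both measures are transported to this one family, so they
   are invariant under the same map. *)
pose v k p : R := c * lam2 m n k p + (1 - c) * lam3 m n k p.
have fam2 := @lam2_family R m n fg; have fam3 := @lam3_family R m n fg.
have famv : keane_family m n v := keane_family_convex c01 fam2 fam3.
have [la2 la2E] := exists_mass_transfer fg fam2 famv.
have [la3 la3E] := exists_mass_transfer fg fam3 famv.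
have lv p : (c *: limit_pt m n ix2 + (1 - c) *: limit_pt m n ix3) p 0 = v 0%N p.
  by rewrite !mxE.
have conc2 := tower_conc (@lam2_mass R m n fg).
have conc3 := tower_conc (@lam3_mass R m n fg).
exists la2, la3; split.
- by apply: (transfer_keane_measure fg fam2 famv lv la2E _ conc2) => p; rewrite mxE.
- by apply: (transfer_keane_measure fg fam3 famv lv la3E _ conc3) => p; rewrite mxE.
have dim2 := hausdorff_dim_measure_eq1 fg fam2 fam3 famv la2E la3E
  (@lam2_mass R m n fg).
have dim3 := hausdorff_dim_measure_eq1 fg fam3 fam2 famv la3E la2E
  (@lam3_mass R m n fg).
congr (_, _).
- have [taT|taF] := boolP ta.
    have N1 : 1 <= 576 * (n 1)%:R :> R.
      have [n16 _] := fg; have : 16 <= (n 1)%:R :> R by rewrite ler_nat.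
      lra.
    apply: (dim2 _ 48 N1) => [|k _]; first by rewrite ler1n.
    apply: lam3_2_rate => // i.
    by rewrite (_ : n i.+2 = next_term ta i.+1 (m i.+1)) // /next_term taT expn1.
  rewrite [RHS](_ : _ = 0%E); last by rewrite ?(negbTE taF).
  apply: (hausdorff_dim_measure_eq0 fg fam3 famv la2E la3E
    (@lam2_mass R m n fg)) => k.
  apply: lam3_2_small => //.
  rewrite (_ : n k.+2 = next_term ta k.+1 (m k.+1)) //.
  by rewrite /next_term (negbTE taF).
- have [tbT|tbF] := boolP tb.
    apply: (dim3 64 64) => [||[//|k] _]; rewrite ?ler1n //.
    apply: lam2_3_rate => // i.
    by rewrite (_ : m i.+1 = next_term tb i.+1 (n i.+1)) // /next_term tbT expn1.
  rewrite [RHS](_ : _ = 0%E); last by rewrite ?(negbTE tbF).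
  apply: (hausdorff_dim_measure_eq0 fg fam2 famv la3E la2E
    (@lam3_mass R m n fg)) => k.
  apply: lam2_3_small => //.
  rewrite (_ : m k.+1 = next_term tb k.+1 (n k.+1)) //.
  by rewrite /next_term (negbTE tbF).
Qed.
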